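(* Assume the setting of the context, with correctly specified covariance model: $\boldsymbol\theta_0\in\Theta$ is the true covariance parameter vector, i.e. $\operatorname{var}(\mathbf Z)=\boldsymbol\Sigma_0=\boldsymbol\Sigma(\boldsymbol\theta_0)$ (so that $L_0(\boldsymbol\theta_0)=0$). Suppose the following conditions hold. (C1) $\lambda_{\min}(\boldsymbol\Sigma(\boldsymbol\theta))>0$ for all $n$ and $\boldsymbol\theta\in\Theta$, and $\limsup_{n\to\infty}\sup_{\boldsymbol\theta\in\Theta}\lambda_{\max}\big(\boldsymbol\Sigma^{-1/2}(\boldsymbol\theta)\boldsymbol\Sigma_0\boldsymbol\Sigma^{-1/2}(\boldsymbol\theta)\big)<\infty$. (C2) For $\alpha\in\mathcal A_n\setminus\mathcal A_n^0$ there exists $\boldsymbol\theta_\alpha\in\Theta$, not depending on $n$, such that $$\sup_{\alpha\in\mathcal A_n\setminus\mathcal A_n^0}\left|\frac{\ell(\alpha;\hat{\boldsymbol\theta}(\alpha))-\ell(\alpha;\boldsymbol\theta_\alpha)}{R(\alpha;\boldsymbol\theta_\alpha)-L_0(\boldsymbol\theta_0)}\right|=o_p(1),\qquad \sup_{\alpha\in\mathcal A_n\setminus\mathcal A_n^0}\left|\frac{L(\alpha;\hat{\boldsymbol\theta}(\alpha))-L(\alpha;\boldsymbol\theta_\alpha)}{R(\alpha;\boldsymbol\theta_\alpha)-L_0(\boldsymbol\theta_0)}\right|=o_p(1);$$ moreover $\sup_{\alpha\in\mathcal A_n^0}|\ell(\alpha;\hat{\boldsymbol\theta}(\alpha))-\ell(\alpha;\boldsymbol\theta_0)|=O_p(1)$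 and $\sup_{\alpha\in\mathcal A_n^0}|L(\alpha;\hat{\boldsymbol\theta}(\alpha))-L(\alpha;\boldsymbol\theta_0)|=O_p(1)$. (C3) With $\boldsymbol\theta_\alpha$ from (C2), $\lim_{n\to\infty}\sum_{\alpha\in\mathcal A_n\setminus\mathcal A_n^0}\frac{1}{(R(\alpha;\boldsymbol\theta_\alpha)-L_0(\boldsymbol\theta_0))^q}=0$ for some $q>0$. (C4) With $\boldsymbol\theta_\alpha$ from (C2), $\lim_{n\to\infty}\sup_{\alpha\in\mathcal A_n\setminus\mathcal A_n^0}\left|\frac{\operatorname{tr}\left(\boldsymbol\Sigma_0(\boldsymbol\Sigma_0^{-1}-\boldsymbol\Sigma^{-1}(\boldsymbol\theta_\alpha))\mathbf M(\alpha;\boldsymbol\theta_\alpha)\right)}{R(\alpha;\boldsymbol\theta_\alpha)-L_0(\boldsymbol\theta_0)}\right|=0$. (C5) With $\boldsymbol\theta_\alpha$ from (C2), $\sup_{\alpha\in\mathcal A_n\setminus\mathcal A_n^0}\left|\frac{\operatorname{tr}\left(((\boldsymbol\eta+\boldsymbol\epsilon)(\boldsymbol\eta+\boldsymbol\epsilon)'-\boldsymbol\Sigma_0)(\boldsymbol\Sigma^{-1}(\boldsymbol\theta_\alpha)-\boldsymbol\Sigma^{-1}(\boldsymbol\theta_0))\right)}{R(\alpha;\boldsymbol\theta_\alpha)-L_0(\boldsymbol\theta_0)}\right|=o_p(1)$. Let $\hat\alpha_2$ be the model selected by GIC with $\tau_n=2$ (i.e. AIC). Then: (i) If $|\mathcal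 A_n^0|\le 1$, then $\hat\alpha_2$ is asymptotically loss efficient. If, in addition, $|\mathcal A_n^0|=1$ and $\limsup_{n\to\infty}p(\alpha_n^0)<\infty$, then $\hat\alpha_2$ is consistent. (ii) If $|\mathcal A_n^0|\ge2$ for sufficiently large $n$ and either of the following is satisfied for some $m>0$: $$\text{(a)}\ \lim_{n\to\infty}\sum_{\alpha\in\mathcal A_n^0}\frac1{p^m(\alpha)}=0,\qquad \text{(b)}\ \lim_{n\to\infty}\sum_{\alpha\in\mathcal A_n^0\setminus\{\alpha_n^0\}}\frac1{(p(\alpha)-p(\alpha_n^0))^m}=0,$$ then $\hat\alpha_2$ is asymptotically loss efficient. If, in addition, (b) holds and $\limsup_{n\to\infty}p(\alpha_n^0)<\infty$, then $\hat\alpha_2$ is consistent.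
   Context: Data. For each $n$, data are observed at sites $\mathbf s_i=\mathbf s_{ni}$, $i=1,\dots,n$, in a region $D\subset\mathbb R^d$ (sites and region may vary with $n$; the dependence of all objects on $n$ is mostly suppressed): $Z(\mathbf s_i)=\mu_0(\mathbf s_i)+\eta(\mathbf s_i)+\epsilon(\mathbf s_i)$, where $\mu_0(\cdot)$ is the mean function, $\eta(\cdot)$ is a zero-mean Gaussian spatial process with $\sup_{\mathbf s\in D}\mathrm E(\eta^2(\mathbf s))<\infty$, and $\epsilon(\mathbf s_i)$ are Gaussian white-noise variables, independent of $\eta(\cdot)$. Write $\mathbf Z,\boldsymbol\eta,\boldsymbol\epsilon$ for the corresponding $n$-vectors, $\boldsymbol\mu_0=\mathrm E(\mathbf Z)$, and $\boldsymbol\Sigma_0=\operatorname{var}(\mathbf Z)=\operatorname{var}(\boldsymbol\eta+\boldsymbol\epsilon)$, so $\mathbf Z\sim N(\boldsymbol\mu_0,\boldsymbol\Sigma_0)$. Models. There are $p_n$ explanatory variables $x_1(\cdot),\dots,x_{p_n}(\cdot)$; $\mathbf X$ is the nonrandom $n\times(p_n+1)$ matrix with rows $(1,x_1(\mathbf s_i),\dots,x_{p_n}(\mathbf s_i))$. $\mathcal A_n\subseteq2^{\{1,\dots,p_n\}}$ is the set of candidate models ($\varnothing$ is the intercept-only model). For $\alpha\in\mathcal A_n$, $p(\alpha)$ is the number of elements of $\alpha$ and $\mathbf X(\alpha)$ is the $n\times(p(\alpha)+1)$ submatrix of $\mathbf X$ consisting of the column $\mathbf 1$ and the columns indexed by $\alpha$.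 Model $\alpha$ postulates $\mathbf Z=\mathbf X(\alpha)\boldsymbol\beta(\alpha)+\boldsymbol\eta+\boldsymbol\epsilon$ with covariance matrix $\boldsymbol\Sigma(\boldsymbol\theta)=\boldsymbol\Sigma_\eta+v^2\mathbf I$, where $\boldsymbol\Sigma_\eta$ is the model covariance matrix of $\boldsymbol\eta$, $v^2$ is the variance of the white noise, and $\boldsymbol\theta\in\Theta$ is the vector of covariance parameters; $\boldsymbol\Sigma(\boldsymbol\theta)$ is continuous in $\boldsymbol\theta\in\Theta$, and $\boldsymbol\Sigma^{-1}(\boldsymbol\theta)$ and $(\mathbf X'\boldsymbol\Sigma^{-1}(\boldsymbol\theta)\mathbf X)^{-1}$ exist for all $\boldsymbol\theta\in\Theta$. A model $\alpha$ is correct if $\mu_0(\mathbf s)$ can be written as $\beta_0+\sum_{j\in\alpha}\beta_jx_j(\mathbf s)$ for all $\mathbf s\in D$. $\mathcal A_n^0\subseteq\mathcal A_n$ is the set of correct models and, if it is nonempty, $\alpha_n^0=\arg\min_{\alpha\in\mathcal A_n^0}p(\alpha)$ is the smallest correct model. Likelihood and GIC. $\mathbf M(\alpha;\boldsymbol\theta)=\mathbf X(\alpha)(\mathbf X(\alpha)'\boldsymbol\Sigma^{-1}(\boldsymbol\theta)\mathbf X(\alpha))^{-1}\mathbf X(\alpha)'\boldsymbol\Sigma^{-1}(\boldsymbol\theta)$, $\mathbf A(\alpha;\boldsymbol\theta)=\mathbf I-\mathbf M(\alpha;\boldsymbol\theta)$, $\hat{\boldsymbol\mu}(\alpha;\boldsymbol\theta)=\mathbf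 M(\alpha;\boldsymbol\theta)\mathbf Z$. The profile log-likelihood is $$\ell(\alpha;\boldsymbol\theta)=-\tfrac n2\log(2\pi)-\tfrac12\log\det\boldsymbol\Sigma(\boldsymbol\theta)-\tfrac12(\mathbf Z-\hat{\boldsymbol\mu}(\alpha;\boldsymbol\theta))'\boldsymbol\Sigma^{-1}(\boldsymbol\theta)(\mathbf Z-\hat{\boldsymbol\mu}(\alpha;\boldsymbol\theta)),$$ and the ML estimate $\hat{\boldsymbol\theta}(\alpha)\in\Theta$ satisfies $\ell(\alpha;\hat{\boldsymbol\theta}(\alpha))=\sup_{\boldsymbol\theta\in\Theta}\ell(\alpha;\boldsymbol\theta)$. For a tuning parameter $\tau_n$, the generalized information criterion (GIC) is $\Gamma_{\tau_n}(\alpha)=-2\ell(\alpha;\hat{\boldsymbol\theta}(\alpha))+\tau_np(\alpha)$, and $\hat\alpha_{\tau_n}=\arg\min_{\alpha\in\mathcal A_n}\Gamma_{\tau_n}(\alpha)$. Losses. $L_0(\boldsymbol\theta)=\tfrac12\{\log\det\boldsymbol\Sigma(\boldsymbol\theta)-\log\det\boldsymbol\Sigma_0+\operatorname{tr}(\boldsymbol\Sigma_0\boldsymbol\Sigma^{-1}(\boldsymbol\theta))-n\}$. The Kullback–Leibler loss is $$L(\alpha;\boldsymbol\theta)=L_0(\boldsymbol\theta)+\tfrac12(\hat{\boldsymbol\mu}(\alpha;\boldsymbol\theta)-\boldsymbol\mu_0)'\boldsymbol\Sigma^{-1}(\boldsymbol\theta)(\hat{\boldsymbol\mu}(\alpha;\boldsymbol\theta)-\boldsymbol\mu_0),$$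 and for fixed $\boldsymbol\theta$, $R(\alpha;\boldsymbol\theta)=\mathrm E(L(\alpha;\boldsymbol\theta))$. A selection procedure $\hat\alpha$ is consistent if $\lim_{n\to\infty}P\{\hat\alpha=\alpha_n^0\}=1$, and asymptotically loss efficient if $L(\hat\alpha;\hat{\boldsymbol\theta}(\hat\alpha))/\min_{\alpha\in\mathcal A_n}L(\alpha;\hat{\boldsymbol\theta}(\alpha))\to1$ in probability as $n\to\infty$. $\lambda_{\min},\lambda_{\max}$ denote smallest and largest eigenvalues; $|\mathcal B|$ denotes the number of elements of a set $\mathcal B$. Convention: $1/0=+\infty$. *)

(* Defs.v *)
From HB Require Import structures.
From mathcomp Require Import all_boot all_order all_algebra finmap.
From mathcomp Require Import all_classical all_reals all_analysis.
Import Order.TTheory GRing.Theory Num.Theory.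
Import numFieldNormedType.Exports.

Set Implicit Arguments.
Unset Strict Implicit.
Unset Printing Implicit Defensive.

Local Open Scope classical_set_scope.
Local Open Scope ring_scope.

Section matrices.
Context {R : realType} {n : nat}.
Implicit Type A : 'M[R]_n.

Definition quad A (v : 'cV[R]_n) : R := (v^T *m A *m v) 0 0.

Definition psdmx A : Prop := A^T = A /\ forall v, 0 <= quad A v.

(* A^{-1/2}, for A symmetric positive definite: the unique positive
   semidefinite square root of A^{-1}. *)
Definition invsqrtmx A : 'M[R]_n :=
  xget 0 [set B | psdmx B /\ B *m B = invmx A].

(* Only used for matrices with real spectrum and n > 0, for which the set of
   (real) eigenvalues is finite and nonempty. *)
Definition lambda_max A : R := sup [set a | eigenvalue A a].
Definition lambda_min A : R := inf [set a | eigenvalue A a].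

End matrices.

Section probability_notions.
Context {R : realType} {d : measure_display} {T : measurableType d}
        (P : probability T R).

(* The case s = 0 is a point mass: the library's normal_prob is a junk
   (uniform) distribution there. *)
Definition normal_law (m s : R) (B : set R) : \bar R :=
  if s == 0 then \d_m B else normal_prob m s B.

Definition has_normal_law (X : T -> R) (m s : R) : Prop :=
  forall B, measurable B -> P (X @^-1` B) = normal_law m s B.

Definition gaussian_process {I : Type} (D : set I) (X : I -> T -> R) : Prop :=
  forall (m : nat) (s : 'I_m -> I) (c : 'I_m -> R), (forall j, D (s j)) ->
  exists mean sd, 0 <= sd /\
    has_normal_law (fun w => \sum_(j < m) c j * X (s j) w) mean sd.

Definition generated_sigma {I : Type} (D : set I) (X : I -> T -> R) :
    set (set T) :=
  <<s \bigcup_(i in D) preimage_set_system setT (X i) measurable >>.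

Definition indep_families (F G : set (set T)) : Prop :=
  forall A B, F A -> G B -> P (A `&` B) = (P A * P B)%E.

Definition mutually_indep {N : nat} (X : 'I_N -> T -> R) : Prop :=
  forall B : 'I_N -> set R, (forall i, measurable (B i)) ->
  P (\bigcap_(i in [set: 'I_N]) (X i @^-1` B i)) =
  (\prod_(i < N) P (X i @^-1` B i))%E.

End probability_notions.

(* Convergence in probability only involves the n-th law, so the probability
   space may change with n. *)
Section stochastic_orders.
Context {R : realType} {disp : nat -> measure_display}
        {T : forall n, measurableType (disp n)}
        (P : forall n, probability (T n) R).

Definition is_op1 (X : forall n, T n -> R) : Prop :=
  forall e : R, 0 < e ->
  (fun n => P n [set w | e < `|X n w|]) @ \oo --> 0%E.

Definition is_Op1 (X : forall n, T n -> R) : Prop :=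
  forall e : R, 0 < e -> exists M : R,
  \forall n \near \oo, (P n [set w | (M < `|X n w|)%R] <= e%:E)%E.

Definition cvg_in_prob (X : forall n, T n -> R) (l : R) : Prop :=
  is_op1 (fun n w => X n w - l).

End stochastic_orders.

(* Everything observed or postulated for one sample of size N; k is the number
   of covariance parameters and p that of explanatory variables (indexed from
   0). Sigma_eta and noise_var are those of the model; the true covariance
   structure is carried by the random variables eta and eps. *)
Record setting (R : realType) (d : measure_display) (T : measurableType d)
    (P : probability T R) (dim k p N : nat) := Setting {
  region : set 'rV[R]_dim;
  site : 'I_N -> 'rV[R]_dim;
  mean_fun : 'rV[R]_dim -> R;
  covariate : 'I_p -> 'rV[R]_dim -> R;
  eta : 'rV[R]_dim -> {RV P >-> R};
  eps : 'I_N -> {RV P >-> R};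
  cand : {set {set 'I_p}};
  Sigma_eta : 'rV[R]_k -> 'M[R]_N;
  noise_var : 'rV[R]_k -> R }.

Section setting_theory.
Context {R : realType} {d : measure_display} {T : measurableType d}
        {P : probability T R} {dim k p N : nat}
        (S : setting P dim k p N).
Implicit Types (a : {set 'I_p}) (th : 'rV[R]_k) (w : T).

Definition noise_vec w : 'cV[R]_N := \col_i (eta S (site S i) w + eps S i w).

Definition Z w : 'cV[R]_N := \col_i mean_fun S (site S i) + noise_vec w.

Definition mu0 : 'cV[R]_N := \col_i fine 'E_P[fun w => Z w i 0].

Definition Sigma0 : 'M[R]_N :=
  \matrix_(i, j) fine (covariance P (fun w => Z w i 0) (fun w => Z w j 0)).

Definition covariates : 'M[R]_(N, p) := \matrix_(i, j) covariate S j (site S i).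

Definition Xmat : 'M[R]_(N, 1 + p) := row_mx (const_mx 1) covariates.

Definition Xsub a : 'M[R]_(N, 1 + #|a|) :=
  row_mx (const_mx 1) (colsub (@enum_val _ (mem a)) covariates).

Definition Sigma th : 'M[R]_N := Sigma_eta S th + (noise_var S th)%:M.

Definition correct_model a : Prop :=
  exists (b0 : R) (b : 'I_p -> R), forall s, region S s ->
    mean_fun S s = b0 + \sum_(j in a) b j * covariate S j s.

Definition correct : {set {set 'I_p}} :=
  [set a in cand S | `[< correct_model a >]].

Definition incorrect : {set {set 'I_p}} := cand S :\: correct.

Definition smallest_correct a : Prop :=
  a \in correct /\ forall b, b \in correct -> (#|a| <= #|b|)%N.

Definition Mmx a th : 'M[R]_N :=
  Xsub a *m invmx ((Xsub a)^T *m invmx (Sigma th) *m Xsub a)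
    *m (Xsub a)^T *m invmx (Sigma th).

Definition muhat a th w : 'cV[R]_N := Mmx a th *m Z w.

Definition loglik a th w : R :=
  - (N%:R / 2) * ln (2 * pi) - ln (\det (Sigma th)) / 2
  - quad (invmx (Sigma th)) (Z w - muhat a th w) / 2.

Definition L0 th : R :=
  (ln (\det (Sigma th)) - ln (\det Sigma0)
   + \tr (Sigma0 *m invmx (Sigma th)) - N%:R) / 2.

Definition loss a th w : R :=
  L0 th + quad (invmx (Sigma th)) (muhat a th w - mu0) / 2.

Definition risk a th : R := fine 'E_P[loss a th].

Record standing_assumptions (Theta : set 'rV[R]_k) : Prop := {
  site_region : forall i, region S (site S i);
  eta_gaussian : gaussian_process P (region S) (fun s => eta S s);
  eta_centered : forall s, region S s -> 'E_P[eta S s]%E = 0%E;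
  eta_sup_var :
    (ereal_sup [set 'E_P[fun w => ((eta S s w : R) ^+ 2)%R] | s in region S] < +oo)%E;
  eps_normal : exists2 v : R, 0 <= v &
    forall i, has_normal_law P (eps S i) 0 (Num.sqrt v);
  eps_indep : mutually_indep P (fun i => eps S i);
  eps_eta_indep : indep_families P
    (generated_sigma (region S) (fun s => eta S s))
    (generated_sigma setT (fun i => eps S i));
  Sigma_eta_psd : forall th, Theta th -> psdmx (Sigma_eta S th);
  noise_var_ge0 : forall th, Theta th -> 0 <= noise_var S th;
  Sigma_continuous : {within Theta, continuous Sigma};
  Sigma_unit : forall th, Theta th -> Sigma th \in unitmx;
  XSX_unit : forall th, Theta th -> Xmat^T *m invmx (Sigma th) *m Xmat \in unitmx }.

Section estimation.
Variable thetahat : {set 'I_p} -> T -> 'rV[R]_k.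

(* Measurability is with respect to the Borel sigma-algebra. *)
Definition ML_estimator (Theta : set 'rV[R]_k) : Prop :=
  forall a, a \in cand S ->
  [/\ measurable_fun setT
        (thetahat a : T -> g_sigma_algebraType (@open 'rV[R]_k)),
      forall w, Theta (thetahat a w) &
      forall w th, Theta th -> loglik a th w <= loglik a (thetahat a w) w].

Definition GIC (tau : R) a w : R :=
  - 2 * loglik a (thetahat a w) w + tau * #|a|%:R.

Definition GIC_selected (tau : R) (ahat : T -> {set 'I_p}) : Prop :=
  [/\ forall a, measurable (ahat @^-1` [set a]),
      forall w, ahat w \in cand S &
      forall w a, a \in cand S -> GIC tau (ahat w) w <= GIC tau a w].

Definition min_loss w : R :=
  inf [set loss a (thetahat a w) w | a in [set a | a \in cand S]].

Definition loss_ratio (ahat : T -> {set 'I_p}) w : R :=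
  loss (ahat w) (thetahat (ahat w) w) w / min_loss w.

End estimation.

(* Suprema over the finite set of incorrect, resp. correct, candidates. *)
Definition sup_incorrect (f : {set 'I_p} -> R) : R :=
  \big[Num.max/0]_(a in incorrect) `|f a|.
Definition sup_correct (f : {set 'I_p} -> R) : R :=
  \big[Num.max/0]_(a in correct) `|f a|.

End setting_theory.

(* A model as a set of natural numbers, so that the same model can be
   recognised in samples having different numbers of explanatory variables. *)
Definition model_index {p : nat} (a : {set 'I_p}) : {fset nat} :=
  [fset val i | i in a]%fset.

Section selection_properties.
Context {R : realType} {dim k : nat} {disp : nat -> measure_display}
        {T : forall n, measurableType (disp n)}
        (P : forall n, probability (T n) R) {p N : nat -> nat}
        (S : forall n, setting (P n) dim k (p n) (N n)).

Definition asymptotically_loss_efficient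
    (thetahat : forall n, {set 'I_(p n)} -> T n -> 'rV[R]_k)
    (ahat : forall n, T n -> {set 'I_(p n)}) : Prop :=
  cvg_in_prob P (fun n => loss_ratio (S n) (thetahat n) (ahat n)) 1.

Definition consistent (alpha0 : forall n, {set 'I_(p n)})
    (ahat : forall n, T n -> {set 'I_(p n)}) : Prop :=
  (fun n => P n (ahat n @^-1` [set alpha0 n])) @ \oo --> 1%E.

End selection_properties.

(* Main.v *)
Require Import Defs.
From HB Require Import structures.
From mathcomp Require Import all_boot all_order all_algebra finmap.
From mathcomp Require Import all_classical all_reals all_analysis.
From mathcomp Require Import measurable_realfun.
From mathcomp Require Import ring lra complex.
Import Order.TTheory GRing.Theory Num.Theory.
Import numFieldNormedType.Exports.

(* Up to a term common to all models, GIC with tau = 2 is twice the loss plus a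
   linear and a quadratic form of the Gaussian noise: the expectation of the
   quadratic form is the number 1 + p(alpha) of regression parameters, so the
   penalty 2 p(alpha) cancels the optimism of the likelihood.  Let D(alpha) be
   the risk of an incorrect model and (1 + p(alpha)) / 2 for a correct one.
   Both forms deviate by more than delta D(alpha) with probability at most
   4 exp (- kappa D(alpha)), and (C3), resp. (a) or (b), makes these bounds
   summable over the models with sum tending to 0, since the exponential beats
   every power.  Hence criterion, loss and D agree up to a relative error
   O(delta), uniformly over all models but possibly alpha_n^0.  If p(alpha_n^0)
   is large, alpha_n^0 joins that uniform class; if it is bounded, both its
   criterion and its loss stay bounded while those of all other models
   diverge, so that alpha_n^0 is selected and minimises the loss.  In the latter
   case the loss ratio is 1 unless the minimal loss vanishes, which has
   probability 0. *)

Set Implicit Arguments.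
Unset Strict Implicit.
Unset Printing Implicit Defensive.

Local Open Scope classical_set_scope.
Local Open Scope ring_scope.

(** * Symmetric matrices *)

(** The tail bounds must not depend on the sample size. With S = Sigma^{-1}(theta), V = Sigma_0 and
    B = S M the matrix of the quadratic form in the noise, (C1) yields B V B <= c B: after
    diagonalisation all weights are at most c, so the variance of the form is of the order of its
    trace, hence of D(alpha). The data specify only the laws of linear combinations of the noise.
    These are handled through Fourier and Laplace transforms: independent sums become products, and
    a square in an exponent becomes linear through an auxiliary normal variable. The size
    p(alpha_n^0) may stay bounded along one subsequence and diverge along another. A threshold B,
    depending on the tolerated error and probability but not on n, decides for each n which of the
    two arguments applies; below it alpha_n^0 gets the weight of a model of size B, so that one
    union bound serves both cases. The null event is forced by the convention that 0 / 0 is 0: a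
    vanishing minimal loss would give the ratio 0 and not 1. *)

Section real_spectral.
Context {R : realType}.

(** Over [R[i]] the matrix is Hermitian, so the complex spectral theorem gives an eigenvalue, which
    is real; a real root of the characteristic polynomial descends to [R] because the embedding is a
    field morphism. *)
Lemma sym_eigenvalue (n : nat) (A : 'M[R]_n.+1) : A^T = A -> exists a, eigenvalue A a.
Proof.
move=> sA; pose f := real_complex R; pose C := map_mx f A.
have hC : C \is hermsymmx.
  apply: realsym_hermsym.
    apply/is_hermitianmxP; rewrite expr0 scale1r map_mx_id//.
    by rewrite /C -[in LHS]sA map_trmx.
  by apply/mxOverP => i j; rewrite mxE complex_real.
have nC := hermitian_normalmx hC.
have /orthomx_spectralP CE := nC.
pose a := spectral_diag C 0 0.
have ra : a \is Num.real by have /mxOverP := hermitian_spectral_diag_real hC; apply.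
have ea : eigenvalue C a.
  apply/eigenvalueP; exists (row 0 (spectralmx C)).
    have E : spectralmx C *m C = diag_mx (spectral_diag C) *m spectralmx C.
      by rewrite [X in _ *m X]CE !mulmxA mulmxV ?spectral_unit// mul1mx.
    by rewrite -row_mul E row_mul row_diag_mx -scalemxAl -rowE.
  apply/negP => /eqP r0.
  have := row_unitarymxP (spectral_unitarymx C) 0 0.
  by rewrite r0 eqxx; rewrite linear0l => /eqP; rewrite eq_sym oner_eq0.
move: ra ea; rewrite eigenvalue_root_char => /complex_realP [x ->].
rewrite -map_char_poly fmorph_root => rx.
by exists x; rewrite eigenvalue_root_char.
Qed.

Lemma row_norm_gt0 (n : nat) (v : 'rV[R]_n) : v != 0 -> 0 < (v *m v^T) 0 0.
Proof.
move=> v0; rewrite mxE.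
have [j vj] : exists j, v 0 j != 0.
  apply/existsP; apply: contra_neqT v0; rewrite negb_exists => /forallP h.
  by apply/rowP => j; rewrite mxE; apply/eqP; have := h j; rewrite negbK.
rewrite (bigD1 j)//= ltr_pwDl//; first by rewrite mxE -expr2 exprn_even_gt0.
by apply: sumr_ge0 => i _; rewrite mxE -expr2 sqr_ge0.
Qed.

(* Householder reflection exchanging v and the first basis vector. *)
Lemma orthogonal_completion (n : nat) (v : 'rV[R]_n.+1) : v *m v^T = 1%:M ->
  exists H : 'M[R]_n.+1, H *m H^T = 1%:M /\ row 0 H = v.
Proof.
move=> v1; pose e : 'rV[R]_n.+1 := delta_mx 0 0.
have tr11 (B : 'M[R]_1) : B^T = B by apply/matrixP => i j; rewrite !ord1 mxE.
have e1 : e *m e^T = 1%:M.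
  by rewrite /e trmx_delta mul_delta_mx; apply/matrixP => i j; rewrite !ord1 !mxE.
(* The reflection along [v - e] degenerates when [v = e]; the identity serves there. *)
have [ve|ve] := eqVneq v e.
  by exists 1%:M; rewrite trmx1 mulmx1 row1 ve.
pose u := v - e.
pose q := (u *m u^T) 0 0.
have q0 : q != 0 by rewrite gt_eqF// row_norm_gt0// subr_eq0.
have uu : u *m u^T = q%:M by rewrite [LHS]mx11_scalar.
pose s := (e *m v^T) 0 0.
have evs : e *m v^T = s%:M by rewrite [LHS]mx11_scalar.
have ves : v *m e^T = s%:M by rewrite -[LHS]tr11 trmx_mul trmxK.
have qE : q = 2 - 2 * s.
  rewrite /q /u linearB/= mulmxBr !mulmxBl v1 e1 evs ves !mxE !mulr1n; ring.
have eu : e *m u^T = (s - 1)%:M.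
  by rewrite /u linearB/= mulmxBr evs e1 raddfB.
have vE : e + u = v by rewrite addrCA subrr addr0.
clearbody u; pose H : 'M[R]_n.+1 := 1%:M - (2 / q) *: (u^T *m u).
have HT : H^T = H.
  by rewrite /H linearB/= trmx1 linearZ/= trmx_mul trmxK.
exists H; split.
  have QQ : (u^T *m u) *m (u^T *m u) = q *: (u^T *m u).
    by rewrite mulmxA -(mulmxA u^T) uu mul_mx_scalar -scalemxAl.
  rewrite HT /H mulmxBl mul1mx -scalemxAl mulmxBr mulmx1 -scalemxAr QQ.
  rewrite scalerA (_ : 2 / q * q = 2); last by field.
  by rewrite scaler_nat mulr2n opprD addrA subrr sub0r scalerN opprK subrK.
rewrite rowE -/e /H mulmxBr mulmx1 -scalemxAr mulmxA eu mul_scalar_mx scalerA.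
have -> : 2 / q * (s - 1) = -1.
  apply: (mulfI q0); rewrite mulrA mulrCA divff// mulr1 qE; ring.
by rewrite scaleN1r opprK.
Qed.

(** Deflation: an orthogonal matrix whose first row is a unit eigenvector conjugates [A] into block
    diagonal form with a 1 x 1 block, and the induction hypothesis applies to the other block. *)
Lemma real_spectral (n : nat) (A : 'M[R]_n) : A^T = A ->
  exists (O : 'M[R]_n) (d : 'rV[R]_n),
    O *m O^T = 1%:M /\ A = O^T *m diag_mx d *m O.
Proof.
elim: n A => [|n IH] A sA.
  exists 1%:M, 0; split; first by rewrite trmx1 mulmx1.
  by apply/matrixP => -[].
have [a /eigenvalueP [v vA v0]] := sym_eigenvalue sA.
have vv0 := row_norm_gt0 v0.
pose r := Num.sqrt ((v *m v^T) 0 0).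
have r0 : r != 0 by rewrite gt_eqF// sqrtr_gt0.
have w1 : (r^-1 *: v) *m (r^-1 *: v)^T = 1%:M.
  rewrite linearZ/= -scalemxAl -scalemxAr scalerA [X in _ *: X]mx11_scalar scale_scalar_mx.
  rewrite -[X in _ * X](sqr_sqrtr (ltW vv0)) -/r; congr (_%:M).
  by rewrite expr2 mulrACA mulVf// mulr1.
have [H [H1 Hv]] := orthogonal_completion w1.
have HT1 : H^T *m H = 1%:M by exact: mulmx1C.
pose B : 'M[R]_(1 + n) := H *m A *m H^T.
have sB : B^T = B by rewrite /B !trmx_mul trmxK sA mulmxA.
have B0 : row 0 B = a *: delta_mx 0 0.
  rewrite /B !row_mul Hv -scalemxAl vA scalerA mulrC -scalerA -Hv -scalemxAl -row_mul H1.
  by rewrite row1.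
have AE : A = H^T *m B *m H.
  by rewrite /B !mulmxA HT1 mul1mx -mulmxA HT1 mulmx1.
clearbody B.
have Bj (j : 'I_(1 + n)) : B 0 j = a * (j == 0)%:R.
  by move/rowP: B0 => /(_ j); rewrite !mxE eqxx.
have Bi (j : 'I_(1 + n)) : B j 0 = a * (j == 0)%:R.
  by rewrite -sB mxE Bj.
have l0 : lshift n 0 = 0 :> 'I_(1 + n) by exact: val_inj.
have Bb : B = block_mx a%:M 0 0 (drsubmx B).
  rewrite -[LHS]submxK; congr block_mx; apply/matrixP => i j; rewrite !mxE.
  - by rewrite !ord1 l0 Bj eqxx mulr1.
  - by rewrite !ord1 l0 Bj mulr0.
  - by rewrite !ord1 l0 Bi mulr0.
have sB' : (drsubmx B)^T = drsubmx B by rewrite trmx_drsub sB.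
have [Q [d [Q1 E]]] := IH _ sB'.
pose K : 'M[R]_(1 + n) := block_mx 1%:M 0 0 Q.
have K1 : K *m K^T = 1%:M.
  rewrite /K tr_block_mx !trmx0 trmx1 mulmx_block !mulmx0 !mul0mx !addr0 !add0r mulmx1 Q1.
  by rewrite -scalar_mx_block.
exists (K *m H), (row_mx a%:M d); split.
  by rewrite trmx_mul mulmxA -(mulmxA K) H1 mulmx1.
rewrite AE.
have -> : B = K^T *m diag_mx (row_mx a%:M d) *m K.
  rewrite Bb E diag_mx_row /K tr_block_mx !trmx0 trmx1 !mulmx_block.
  rewrite !(mulmx0, mul0mx, addr0, add0r, mul1mx, mulmx1).
  by congr block_mx; apply/matrixP => i j; rewrite !ord1 !mxE.
by rewrite trmx_mul !mulmxA.
Qed.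

End real_spectral.

Section psd_matrices.
Context {R : realType} {n : nat}.
Implicit Types (A B S : 'M[R]_n) (v : 'cV[R]_n).

Definition dotv (u v : 'cV[R]_n) : R := (u^T *m v) 0 0.

Lemma dotvE (u v : 'cV[R]_n) : dotv u v = \sum_i u i 0 * v i 0.
Proof. by rewrite /dotv mxE; apply: eq_bigr => i _; rewrite mxE. Qed.

Lemma dotvC (u v : 'cV[R]_n) : dotv u v = dotv v u.
Proof. by rewrite !dotvE; apply: eq_bigr => i _; rewrite mulrC. Qed.

Lemma quadE A v : quad A v = dotv v (A *m v).
Proof. by rewrite /quad /dotv mulmxA. Qed.

Lemma dotv_mulmxl A (u v : 'cV[R]_n) : dotv (A *m u) v = dotv u (A^T *m v).
Proof. by rewrite /dotv trmx_mul mulmxA. Qed.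

Lemma dotvDl (u v w : 'cV[R]_n) : dotv (u + v) w = dotv u w + dotv v w.
Proof. by rewrite /dotv linearD/= mulmxDl mxE. Qed.

Lemma dotvDr (u v w : 'cV[R]_n) : dotv u (v + w) = dotv u v + dotv u w.
Proof. by rewrite dotvC dotvDl !(dotvC u). Qed.

Lemma dotvZr (a : R) (u v : 'cV[R]_n) : dotv u (a *: v) = a * dotv u v.
Proof. by rewrite /dotv -scalemxAr mxE. Qed.

Lemma dotvNr (u v : 'cV[R]_n) : dotv u (- v) = - dotv u v.
Proof. by rewrite -scaleN1r dotvZr mulN1r. Qed.

Lemma dotvv_ge0 v : 0 <= dotv v v.
Proof. by rewrite dotvE; apply: sumr_ge0 => i _; rewrite -expr2 sqr_ge0. Qed.

Lemma dotvv_eq0 v : dotv v v = 0 -> v = 0.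
Proof.
move=> /eqP; apply: contraTeq => v0; rewrite gt_eqF//.
have := @row_norm_gt0 R n v^T; rewrite trmxK; apply.
by apply: contra_neq v0 => /(congr1 trmx); rewrite trmxK trmx0.
Qed.

Lemma quad_sandwich A B v : quad (B^T *m A *m B) v = quad A (B *m v).
Proof. by rewrite /quad trmx_mul !mulmxA. Qed.

Lemma quad_spectral (O : 'M[R]_n) (d : 'rV[R]_n) v :
  quad (O^T *m diag_mx d *m O) v = \sum_j d 0 j * ((O *m v) j 0) ^+ 2.
Proof.
rewrite quad_sandwich; move: (O *m v) => x.
rewrite quadE dotvE; apply: eq_bigr => j _.
by rewrite mul_diag_mx mxE; ring.
Qed.

Lemma dotvv_orthogonal (O : 'M[R]_n) v : O *m O^T = 1%:M ->
  dotv (O *m v) (O *m v) = dotv v v.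
Proof. by move=> /mulmx1C O1; rewrite dotv_mulmxl mulmxA O1 mul1mx. Qed.

Lemma quad_eigenvector (O : 'M[R]_n) (d : 'rV[R]_n) j : O *m O^T = 1%:M ->
  quad (O^T *m diag_mx d *m O) (col j O^T) = d 0 j.
Proof.
move=> O1; rewrite quad_spectral colE mulmxA O1 mul1mx.
rewrite (bigD1 j)//= big1 ?addr0 ?mxE ?eqxx ?expr1n ?mulr1// => i ij.
by rewrite mxE (negbTE ij) expr0n/= mulr0.
Qed.

Lemma psd_spectral_ge0 (O : 'M[R]_n) (d : 'rV[R]_n) j : O *m O^T = 1%:M ->
  psdmx (O^T *m diag_mx d *m O) -> 0 <= d 0 j.
Proof. by move=> O1 [_ h]; rewrite -(quad_eigenvector d j O1). Qed.

Lemma psdmx_sandwich A B : psdmx A -> psdmx (B^T *m A *m B).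
Proof.
move=> [sA pA]; split; first by rewrite !trmx_mul trmxK sA mulmxA.
by move=> v; rewrite quad_sandwich.
Qed.

Lemma psd_sqrt_exists A : psdmx A -> exists B, psdmx B /\ B *m B = A.
Proof.
move=> pA; have [Q [d [Q1 AE]]] := real_spectral pA.1.
have d0 j : 0 <= d 0 j by apply: (psd_spectral_ge0 _ Q1); rewrite -AE.
pose s := map_mx Num.sqrt d.
exists (Q^T *m diag_mx s *m Q); split; first split.
- by rewrite !trmx_mul trmxK tr_diag_mx mulmxA.
- move=> v; rewrite quad_spectral; apply: sumr_ge0 => j _.
  by rewrite mulr_ge0 ?sqr_ge0// mxE sqrtr_ge0.
- rewrite !mulmxA -(mulmxA (Q^T *m _)) Q1 mulmx1 -(mulmxA Q^T) mulmx_diag.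
  rewrite [RHS]AE; congr (_ *m diag_mx _ *m _); apply/rowP => j.
  by rewrite !mxE -expr2 sqr_sqrtr.
Qed.

(** If [A] is the square of a symmetric [B], then [quad A v] is the squared norm of [B *m v]. *)
Lemma psd_quad_eq0 A v : psdmx A -> quad A v = 0 -> A *m v = 0.
Proof.
move=> /psd_sqrt_exists [B [[sB _] BB]].
rewrite -BB quadE -mulmxA -{1}sB -dotv_mulmxl => /dotvv_eq0 ->.
by rewrite mulmx0.
Qed.

Lemma psd_quad_gt0 A v : psdmx A -> A \in unitmx -> v != 0 -> 0 < quad A v.
Proof.
move=> pA uA v0; rewrite lt_neqAle pA.2 andbT eq_sym.
apply: contra_neq v0 => /(psd_quad_eq0 pA) /(congr1 (mulmx (invmx A))).
by rewrite mulmxA mulVmx// mul1mx mulmx0.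
Qed.

Lemma psdmx_invmx A : psdmx A -> A \in unitmx -> psdmx (invmx A).
Proof.
move=> [sA pA] uA; have sI : (invmx A)^T = invmx A by rewrite trmx_inv sA.
split=> // v; rewrite -[invmx A]mul1mx -(mulVmx uA) -{1}sI quad_sandwich.
exact: pA.
Qed.

Lemma unitmx_square A B : B *m B = A -> A \in unitmx -> B \in unitmx.
Proof. by move=> <-; rewrite !unitmxE det_mulmx unitrM => /andP[]. Qed.

Lemma invsqrtmxP A : psdmx A -> A \in unitmx ->
  psdmx (invsqrtmx A) /\ invsqrtmx A *m invsqrtmx A = invmx A.
Proof.
move=> pA uA; rewrite /invsqrtmx; case: xgetP => [B _ []//|].
have [B BP] := psd_sqrt_exists (psdmx_invmx pA uA).
by move=> /(_ B); case.
Qed.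

Lemma unitmx_kernel A : (forall v, A *m v = 0 -> v = 0) -> A \in unitmx.
Proof.
move=> h; rewrite -unitmx_tr -row_free_unit -kermx_eq0; apply/eqP.
apply/row_matrixP => i; rewrite row0; apply: trmx_inj; rewrite trmx0; apply: h.
by apply: trmx_inj; rewrite trmx_mul trmxK -row_mul mulmx_ker row0 trmx0.
Qed.

End psd_matrices.

(** * The largest eigenvalue as a bound on quadratic forms *)

Section largest_eigenvalue.
Context {R : realType}.

Lemma quad_le_lambda_max (n : nat) (A : 'M[R]_n.+1) (v : 'cV[R]_n.+1) : A^T = A ->
  quad A v <= lambda_max A * dotv v v.
Proof.
move=> sA; have [Q [d [Q1 AE]]] := real_spectral sA.
have Q1' := mulmx1C Q1.
(* [lambda_max] is a supremum, so it dominates the [d 0 j] only once the spectrum is bounded; an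
   eigenvalue is a Rayleigh quotient, hence at most the sum of the [|d 0 j|]. *)
have ub : has_ubound [set a | eigenvalue A a].
  exists (\sum_j `|d 0 j|) => a /= /eigenvalueP[w wA w0].
  have w0' := row_norm_gt0 w0.
  rewrite -(ler_pM2r w0').
  have -> : a * (w *m w^T) 0 0 = quad A w^T.
    by rewrite /quad trmxK wA -scalemxAl [RHS]mxE.
  rewrite [in leLHS]AE quad_spectral.
  have -> : (w *m w^T) 0 0 = \sum_j ((Q *m w^T) j 0) ^+ 2.
    have := dotvv_orthogonal w^T Q1; rewrite {2}/dotv trmxK => <-.
    by rewrite dotvE; apply: eq_bigr => j _; rewrite expr2.
  rewrite mulr_sumr; apply: ler_sum => j _; rewrite ler_wpM2r ?sqr_ge0//.
  by rewrite (bigD1 j)//= (le_trans (ler_norm _))// lerDl sumr_ge0.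
have dle j : d 0 j <= lambda_max A.
  apply: ub_le_sup => //=; apply/eigenvalueP; exists (row j Q).
    rewrite AE !mulmxA -row_mul Q1 row1 -rowE row_diag_mx -scalemxAl.
    by rewrite -rowE.
  apply/eqP => r0; have : row j (Q *m Q^T) = 0 by rewrite row_mul r0 mul0mx.
  by rewrite Q1 row1 => /rowP/(_ j); rewrite !mxE !eqxx => /eqP; rewrite oner_eq0.
rewrite {1}AE quad_spectral -(dotvv_orthogonal v Q1) dotvE mulr_sumr.
by apply: ler_sum => j _; rewrite -expr2 ler_wpM2r ?sqr_ge0.
Qed.

(** Substituting v = A^{-1/2} u turns the ratio of the two forms into a Rayleigh quotient. This
    converts (C1) into the inequality Sigma_0 <= c Sigma(theta) between quadratic forms, the shape
    in which it enters the tail bounds. *)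
Lemma quad_le_lambda_max_invsqrt (n : nat) (A B : 'M[R]_n.+1) (v : 'cV[R]_n.+1) :
  psdmx A -> A \in unitmx -> B^T = B ->
  quad B v <= lambda_max (invsqrtmx A *m B *m invsqrtmx A) * quad A v.
Proof.
move=> pA uA sB; have [[sC pC] CC] := invsqrtmxP pA uA.
set C := invsqrtmx A in sC pC CC *.
have uC : C \in unitmx by apply: (unitmx_square CC); rewrite unitmx_inv.
have sCBC : (C *m B *m C)^T = C *m B *m C by rewrite !trmx_mul sC sB mulmxA.
have := quad_le_lambda_max (invmx C *m v) sCBC.
rewrite -{1}sC quad_sandwich mulmxA mulmxV// mul1mx.
suff -> : dotv (invmx C *m v) (invmx C *m v) = quad A v by [].
rewrite dotv_mulmxl trmx_inv sC mulmxA quadE; congr (dotv _ (_ *m _)).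
rewrite -[LHS]mulmx1 -(mulVmx uA) -CC !mulmxA -(mulmxA (invmx C) (invmx C) C) mulVmx// mulmx1.
by rewrite mulVmx// mul1mx.
Qed.

End largest_eigenvalue.

(** * Relative entropy of covariance matrices and simultaneous diagonalisation *)

Section kullback_leibler.
Context {R : realType} {n : nat}.
Implicit Types (A B S : 'M[R]_n) (v : 'cV[R]_n).

Lemma det_orthogonal_conj (O : 'M[R]_n) (d : 'rV[R]_n) : O *m O^T = 1%:M ->
  \det (O^T *m diag_mx d *m O) = \prod_j d 0 j.
Proof.
move=> O1; rewrite !det_mulmx mulrAC mulrC -det_mulmx (mulmx1C O1) det1 mulr1.
exact: det_diag.
Qed.

Lemma trace_orthogonal_conj (O : 'M[R]_n) (d : 'rV[R]_n) : O *m O^T = 1%:M ->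
  \tr (O^T *m diag_mx d *m O) = \sum_j d 0 j.
Proof. by move=> O1; rewrite mxtrace_mulC mulmxA O1 mul1mx mxtrace_diag. Qed.

Lemma psd_det_gt0 A : psdmx A -> A \in unitmx -> 0 < \det A.
Proof.
move=> pA uA; have [Q [d [Q1 AE]]] := real_spectral pA.1.
have : \det A != 0 by rewrite -unitfE -unitmxE.
rewrite lt_neqAle eq_sym => ->/=; rewrite AE det_orthogonal_conj//.
by apply: prodr_ge0 => j _; apply: (psd_spectral_ge0 _ Q1); rewrite -AE.
Qed.

Lemma ln_le_subr1 (x : R) : 0 < x -> ln x <= x - 1.
Proof.
by move=> x0; have := expR_ge1Dx (ln x); rewrite lnK ?posrE// lerBrDr addrC.
Qed.

Lemma ln_eq_subr1 (x : R) : 0 < x -> ln x = x - 1 -> x = 1.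
Proof.
move=> x0 lx; apply/eqP; rewrite -ln_eq0//; apply: contraTT isT => l0.
by have := expR_gt1Dx l0; rewrite lnK ?posrE// lx addrC subrK ltxx.
Qed.

(** [D] is the sum of x - 1 - ln x over the eigenvalues x of A^{-1/2} B A^{-1/2}; each term is
    nonnegative and vanishes only at x = 1. *)
Lemma kullback_leibler_covariance A B : psdmx A -> A \in unitmx -> psdmx B -> B \in unitmx ->
  let D := ln (\det A) - ln (\det B) + \tr (B *m invmx A) - n%:R in
  0 <= D /\ (D = 0 -> A = B).
Proof.
move=> pA uA pB uB D; have [[sC pC] CC] := invsqrtmxP pA uA.
set C := invsqrtmx A in sC pC CC *.
have uC : C \in unitmx by apply: (unitmx_square CC); rewrite unitmx_inv.
pose K := C *m B *m C.
have pK : psdmx K by rewrite /K -{1}sC; exact: psdmx_sandwich.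
have [Q [d [Q1 KE]]] := real_spectral pK.1.
have detC : \det C ^+ 2 = (\det A)^-1 by rewrite expr2 -det_mulmx CC det_inv.
have dA := psd_det_gt0 pA uA; have dB := psd_det_gt0 pB uB.
have detK : \prod_j d 0 j = \det B / \det A.
  by rewrite -(det_orthogonal_conj d Q1) -KE /K !det_mulmx mulrAC -expr2 detC mulrC.
have d0 j : 0 < d 0 j.
  rewrite lt_neqAle (psd_spectral_ge0 _ Q1) -?KE// andbT eq_sym.
  have : \prod_j d 0 j != 0 by rewrite detK gt_eqF// divr_gt0.
  by move/prodf_neq0; apply.
have lnK : ln (\det A) - ln (\det B) = - \sum_j ln (d 0 j).
  have -> : \sum_j ln (d 0 j) = ln (\prod_j d 0 j).
    suff [] : 0 < \prod_j d 0 j /\ \sum_j ln (d 0 j) = ln (\prod_j d 0 j) by [].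
    elim/big_ind2 : _ => [|x1 x2 y1 y2 [p1 ->] [p2 ->]|//]; first by rewrite ln1.
    by rewrite lnM ?mulr_gt0.
  by rewrite detK ln_div// opprB.
have trK : \tr (B *m invmx A) = \sum_j d 0 j.
  by rewrite -(trace_orthogonal_conj d Q1) -KE /K -mulmxA [RHS]mxtrace_mulC -mulmxA CC.
have DE : D = \sum_j (d 0 j - 1 - ln (d 0 j)).
  rewrite /D lnK trK !sumrB sumr_const card_ord; ring.
have t0 j : 0 <= d 0 j - 1 - ln (d 0 j) by rewrite subr_ge0 ln_le_subr1.
split; first by rewrite DE sumr_ge0.
rewrite DE => /eqP; rewrite psumr_eq0// => /allP D0.
have d1 : d = const_mx 1.
  apply/rowP => j; rewrite mxE; apply: ln_eq_subr1 => //.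
  have := D0 j (mem_index_enum _); rewrite /= subr_eq0 => /eqP.
  by [].
have K1 : K = 1%:M by rewrite KE d1 diag_const_mx mulmx1 (mulmx1C Q1).
(* The left side is also [B], since [K] is C B C and C C is the inverse of A. *)
have : A *m (C *m K *m C) *m A = A.
  by rewrite K1 mulmx1 CC mulmxV// mul1mx.
by rewrite /K !mulmxA -(mulmxA A C C) CC mulmxV// mul1mx -mulmxA -mulmxA (mulmxA C) CC mulVmx// mulmx1.
Qed.

(** For noise with covariance [V], the last clause makes the variables [dotv (b j) e] standard and
    uncorrelated, and the third turns [B] into a weighted sum of their squares. The weights are the
    eigenvalues of V^{1/2} B V^{1/2}; tested on an eigenvector, the hypothesis reads lam^2 <= c lam,
    which gives the upper bound. *)
Lemma simultaneous_diagonalisation V B (c : R) : psdmx V -> V \in unitmx -> psdmx B ->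
  0 <= c -> (forall v, quad V (B *m v) <= c * quad B v) ->
  exists (b : 'I_n -> 'cV[R]_n) (lam : 'I_n -> R),
    [/\ forall j, 0 <= lam j <= c,
        \sum_j lam j = \tr (B *m V),
        forall v, quad B v = \sum_j lam j * (dotv (b j) v) ^+ 2 &
        forall u : 'I_n -> R, quad V (\sum_j u j *: b j) = \sum_j u j ^+ 2].
Proof.
move=> pV uV pB c0 BVB.
have [C [[sC pC] CC]] := psd_sqrt_exists pV.
have uC := unitmx_square CC uV.
pose K := C *m B *m C.
have pK : psdmx K by rewrite /K -{1}sC; exact: psdmx_sandwich.
have [Q [d [Q1 KE]]] := real_spectral pK.1.
have Q1' := mulmx1C Q1.
have bC j v : dotv (invmx C *m col j Q^T) v = (Q *m (invmx C *m v)) j 0.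
  rewrite dotv_mulmxl trmx_inv sC colE dotv_mulmxl trmxK dotvE (bigD1 j)//= big1.
    by rewrite !mxE !eqxx mul1r addr0.
  by move=> i /negbTE ij; rewrite mxE ij mul0r.
exists (fun j => invmx C *m col j Q^T), (fun j => d 0 j); split.
- move=> j; rewrite (psd_spectral_ge0 _ Q1) -?KE//=.
  pose o := col j Q^T.
  have dE : quad K o = d 0 j by rewrite KE quad_eigenvector.
  have oo : dotv o o = 1.
    by rewrite -(dotvv_orthogonal _ Q1) /o colE mulmxA Q1 mul1mx dotvE (bigD1 j)//= big1 ?mxE ?eqxx ?mulr1 ?addr0// => i /negbTE ij; rewrite mxE ij mul0r.
  have Ko : K *m o = d 0 j *: o.
    rewrite /o colE KE -!mulmxA (mulmxA Q) Q1 mul1mx scalemxAr; congr (_ *m _).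
    by apply/colP => i; rewrite mul_diag_mx !mxE; case: eqVneq => [->|]; rewrite ?mulr0.
  have KB : quad K o = quad B (C *m o) by rewrite /K -{1}sC quad_sandwich.
  have := BVB (C *m o).
  have -> : quad V (B *m (C *m o)) = d 0 j ^+ 2.
    have -> : V = C^T *m 1%:M *m C by rewrite mulmx1 sC CC.
    rewrite quad_sandwich quadE mul1mx !mulmxA -/K Ko dotvZr dotvC dotvZr oo.
    by rewrite mulr1 expr2.
  rewrite -KB dE expr2.
  have : 0 <= d 0 j by apply: (psd_spectral_ge0 _ Q1); rewrite -KE.
  rewrite le_eqVlt => /predU1P[<-//|d0].
  by rewrite ler_pM2r.
- by rewrite -(trace_orthogonal_conj d Q1) -KE /K -mulmxA [LHS]mxtrace_mulC -mulmxA CC.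
- move=> v; under eq_bigr do rewrite bC.
  rewrite -quad_spectral -KE /K -{1}sC quad_sandwich mulmxA mulmxV// mul1mx//.
- move=> u.
  have -> : \sum_j u j *: (invmx C *m col j Q^T) = invmx C *m (Q^T *m \col_j u j).
    rewrite mulmxA; apply/colP => i; rewrite summxE mxE; apply: eq_bigr => j _.
    by rewrite mxE colE mulmxA -colE mxE [X in _ = _ * X]mxE mulrC.
  have -> : V = C^T *m 1%:M *m C by rewrite mulmx1 sC CC.
  rewrite quad_sandwich mulmxA mulmxV// mul1mx quadE mul1mx.
  rewrite -{1}[Q]trmxK in Q1.
  rewrite dotvv_orthogonal ?trmxK// dotvE.
  by apply: eq_bigr => j _; rewrite mxE expr2.
Qed.

End kullback_leibler.

(** * Generalised least squares *)

Section generalised_least_squares.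
Context {R : realType} {n q : nat} (S : 'M[R]_n) (X : 'M[R]_(n, q)).
Hypotheses (pS : psdmx S) (uS : S \in unitmx)
           (Xinj : forall u : 'cV[R]_q, X *m u = 0 -> u = 0).

(* Locked, as otherwise mulmxA rewrites inside it. *)
Definition gls_proj : 'M[R]_n :=
  locked (X *m invmx (X^T *m S *m X) *m X^T *m S).
Local Notation M := gls_proj.
Let G := X^T *m S *m X.

Lemma gls_projE : M = X *m invmx (X^T *m S *m X) *m X^T *m S.
Proof. by rewrite /gls_proj -lock. Qed.

Let sS : S^T = S := pS.1.

Let sG : G^T = G.
Proof. by rewrite /G !trmx_mul trmxK sS mulmxA. Qed.

Lemma gram_unit : G \in unitmx.
Proof.
apply: unitmx_kernel => u Gu; apply: Xinj; apply/eqP; apply: contraT => Xu.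
have : 0 < quad S (X *m u) by exact: psd_quad_gt0.
have -> : quad S (X *m u) = (u^T *m (G *m u)) 0 0.
  by rewrite /quad trmx_mul /G !mulmxA.
by rewrite Gu mulmx0 mxE ltxx.
Qed.

Lemma gls_projX : M *m X = X.
Proof.
by rewrite gls_projE -/G -!mulmxA (mulmxA X^T) -/G mulVmx ?mulmx1// gram_unit.
Qed.

Lemma gls_proj_idem : M *m M = M.
Proof. by rewrite [X in _ *m X]gls_projE !mulmxA gls_projX -gls_projE. Qed.

Lemma gls_sym : (S *m M)^T = S *m M.
Proof.
by rewrite gls_projE -/G !trmx_mul trmxK sS trmx_inv sG !mulmxA.
Qed.

Lemma trace_gls : \tr M = q%:R.
Proof.
rewrite gls_projE -/G -!mulmxA mxtrace_mulC -!mulmxA (mulmxA X^T) -/G.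
by rewrite mulVmx ?mxtrace1// gram_unit.
Qed.

Lemma gls_trmx : M^T *m S = S *m M.
Proof. by rewrite -[RHS]gls_sym [RHS]trmx_mul sS. Qed.

Lemma gls_trmx_idem : M^T *m S *m M = S *m M.
Proof. by rewrite gls_trmx -mulmxA gls_proj_idem. Qed.

Lemma quad_gls v : quad (S *m M) v = quad S (M *m v).
Proof. by rewrite -gls_trmx_idem quad_sandwich. Qed.

Lemma gls_psd : psdmx (S *m M).
Proof. by split; [exact: gls_sym|move=> v; rewrite quad_gls; exact: pS.2]. Qed.

(** [M] is the projection on the columns of [X] that is orthogonal for the inner product [S]. This
    removes the cross terms from the two decompositions that follow. *)
Lemma trmx_gls_compl (u v : 'cV[R]_n) : dotv (S *m (M *m u)) (v - M *m v) = 0.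
Proof.
rewrite mulmxA dotv_mulmxl gls_sym mulmxBr !mulmxA -(mulmxA S M M) gls_proj_idem subrr.
by rewrite /dotv mulmx0 mxE.
Qed.

(* S M inverts S on the column space of X, so a bound V <= c S^{-1} transfers. *)
Lemma gls_bound (V : 'M[R]_n) (c : R) (v : 'cV[R]_n) :
  (forall u, quad V u <= c * quad (invmx S) u) ->
  quad V (S *m M *m v) <= c * quad (S *m M) v.
Proof.
move=> h; rewrite (le_trans (h _))// -quad_sandwich gls_sym.
by rewrite -(mulmxA _ (invmx S)) (mulmxA (invmx S)) mulVmx// mul1mx -mulmxA gls_proj_idem.
Qed.

Lemma quad_invmx_mul (v : 'cV[R]_n) : quad (invmx S) (S *m v) = quad S v.
Proof. by rewrite -quad_sandwich sS mulmxV// mul1mx. Qed.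

Variables (mu e : 'cV[R]_n).
Let b := mu - M *m mu.

(** The error of the fit is M e - b, fitted noise minus bias, and the two are orthogonal for [S]. *)
Lemma gls_fit_quad :
  quad S (M *m (mu + e) - mu) = quad S b + quad (S *m M) e.
Proof.
have -> : M *m (mu + e) - mu = M *m e - b.
  by rewrite mulmxDr /b opprB addrAC addrC addrA addrAC.
have z : dotv (S *m (M *m e)) b = 0 by exact: trmx_gls_compl.
have z1 : dotv (M *m e) (S *m b) = 0 by have := dotv_mulmxl S (M *m e) b; rewrite sS z.
have z2 : dotv (- b) (S *m (M *m e)) = 0 by rewrite dotvC dotvNr z oppr0.
have z3 : dotv (- b) (S *m b) = - dotv b (S *m b) by rewrite dotvC dotvNr dotvC.
rewrite quad_gls; move: (b) z1 z2 z3 => c z1 z2 z3.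
rewrite !quadE mulmxBr !dotvDl !dotvDr !dotvNr.
by rewrite z1 z2 z3 opprK oppr0 addr0 add0r addrC.
Qed.

(** The residual is b + (e - M e). The bias is orthogonal to M e, so its cross term involves the
    whole noise, and the remaining square is split by Pythagoras. *)
Lemma gls_residual_quad :
  quad S (mu + e - M *m (mu + e)) =
  quad S b + 2 * dotv (S *m b) e + quad S e - quad (S *m M) e.
Proof.
have -> : mu + e - M *m (mu + e) = b + (e - M *m e).
  by rewrite mulmxDr /b opprD addrACA.
have E (u v : 'cV[R]_n) : quad S (u + v) = quad S u + 2 * dotv (S *m u) v + quad S v.
  rewrite !quadE mulmxDr !dotvDl !dotvDr (dotvC v (S *m u)).
  have -> : dotv u (S *m v) = dotv (S *m u) v by rewrite dotv_mulmxl sS.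
  ring.
rewrite E.
have bM : dotv (S *m b) (M *m e) = 0.
  by rewrite dotv_mulmxl sS dotvC trmx_gls_compl.
rewrite dotvDr dotvNr bM subr0.
have -> : quad S e = quad S (e - M *m e) + quad S (M *m e).
  rewrite -[in LHS](subrK (M *m e) e) [LHS]E.
  by rewrite dotv_mulmxl sS dotvC trmx_gls_compl mulr0 addr0.
by rewrite quad_gls; ring.
Qed.

End generalised_least_squares.

(** * Gaussian random variables *)

Section characteristic_function.
Context {R : realType}.
Local Notation mu := (@lebesgue_measure R).

(** Completing the square: exponential tilting shifts the mean by t s^2. *)
Lemma expR_normal_pdf (t m s x : R) : s != 0 ->
  expR (t * x) * normal_pdf m s x =
  expR (t * m + t ^+ 2 * s ^+ 2 / 2) * normal_pdf (m + t * s ^+ 2) s x.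
Proof.
move=> s0; rewrite !normal_pdfE// /normal_fun mulrCA [RHS]mulrCA; congr (_ * _).
rewrite -!expRD; congr expR.
field.
exact: s0.
Qed.

Lemma integral_expR_normal (t m s : R) : s != 0 ->
  (\int[mu]_x (expR (t * x) * normal_pdf m s x)%:E =
   (expR (t * m + t ^+ 2 * s ^+ 2 / 2))%:E)%E.
Proof.
move=> s0; under eq_integral do rewrite expR_normal_pdf// EFinM.
by rewrite integralZl//= ?integral_normal_pdf ?mule1//; exact: integrable_normal_pdf.
Qed.

Lemma integrable_expR_normal (t m s : R) : s != 0 ->
  mu.-integrable setT (EFin \o (fun x => expR (t * x) * normal_pdf m s x)).
Proof.
move=> s0; rewrite (_ : _ \o _ = fun x => ((expR (t * m + t ^+ 2 * s ^+ 2 / 2))%:E *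
   (normal_pdf (m + t * s ^+ 2) s x)%:E)%E); last first.
  by apply/funext => x /=; rewrite expR_normal_pdf.
by apply: integrableZl => //; exact: integrable_normal_pdf.
Qed.

(** Integration by parts on the line: the fundamental theorem on growing intervals, with dominated
    convergence for the integrals and vanishing boundary values. *)
Lemma integral_derive_eq0 (h h' : R -> R) :
  (forall x : R, is_derive x 1 h (h' x)) -> continuous h' ->
  mu.-integrable setT (EFin \o h') ->
  h n%:R @[n --> \oo] --> (0 : R) -> h (- n%:R) @[n --> \oo] --> (0 : R) ->
  (\int[mu]_x (h' x)%:E = 0)%E.
Proof.
move=> hh' ch' ih' hy hNy.
have ch x : {for x, continuous h}.
  by apply/differentiable_continuous/derivable1_diffP; have [] := hh' x.
(* The endpoints use [n.+1] because the fundamental theorem is applied on a nondegenerate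
   interval. *)
pose f_ (n : nat) : R -> \bar R := (EFin \o h') \_ `[- n.+1%:R, n.+1%:R].
have /integrableP[mh' _] := ih'.
have [_ _ cvgf] : [/\ mu.-integrable setT (EFin \o h'),
  (fun n => \int[mu]_(x in setT) `| f_ n x - (EFin \o h') x |)%E @ \oo --> 0%E &
  (fun n => \int[mu]_(x in setT) f_ n x)%E @ \oo --> (\int[mu]_x (h' x)%:E)%E].
  apply: (@dominated_convergence _ _ _ mu setT _ f_ (EFin \o h') (fun x => `|(h' x)%:E|%E)) => //.
  - move=> n; have mD : measurable (`[- n.+1%:R, n.+1%:R]%classic : set R) by [].
    suff /integrableP[] : mu.-integrable setT (f_ n) by [].
    apply/integrable_restrict => //; rewrite setTI.
    exact: integrableS ih'.
  - apply: aeW => x _; apply: cvg_near_cst; near=> n.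
    rewrite /f_ patchE mem_set//= in_itv/= -ler_norml.
    near: n; exists (Num.trunc `|x|) => // n /= xn.
    rewrite (le_trans (ltW (truncnS_gt _)))// ler_nat.
    by rewrite ltnS.
  - exact: integrable_abse.
  - apply: aeW => x n _; rewrite /f_ patchE; case: ifP => // _.
    by rewrite abse0.
have E n : (\int[mu]_(x in setT) f_ n x)%E = (h n.+1%:R - h (- n.+1%:R))%:E.
  rewrite /f_ -integral_mkcond/= EFinB.
  have n0 : - n.+1%:R < n.+1%:R :> R by rewrite -subr_gt0 opprK addr_gt0.
  apply: continuous_FTC2 => //.
  - exact: continuous_subspaceT.
  - split.
    + by move=> x _; have [] := hh' x.
    + by apply: cvg_at_right_filter; exact: ch.
    + by apply: cvg_at_left_filter; exact: ch.
  - by move=> x _; rewrite derive1E; have [_ ->] := hh' x.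
have cvg0 : (fun n => \int[mu]_(x in setT) f_ n x)%E @ \oo --> 0%E.
  rewrite (_ : (fun n => _) = fun n => (h n.+1%:R - h (- n.+1%:R))%:E); last exact/funext.
  apply: cvg_EFin; first exact: nearW.
  rewrite -[X in _ --> X](subr0 (0 : R)); apply: cvgB.
    by rewrite (cvg_shiftS (fun n => h n%:R)).
  by rewrite (cvg_shiftS (fun n => h (- n%:R))).
exact: (cvg_unique _ cvgf cvg0).
Unshelve. all: by end_near. Qed.

Lemma is_derive_affine (a b x : R) : is_derive x 1 (fun x => a * x + b) a.
Proof.
rewrite (_ : (fun x => _) = (a *: (id : R -> R)) + cst b) //.
by apply: is_derive_eq; rewrite addr0 /GRing.scale/= mulr1.
Qed.

Lemma is_derive_normal_pdf (s x : R) : s != 0 ->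
  is_derive x 1 (normal_pdf 0 s) (- x / s ^+ 2 * normal_pdf 0 s x).
Proof.
move=> s0; rewrite normal_pdfE//.
pose f : R -> R := (- (s ^+ 2 *+ 2)^-1) *: (id : R -> R) ^+ 2.
have -> : (fun x => normal_peak s * normal_fun 0 s x) = normal_peak s *: (expR \o f).
  by apply/funext => y/=; rewrite /normal_fun subr0; congr (_ * expR _); rewrite mulNr mulrC -mulNr.
have df : is_derive x 1 f (- x / s ^+ 2).
  apply: is_derive_eq; rewrite /GRing.scale/=; field.
  exact: s0.
have H := is_derive1_comp (is_derive_expR (f x)) df.
apply: is_derive_eq; rewrite /f /GRing.scale/= /normal_fun subr0.
rewrite (_ : - x ^+ 2 / (s ^+ 2 *+ 2) = - (s ^+ 2 *+ 2)^-1 * x ^+ 2); last by ring.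
by rewrite [LHS]mulrA [LHS]mulrC.
Qed.

Lemma ler_abs_expR (x : R) : `|x| <= expR x + expR (- x).
Proof.
have h (y : R) : y <= expR y by rewrite (le_trans _ (expR_ge1Dx y))// lerDr.
have [x0|x0] := ger0P x.
  by rewrite (le_trans (h x))// lerDl expR_ge0.
by rewrite (le_trans (h (- x)))// lerDr expR_ge0.
Qed.

Lemma cvg_normal_pdf (s : R) (e : R) : s != 0 -> e = 1 \/ e = -1 ->
  normal_pdf 0 s (e * n%:R) @[n --> \oo] --> (0 : R).
Proof.
move=> s0 e1.
have e2 : e ^+ 2 = 1 by case: e1 => ->; rewrite ?sqrrN expr1n.
rewrite normal_pdfE//.
rewrite (_ : (fun n : nat => _) = (fun n => normal_peak s * gauss_fun (n%:R / Num.sqrt (s ^+ 2 *+ 2)))).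
  rewrite -[X in _ --> X](mulr0 (normal_peak s)); apply: cvgM; first exact: cvg_cst.
  apply: (@cvg_comp _ _ _ (fun n : nat => (n%:R : R))
    (fun x => gauss_fun (x / Num.sqrt (s ^+ 2 *+ 2))) _ (+oo)%R).
    exact: cvgr_idn.
  apply: (@cvg_comp _ _ _ (fun x : R => x / Num.sqrt (s ^+ 2 *+ 2)) gauss_fun _ (+oo)%R).
    apply/gt0_cvgMly; last exact: cvg_id.
    by rewrite invr_gt0// sqrtr_gt0 pmulrn_lgt0// exprn_even_gt0.
  exact: cvg_gauss_fun.
apply/funext => n; rewrite /normal_fun /gauss_fun subr0 exprMn e2 mul1r.
rewrite mulNr exprMn exprVn sqr_sqrtr//.
by rewrite pmulrn_lge0// sqr_ge0.
Qed.

(** As a function of t the integral F solves F' = - t s^2 F, so that F(t) exp(s^2 t^2 / 2) is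
    constant; its value at 0 is cos b. *)
Lemma integral_cos_normal (t b s : R) : s != 0 ->
  (\int[mu]_x (cos (t * x + b) * normal_pdf 0 s x)%:E =
   (cos b * expR (- (t ^+ 2 * s ^+ 2 / 2)))%:E)%E.
Proof.
move=> s0.
pose g : R -> R := normal_pdf 0 s.
have cg : continuous g by exact: continuous_normal_pdf.
have dg (x : R) : is_derive x 1 g (- x / s ^+ 2 * g x) by exact: is_derive_normal_pdf.
have g0 x : 0 <= g x by exact: normal_pdf_ge0.
have ig : mu.-integrable setT (EFin \o g) by exact: integrable_normal_pdf.
(* An integrable majorant of |x| g(x), as required for differentiating under the integral; its own
   integrability comes from the Laplace transform. *)
pose G x := expR (1 * x) * g x + expR (- 1 * x) * g x.
have iG : mu.-integrable setT (EFin \o G).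
  rewrite (_ : EFin \o G = (fun x => (expR (1 * x) * g x)%:E + (expR (-1 * x) * g x)%:E)%E) //.
  by apply: integrableD => //; exact: integrable_expR_normal.
have G0 x : 0 <= G x by rewrite addr_ge0// mulr_ge0// expR_ge0.
have Gx x : `|x| * g x <= G x.
  by rewrite /G -mulrDl ler_wpM2r// mul1r mulN1r ler_abs_expR.
have claff u c : continuous (fun x : R => u * x + c).
  move=> x; apply: cvgD; last exact: cvg_cst.
  by apply: cvgM; [exact: cvg_cst|exact: cvg_id].
have ccos u : continuous (fun x : R => cos (u * x + b)).
  by move=> x; apply: continuous_comp; [exact: claff|exact: continuous_cos].
have csin u : continuous (fun x : R => sin (u * x + b)).
  by move=> x; apply: continuous_comp; [exact: claff|exact: continuous_sin].
have icos u : mu.-integrable setT (EFin \o (fun x => cos (u * x + b) * g x)).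
  apply: (le_integrable _ _ _ ig) => //.
    apply/measurable_EFinP; apply: measurable_funM;
      exact: continuous_measurable_fun.
  move=> x _ /=; rewrite lee_fin normrM ler_piMl//.
  exact: cos_max.
have isin u : mu.-integrable setT (EFin \o (fun x => x * (sin (u * x + b) * g x))).
  apply: (le_integrable _ _ _ iG) => //.
    apply/measurable_EFinP; apply: measurable_funM => //.
    by apply: measurable_funM; exact: continuous_measurable_fun.
  move=> x _ /=; rewrite lee_fin [leRHS]ger0_norm// (le_trans _ (Gx x))//.
  rewrite normrM ler_wpM2l// normrM (ger0_norm (g0 x)) ler_piMl//.
  exact: sin_max.
pose F u := (\int[mu]_x (cos (u * x + b) * g x)).

(* Obtained by integrating the derivative of s^2 sin(u x + b) g(x), which uses g'(x) = - x g(x) /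
   s^2. *)
have ibp u : \int[mu]_x (x * (sin (u * x + b) * g x)) = u * s ^+ 2 * F u.
  have h0 e : e = 1 \/ e = -1 ->
      s ^+ 2 * (sin (u * (e * n%:R) + b) * g (e * n%:R)) @[n --> \oo] --> (0 : R).
    move=> e1; rewrite -[X in _ --> X](mulr0 (s ^+ 2)); apply: cvgM; first exact: cvg_cst.
    apply/norm_cvg0P; apply: (@squeeze_cvgr _ _ _ _ (fun=> 0) (fun n : nat => g (e * n%:R))).
    - apply: nearW => n; rewrite normr_ge0/= normrM (ger0_norm (g0 _)) ler_piMl//.
      exact: sin_max.
    - exact: cvg_cst.
    - exact: cvg_normal_pdf.
  pose k x := u * s ^+ 2 * (cos (u * x + b) * g x) - x * (sin (u * x + b) * g x).
  have ik1 : mu.-integrable setT (EFin \o (fun x => u * s ^+ 2 * (cos (u * x + b) * g x))).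
    by apply: (integrableZl _ (u * s ^+ 2) (icos u)).
  have ik : mu.-integrable setT (EFin \o k).
    exact: (integrableB measurableT ik1 (isin u)).
  have := @integral_derive_eq0 (fun x => s ^+ 2 * (sin (u * x + b) * g x)) k.
  have -> : (\int[mu]_x (k x)%:E)%E =
      (u * s ^+ 2 * F u - \int[mu]_x (x * (sin (u * x + b) * g x)))%:E.
    rewrite /F -RintegralZl// -RintegralB// -[LHS]fineK//.
    exact: integrable_fin_num.
  move=> H; apply/eqP; rewrite eq_sym -subr_eq0; apply/eqP.
  suff /(congr1 fine)/= : (u * s ^+ 2 * F u - \int[mu]_x (x * (sin (u * x + b) * g x)))%:E = 0%E by [].
  apply: H.
  - move=> x.
    have d1 := @is_derive1_comp _ sin (fun x => u * x + b) x _ _ (is_derive_sin (u * x + b)) (is_derive_affine u b x).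
    have d2 := dg x.
    rewrite (_ : (fun x => _) = s ^+ 2 *: ((sin \o (fun x => u * x + b)) * g)) //.
    apply: is_derive_eq; rewrite /GRing.scale/= /k; field.
    exact: s0.
  - move=> x; apply: cvgB; apply: cvgM.
    + exact: cvg_cst.
    + by apply: cvgM; [exact: ccos|exact: cg].
    + exact: cvg_id.
    + by apply: cvgM; [exact: csin|exact: cg].
  - exact: ik.
  - under eq_fun do rewrite -(mul1r (_%:R)).
    by apply: h0; left.
  - under eq_fun do rewrite -mulN1r.
    by apply: h0; right.
have dF (u : R) : is_derive u 1 F (- (u * s ^+ 2 * F u)).
  pose f (v x : R) := cos (v * x + b) * g x.
  have df (v x : R) : is_derive v 1 (f ^~ x) (- (x * (sin (v * x + b) * g x))).
    have d1 := @is_derive1_comp _ cos (fun v => x * v + b) v _ _ (is_derive_cos (x * v + b)) (is_derive_affine x b v).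
    rewrite (_ : f^~ x = g x *: (cos \o (fun v => x * v + b))); last first.
      by apply/funext => w; rewrite /f /GRing.scale/= mulrC [x * w]mulrC.
    rewrite (mulrC v).
    by apply: is_derive_eq; rewrite /GRing.scale/=; ring.
  have uI : `]u - 1, u + 1[%classic u.
    by rewrite /= in_itv/= ltrBlDr !ltrDl ltr01.
  have H1 (x y : R) : `]u - 1, u + 1[%classic x -> setT y -> derivable (f^~ y) x 1.
    by move=> _ _; have [] := df x y.
  have H2 (x y : R) : `]u - 1, u + 1[%classic x -> setT y -> `|partial1of2 f x y| <= G y.
    move=> _ _; rewrite partial1of2E; have [_ ->] := df x y.
    rewrite normrN normrM (le_trans _ (Gx y))// ler_wpM2l// normrM (ger0_norm (g0 y)).
    by rewrite ler_piMl// sin_max.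
  apply: DeriveDef.
    exact: (derivable_under_integral measurableT uI (fun v _ => icos v) H1 G0 iG H2).
  rewrite -derive1E (differentiation_under_integral measurableT uI (fun v _ => icos v) H1 G0 iG H2).
  rewrite -ibp -mulN1r -RintegralZl//.
  apply: eq_Rintegral => x _; rewrite partial1of2E; have [_ ->] := df u x.
  by rewrite mulN1r.
pose E (v : R) := expR (s ^+ 2 / 2 * v ^+ 2).
have dE (u : R) : is_derive u 1 E (u * s ^+ 2 * E u).
  have d1 : is_derive u 1 (s ^+ 2 / 2 *: (id : R -> R) ^+ 2) (u * s ^+ 2).
    by apply: is_derive_eq; rewrite /GRing.scale/=; field.
  have := @is_derive1_comp _ expR _ u _ _ (is_derive_expR (s ^+ 2 / 2 * u ^+ 2)) d1.
  by rewrite [X in is_derive _ _ _ X -> _]mulrC.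
have cst := @is_derive_0_is_cst _ (F * E) t 0.
have {cst} FE : F t * E t = F 0 * E 0.
  apply: cst => u; apply: is_derive_eq; rewrite /GRing.scale/=; ring.
have F0 : F 0 = cos b.
  rewrite /F; under eq_Rintegral do rewrite mul0r add0r.
  by rewrite RintegralZl// /Rintegral integral_normal_pdf mulr1.
have Et : F t = cos b * expR (- (t ^+ 2 * s ^+ 2 / 2)).
  rewrite (_ : - _ = - (s ^+ 2 / 2 * t ^+ 2)); last by field.
  rewrite expRN -[LHS](mulfK (_ : E t != 0)) ?FE ?gt_eqF ?expR_gt0//.
  by rewrite F0 /E expr0n/= mulr0 expR0 mulr1.
rewrite -Et /F fineK//; exact: (integrable_fin_num measurableT (icos t)).
Qed.

End characteristic_function.

Section normal_integral.
Context {R : realType}.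
Local Notation mu := (@lebesgue_measure R).

Lemma ge0_integral_normal_prob (m s : R) (f : measurableTypeR R -> \bar R) :
  (forall x, (0 <= f x)%E) -> measurable_fun setT f ->
  (\int[normal_prob m s]_x f x = \int[mu]_x (f x * (normal_pdf m s x)%:E))%E.
Proof.
move=> f0 mf; have dom := normal_prob_dominates m s.
rewrite -(Radon_Nikodym_SigmaFinite.change_of_variables dom)//.
apply: ae_eq_integral => //.
- apply: emeasurable_funM => //.
  exact: measurable_int (Radon_Nikodym_SigmaFinite.f_integrable dom).
- apply: emeasurable_funM => //; apply/measurable_EFinP.
  exact: measurable_normal_pdf.
- apply: ae_eqe_mul2l; apply: integral_ae_eq => //.
  + exact: Radon_Nikodym_SigmaFinite.f_integrable dom.
  + by apply/measurable_EFinP; exact: measurable_normal_pdf.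
  + by move=> E _ mE; rewrite -(Radon_Nikodym_SigmaFinite.f_integral dom).
Qed.

End normal_integral.

Section gaussian_rv.
Context {R : realType} {d : measure_display} {T : measurableType d}
        (P : probability T R).

(* The law N(0, v), including v = 0, described by its Fourier and Laplace
   transforms; the phase b covers both the real and the imaginary part of the
   former. *)
Definition gaussian_rv (X : T -> R) (v : R) : Prop :=
  [/\ measurable_fun setT X,
      forall t b, (\int[P]_w (cos (t * X w + b))%:E =
                   (cos b * expR (- (t ^+ 2 * v / 2)))%:E)%E &
      forall t, (\int[P]_w (expR (t * X w))%:E = (expR (t ^+ 2 * v / 2))%:E)%E].

Lemma integrable_bounded (f : T -> R) (M : R) :
  measurable_fun setT f -> (forall w, `|f w| <= M) ->
  P.-integrable setT (EFin \o f).
Proof.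
move=> mf fM; apply: (le_integrable measurableT (g := cst M%:E)).
- exact/measurable_EFinP.
- by move=> w _ /=; rewrite lee_fin (le_trans (fM w))// ler_norm.
- by apply: finite_measure_integrable_cst => //; exact: measurableT.
Qed.

Lemma integral_affine_bounded (f : T -> R) (c M a : R) :
  measurable_fun setT f -> (forall w, `|f w| <= M) ->
  (\int[P]_w (f w)%:E = a%:E)%E ->
  (\int[P]_w (c + f w)%:E = (c + a)%:E)%E.
Proof.
move=> mf fM fa; under eq_integral do rewrite EFinD.
rewrite integralD//=; last exact: integrable_bounded fM.
  by rewrite fa integral_cst//= probability_setT mule1.
exact: finite_measure_integrable_cst.
Qed.

Lemma integral_normal_law (X : T -> R) (m s : R) (f : R -> R) :
  measurable_fun setT X -> has_normal_law P X m s -> s != 0 ->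
  measurable_fun setT f -> (forall x, 0 <= f x) ->
  (\int[P]_w (f (X w))%:E = \int[lebesgue_measure]_x (f x * normal_pdf m s x)%:E)%E.
Proof.
move=> mX lX s0 mf f0.
have mEf : measurable_fun setT (EFin \o f) by apply/measurable_EFinP.
have mX' : @measurable_fun _ _ T (measurableTypeR R) setT X := mX.
pose X' : {RV P >-> measurableTypeR R} :=
  HB.pack (X : T -> measurableTypeR R)
    (isMeasurableFun.Build _ _ T (measurableTypeR R) X mX').
transitivity (\int[distribution P X']_x (f x)%:E)%E.
  by rewrite ge0_integral_distribution// => x; rewrite lee_fin.
transitivity (\int[normal_prob m s]_x (f x)%:E)%E; last first.
  by rewrite ge0_integral_normal_prob//= => x; rewrite lee_fin.
apply: eq_measure_integral => A mA _.
by have := lX A mA; rewrite /normal_law (negbTE s0).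
Qed.

Lemma has_normal_law0 (X : T -> R) (m : R) :
  measurable_fun setT X -> has_normal_law P X m 0 ->
  forall f : R -> R, measurable_fun setT f ->
  (\int[P]_w (f (X w))%:E = (f m)%:E)%E.
Proof.
move=> mX lX f mf.
have ae : ae_eq P setT (fun w => (f (X w))%:E) (cst (f m)%:E).
  exists (X @^-1` (~` [set m])); split.
  - by rewrite -[X in measurable X]setTI; apply: mX => //; exact: measurableC.
  - have := lX (~` [set m]); rewrite /normal_law eqxx diracE memNset//=.
    by apply; exact: measurableC.
  - by move=> w /= h Xm; apply: h => _; rewrite Xm.
rewrite (ae_eq_integral _ _ _ _ _ ae)//; first by rewrite integral_cst//= probability_setT mule1.
by apply/measurable_EFinP; exact: measurableT_comp.
Qed.

Lemma normal_law_expR (X : T -> R) (m s t : R) :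
  measurable_fun setT X -> has_normal_law P X m s ->
  (\int[P]_w (expR (t * X w))%:E = (expR (t * m + t ^+ 2 * s ^+ 2 / 2))%:E)%E.
Proof.
move=> mX lX.
have mf : measurable_fun setT (fun x : R => expR (t * x)).
  by apply: measurableT_comp => //; exact: measurable_funM.
have [s0|s0] := eqVneq s 0.
  rewrite s0 in lX *.
  by rewrite (has_normal_law0 mX lX mf) expr0n/= mulr0 mul0r addr0.
rewrite (integral_normal_law mX lX s0 mf); last by move=> x; exact: expR_ge0.
exact: integral_expR_normal.
Qed.

Lemma normal_law_gaussian_rv (X : T -> R) (s : R) :
  measurable_fun setT X -> has_normal_law P X 0 s -> gaussian_rv X (s ^+ 2).
Proof.
move=> mX lX; split => // [t b|t]; last first.
  by rewrite (normal_law_expR t mX lX) mulr0 add0r.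
have maff : measurable_fun setT (fun x : R => t * x + b).
  by apply: measurable_funD => //; exact: measurable_funM.
have mf : measurable_fun setT (fun x : R => cos (t * x + b)).
  by apply: measurableT_comp => //; apply: continuous_measurable_fun; exact: continuous_cos.
have [s0|s0] := eqVneq s 0.
  rewrite s0 in lX *.
  by rewrite (has_normal_law0 mX lX mf) expr0n/= !mulr0 mul0r oppr0 expR0 mulr1 add0r.
(* The change of law is stated for nonnegative functions, so the cosine is raised by 1. *)
have mf1 : measurable_fun setT (fun x : R => 1 + cos (t * x + b)).
  exact: measurable_funD.
have f10 x : 0 <= 1 + cos (t * x + b).
  by rewrite -lerBlDl sub0r cos_geN1.
have := integral_normal_law mX lX s0 mf1 f10.
under [X in _ = X]eq_integral do rewrite mulrDl mul1r EFinD.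
rewrite integralD//=; last 2 first.
- exact: integrable_normal_pdf.
- apply: (le_integrable measurableT _ _ (integrable_normal_pdf 0 s)).
    apply/measurable_EFinP; apply: measurable_funM => //.
    exact: measurable_normal_pdf.
  move=> x _ /=; rewrite lee_fin normrM ler_piMl//.
  exact: cos_max.
rewrite integral_normal_pdf integral_cos_normal//.
under eq_integral do rewrite EFinD.
rewrite integralD//=; last 2 first.
- exact: finite_measure_integrable_cst.
- apply: (integrable_bounded (M := 1)); first exact: (measurableT_comp mf mX).
  by move=> w; exact: cos_max.
rewrite integral_cst//= probability_setT mule1.
by rewrite ![(1 + _)%E]addeC => /(congr1 (fun x => x - 1)%E); rewrite !addeK.
Qed.

End gaussian_rv.

(** * Inequalities for reading moments off transforms *)

Section elementary_inequalities.
Context {R : realType}.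

Lemma ge0_derive_ge0 (f df : R -> R) (x : R) :
  (forall x : R, is_derive x 1 f (df x)) ->
  (forall x, 0 <= x -> 0 <= df x) -> 0 <= f 0 -> 0 <= x -> 0 <= f x.
Proof.
move=> dfP df0 f0; rewrite le_eqVlt => /predU1P[<-//|x0].
have cf : {within `[0, x], continuous f}.
  apply: continuous_subspaceT => y.
  by apply/differentiable_continuous/derivable1_diffP; have [] := dfP y.
have [c /[!in_itv]/= /andP[c0 _] E] := MVT x0 (fun y _ => dfP y) cf.
rewrite -(subrK (f 0) (f x)) E addr_ge0// mulr_ge0 ?df0 ?(ltW c0)//.
by rewrite subr0 ltW.
Qed.

Lemma sin_lex (x : R) : 0 <= x -> sin x <= x.
Proof.
move=> x0; rewrite -subr_ge0.
apply: (@ge0_derive_ge0 ((id : R -> R) - sin) (fun x => 1 - cos x)) => //.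
by rewrite [X in _ <= X](_ : _ = 0 - sin 0) // sin0 subr0.
Qed.

Lemma cos_ge1Bx2 (x : R) : 1 - x ^+ 2 / 2 <= cos x.
Proof.
wlog x0 : x / 0 <= x.
  move=> h; have [/h//|x0] := leP 0 x.
  by rewrite -cosN -(sqrrN x) h// oppr_ge0 ltW.
pose f : R -> R := cos - (cst 1 - 2^-1 *: (id : R -> R) ^+ 2).
have fE y : f y = cos y - (1 - y ^+ 2 / 2) by rewrite mulrC.
rewrite -subr_ge0 -fE; apply: (@ge0_derive_ge0 f (fun x => x - sin x)) => //.
- by move=> y; apply: is_derive_eq; rewrite /GRing.scale/=; field.
- by move=> y y0; rewrite subr_ge0 sin_lex.
- by rewrite fE cos0 expr0n/= mul0r subr0 subrr.
Qed.

(** Square 2 sinh(x / 2) >= x, using that the two exponentials have product 1. The bound controls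
    second moments by Laplace transforms. *)
Lemma expRDNx_ge (x : R) : 2 + x ^+ 2 <= expR x + expR (- x).
Proof.
wlog x0 : x / 0 <= x.
  move=> h; have [/h//|x0] := leP 0 x.
  have := h (- x); rewrite sqrrN opprK (addrC (expR (- x))); apply.
  by rewrite oppr_ge0 ltW.
have dexpN (y : R) : is_derive y 1 (fun y : R => expR (- y)) (- expR (- y)).
  have := @is_derive1_comp _ expR (-%R) y _ _ (is_derive_expR (- y)) (is_deriveNid y 1).
  by rewrite mulrN1.
pose E : R -> R := fun y => expR (- y).
have dE (y : R) : is_derive y 1 E (- expR (- y)) by exact: dexpN.
have sinh y : 0 <= y -> 0 <= expR y - expR (- y) - 2 * y :> R.
  pose f : R -> R := expR - E - 2 *: (id : R -> R).
  move=> y0; rewrite -[X in _ <= X]/(f y).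
  apply: (@ge0_derive_ge0 f (fun y => expR y + expR (- y) - 2)) => //.
  - move=> z; apply: is_derive_eq; rewrite /GRing.scale/=; ring.
  - move=> z _; rewrite subr_ge0.
    by have := expR_ge1Dx z; have := expR_ge1Dx (- z); lra.
  - by rewrite -[X in _ <= X]/(expR 0 - expR (- 0) - 2 * 0) oppr0 subrr mulr0 subr0.
have x2 : 0 <= x / 2 by rewrite divr_ge0.
have e1 : expR (x / 2) ^+ 2 = expR x by rewrite expr2 -expRD -splitr.
have e2 : expR (- (x / 2)) ^+ 2 = expR (- x) by rewrite expr2 -expRD -opprD -splitr.
have h : x <= expR (x / 2) - expR (- (x / 2)) by have := sinh _ x2; lra.
have := lerXn2r 2 x0 (le_trans x0 h) h.
rewrite sqrrB e1 e2 expRxMexpNx_1; lra.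
Qed.

(** Let [u] tend to 0; this takes the place of differentiating a transform at the origin. *)
Lemma le0_small_multiples (a c e : R) : 0 < e ->
  (forall u, 0 < u -> u < e -> a <= u * c) -> a <= 0.
Proof.
move=> e0 h; rewrite leNgt; apply/negP => a0.
pose u := Num.min (e / 2) (a / (2 * (`|c| + 1))).
have c1 : 0 < `|c| + 1 by rewrite ltr_pwDr.
have u0 : 0 < u by rewrite lt_min divr_gt0//= divr_gt0// mulr_gt0.
have ue : u < e.
  by rewrite (@le_lt_trans _ _ (e / 2))// ?ge_min ?lexx// ltr_pdivrMr// ltr_pMr// ltr1n.
have := h u u0 ue; apply/negP; rewrite -ltNge.
rewrite (@le_lt_trans _ _ (u * (`|c| + 1)))//.
  by rewrite ler_pM2l// (le_trans (ler_norm c))// lerDl.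
rewrite (@le_lt_trans _ _ (a / (2 * (`|c| + 1)) * (`|c| + 1)))//.
  by rewrite ler_pM2r// ge_min lexx orbT.
have -> : a / (2 * (`|c| + 1)) * (`|c| + 1) = a / 2 by field; rewrite gt_eqF.
by rewrite ltr_pdivrMr// ltr_pMr// ltr1n.
Qed.

(** For a variable with mean [mu] the hypothesis is E(1 + t X) <= E(exp(t X)). Comparing first-order
    terms as t tends to 0 from either side yields the two inequalities. *)
Lemma mean_of_laplace (mu m v : R) :
  (forall t, 1 + t * mu <= expR (t * m + t ^+ 2 * v / 2)) -> mu = m.
Proof.
move=> h.
(* [s] is 1 or -1, the side from which t approaches 0. *)
have key s : s ^+ 2 = 1 -> s * (mu - m) <= 0.
  move=> s2; apply: (@le0_small_multiples _ (`|v| + `|m * mu| + `|mu * v|) (Num.min 1 ((`|mu| + 1)^-1))).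
    by rewrite lt_min ltr01 invr_gt0 ltr_pwDr.
  move=> u u0; rewrite lt_min => /andP[u1 um].
  have sn : `|s| = 1 by apply/eqP; rewrite -(@pexpr_eq1 _ _ 2)// -normrX s2 normr1.
  set t := u * s.
  have t1 : 0 <= 1 + t * mu.
    rewrite -lerBlDl sub0r lerNl (le_trans (ler_norm _))// normrN !normrM sn mulr1.
    rewrite gtr0_norm// (@le_trans _ _ ((`|mu| + 1)^-1 * (`|mu| + 1)))//.
      by rewrite ler_pM ?normr_ge0 ?(ltW u0) ?(ltW um) ?lerDl.
    by rewrite mulVf// gt_eqF// ltr_pwDr.
  (* Multiplying the hypothesis exp(y) >= 1 + t mu by exp(- y) >= 1 - y leaves a polynomial
     inequality. *)
  have : (1 + t * mu) * (1 - (t * m + t ^+ 2 * v / 2)) <= 1.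
    set y := t * m + _.
    rewrite (le_trans (ler_wpM2l t1 (expR_ge1Dx (- y))))//.
    by rewrite -[leRHS](expRxMexpNx_1 y) ler_wpM2r ?expR_ge0 ?h.
  have t2 : t ^+ 2 = u ^+ 2 by rewrite exprMn s2 mulr1.
  have -> : (1 + t * mu) * (1 - (t * m + t ^+ 2 * v / 2)) =
     1 + u * (s * (mu - m) - u * (v / 2 + m * mu + t * (mu * v) / 2)).
    rewrite t2 /t; rewrite (_ : u ^+ 2 * v / 2 = u^+2 * (v/2)); last by ring.
    transitivity (1 + u * (s * (mu - m)) - u ^+2 * (v/2) - s^+2 * u^+2 * (m * mu) - u ^+ 2 * (u * s * (mu * v) / 2)).
      by field.
    by rewrite s2; ring.
  rewrite gerDl pmulr_rle0// subr_le0 => /le_trans; apply.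
  rewrite ler_pM2l// lerD//.
    rewrite lerD ?ler_norm// (le_trans (ler_norm _))// normrM ler_piMr//.
    by rewrite ger0_norm// invf_le1// ler1n.
  rewrite (le_trans (ler_norm _))// normrM -[leRHS]mulr1 ler_pM//.
    rewrite normrM ler_piMl// /t normrM sn mulr1 gtr0_norm// ltW//.
  by rewrite ger0_norm// invf_le1// ler1n.
apply/eqP; rewrite -subr_eq0 eq_le -[X in X <= 0]mul1r key ?expr1n//=.
by rewrite -[X in 0 <= X]opprK oppr_ge0 -mulN1r key// sqrrN expr1n.
Qed.

End elementary_inequalities.

Section gaussian_moments.
Context {R : realType} {d : measure_display} {T : measurableType d}
        (P : probability T R).
Implicit Types (X : T -> R) (v : R).

Let i1 (c : R) : P.-integrable setT (fun=> c%:E).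
Proof. exact: finite_measure_integrable_cst. Qed.

Lemma integrable_affine (f : T -> R) (c u : R) : P.-integrable setT (EFin \o f) ->
  P.-integrable setT (EFin \o (fun w => c + u * f w)).
Proof.
by move=> f1; exact: (integrableD measurableT (i1 c) (integrableZl measurableT u f1)).
Qed.

Lemma integral_affine (f : T -> R) (c u : R) : P.-integrable setT (EFin \o f) ->
  (\int[P]_w (c + u * f w)%:E = c%:E + u%:E * \int[P]_w (f w)%:E)%E.
Proof.
move=> f1; rewrite -integralZl//.
rewrite [LHS](integralD measurableT (i1 c) (integrableZl measurableT u f1)).
congr (_ + _)%E; rewrite integral_cst//=.
by rewrite probability_setT mule1.
Qed.

Lemma integrable_expR_integral X (c : R) (a : R) : measurable_fun setT X ->
  (\int[P]_w (expR (c * X w))%:E = a%:E)%E ->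
  P.-integrable setT (EFin \o (fun w => expR (c * X w))).
Proof.
move=> mX E; apply/integrableP; split.
  apply/measurable_EFinP; apply: measurableT_comp => //.
  exact: measurable_funM.
by under eq_integral do rewrite gee0_abs ?lee_fin ?expR_ge0//; rewrite E ltry.
Qed.

Lemma integrable_sqr_laplace X (a b : R) : measurable_fun setT X ->
  (\int[P]_w (expR (1 * X w))%:E = a%:E)%E ->
  (\int[P]_w (expR (-1 * X w))%:E = b%:E)%E ->
  P.-integrable setT (EFin \o (fun w => X w ^+ 2)).
Proof.
move=> mX E1 E2.
have I : P.-integrable setT ((EFin \o (fun w => expR (1 * X w))) \+
    (EFin \o (fun w => expR (-1 * X w)))).
  by apply: integrableD => //; apply: integrable_expR_integral; eauto.
apply: (le_integrable _ _ _ I) => //.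
  by apply/measurable_EFinP; exact: measurable_funX.
move=> w _ /=; rewrite lee_fin !ger0_norm ?addr_ge0 ?expR_ge0 ?sqr_ge0//.
by rewrite mul1r mulN1r (le_trans _ (expRDNx_ge (X w)))// lerDr.
Qed.

Lemma integrable_laplace X (a b : R) : measurable_fun setT X ->
  (\int[P]_w (expR (1 * X w))%:E = a%:E)%E ->
  (\int[P]_w (expR (-1 * X w))%:E = b%:E)%E ->
  P.-integrable setT (EFin \o X).
Proof.
move=> mX E1 E2.
have I : P.-integrable setT ((EFin \o (fun w => expR (1 * X w))) \+
    (EFin \o (fun w => expR (-1 * X w)))).
  by apply: integrableD => //; apply: integrable_expR_integral; eauto.
apply: (le_integrable _ _ _ I) => //.
  exact/measurable_EFinP.
move=> w _ /=; rewrite lee_fin [leRHS]ger0_norm ?addr_ge0 ?expR_ge0//.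
by rewrite mul1r mulN1r ler_abs_expR.
Qed.

Lemma laplace_mean X (m v : R) : measurable_fun setT X ->
  (forall t, (\int[P]_w (expR (t * X w))%:E = (expR (t * m + t ^+ 2 * v / 2))%:E)%E) ->
  (\int[P]_w (X w)%:E = m%:E)%E.
Proof.
move=> mX E; have iX := integrable_laplace mX (E 1) (E (-1)).
have -> : (\int[P]_w (X w)%:E = (\int[P]_w X w)%:E)%E.
  by rewrite fineK//; exact: (integrable_fin_num measurableT iX).
congr EFin; apply: (@mean_of_laplace _ _ m v) => t.
rewrite -lee_fin -E EFinD EFinM.
have -> : (\int[P]_w X w)%:E = (\int[P]_w (X w)%:E)%E.
  by rewrite fineK//; exact: (integrable_fin_num measurableT iX).
rewrite -integral_affine//; apply: le_integral => //.
- exact: integrable_affine.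
- exact: (integrable_expR_integral mX (E t)).
- by move=> w _; rewrite lee_fin expR_ge1Dx.
Qed.

Lemma gaussian_rv_integrable X v : gaussian_rv P X v -> P.-integrable setT (EFin \o X).
Proof. by case=> mX _ E; exact: integrable_laplace mX (E 1) (E (-1)). Qed.

Lemma gaussian_rv_integrable_sqr X v : gaussian_rv P X v ->
  P.-integrable setT (EFin \o (fun w => X w ^+ 2)).
Proof. by case=> mX _ E; exact: integrable_sqr_laplace mX (E 1) (E (-1)). Qed.

Lemma gaussian_rv_mean X v : gaussian_rv P X v -> (\int[P]_w (X w)%:E = 0)%E.
Proof.
case=> mX _ E; apply: (@laplace_mean _ 0 v) => // t.
by rewrite E mulr0 add0r.
Qed.

(** The two transforms squeeze the second moment: cos x >= 1 - x^2 / 2 with the Fourier transform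
    bounds it below by [v], and e^x + e^{-x} >= 2 + x^2 with the Laplace transform bounds it above.
    The argument sqrt(2 u) makes t^2 / 2 equal to u, which then tends to 0. *)
Lemma gaussian_rv_variance X v : gaussian_rv P X v ->
  (\int[P]_w (X w ^+ 2)%:E = v%:E)%E.
Proof.
move=> gX; have [mX C E] := gX.
have iX := gaussian_rv_integrable_sqr gX.
have m2E : (\int[P]_w (X w ^+ 2)%:E = (\int[P]_w (X w ^+ 2))%:E)%E.
  by rewrite fineK//; exact: (integrable_fin_num measurableT iX).
rewrite m2E; congr EFin; set m2 := (\int[P]_w (X w ^+ 2)) in m2E *.
have H (c u : R) : (\int[P]_w (c + u * X w ^+ 2)%:E = (c + u * m2)%:E)%E.
  by rewrite integral_affine// m2E.
have lo u : 0 < u -> 1 - u * m2 <= expR (- (u * v)).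
  move=> u0; rewrite -lee_fin -[u in X in (_ <= X)%E](@mulfK _ 2)// -mulNr.
  have s2 : Num.sqrt (u * 2) ^+ 2 = u * 2 by rewrite sqr_sqrtr// mulr_ge0// ltW.
  have := C (Num.sqrt (u * 2)) 0; rewrite cos0 mul1r s2.
  have -> : - (u * 2 / 2 * v) = - (u * 2 * v / 2) by field.
  rewrite mulNr.
  move=> <-; rewrite -mulNr -H; apply: le_integral => //.
  - exact: (integrable_affine 1 (- u) iX).
  - apply: (integrable_bounded P (M := 1)); last by move=> w; exact: cos_max.
    apply: measurableT_comp; first by apply: continuous_measurable_fun; exact: continuous_cos.
    by apply: measurable_funD => //; exact: measurable_funM.
  - move=> w _; rewrite lee_fin (le_trans _ (cos_ge1Bx2 _))//.
    by rewrite addr0 exprMn s2 mulNr; lra.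
have up u : 0 < u -> 1 + u * m2 <= expR (u * v).
  move=> u0.
  have s2 : Num.sqrt (u * 2) ^+ 2 = u * 2 by rewrite sqr_sqrtr// mulr_ge0// ltW.
  set t := Num.sqrt (u * 2) in s2.
  have := E (- t); have := E t; rewrite sqrrN s2.
  have -> : u * 2 * v / 2 = u * v by field.
  move=> E1 E2.
  rewrite -(ler_pM2l (_ : 0 < 2))// mulr_natl -lee_fin.
  rewrite [X in (_ <= X)%E](_ : _ = ((expR (u * v))%:E + (expR (u * v))%:E)%E); last by rewrite mulr_natl.
  rewrite -{1}E1 -E2 -(integralD measurableT
    (integrable_expR_integral mX E1) (integrable_expR_integral mX E2)).
  rewrite (_ : (1 + u * m2) *+ 2 = 2 + (u * 2) * m2); last by ring.
  rewrite -H; apply: le_integral => //.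
  - exact: (integrable_affine 2 (u * 2) iX).
  - apply: integrableD => //.
      exact: (integrable_expR_integral mX E1).
    exact: (integrable_expR_integral mX E2).
  - move=> w _; rewrite -EFinD lee_fin mulNr -s2 -exprMn.
    exact: expRDNx_ge.
have m20 : 0 <= m2 by apply: Rintegral_ge0 => w _; exact: sqr_ge0.
apply/eqP; rewrite eq_le -subr_le0 -[X in _ && X]subr_le0; apply/andP; split.
- apply: (@le0_small_multiples _ _ (m2 * v) 1) => // u u0 _.
  have : (1 + u * m2) * (1 - u * v) <= 1.
    have p : 0 <= 1 + u * m2 by rewrite addr_ge0// mulr_ge0// ltW.
    rewrite (le_trans (ler_wpM2l p (expR_ge1Dx (- (u * v)))))//.
    by rewrite -[leRHS](expRxMexpNx_1 (u * v)) ler_wpM2r ?expR_ge0 ?up.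
  rewrite (_ : (1 + u * m2) * (1 - u * v) = 1 + u * (m2 - v - u * (m2 * v))); last by ring.
  by rewrite gerDl pmulr_rle0// subr_le0.
- apply: (@le0_small_multiples _ _ (m2 * v) ((m2 + 1)^-1)).
    by rewrite invr_gt0 ltr_pwDr.
  move=> u u0 um.
  have : (1 - u * m2) * (1 + u * v) <= 1.
    have p : 0 <= 1 - u * m2.
      rewrite subr_ge0 (@le_trans _ _ ((m2 + 1)^-1 * (m2 + 1)))//.
        by rewrite ler_pM ?(ltW u0) ?(ltW um) ?lerDl.
      by rewrite mulVf// gt_eqF// ltr_pwDr.
    rewrite (le_trans (ler_wpM2l p (expR_ge1Dx (u * v))))//.
    by rewrite -[leRHS](expRxMexpNx_1 (u * v)) mulrC ler_wpM2l ?expR_ge0 ?lo.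
  rewrite (_ : (1 - u * m2) * (1 + u * v) = 1 + u * (v - m2 - u * (m2 * v))); last by ring.
  by rewrite gerDl pmulr_rle0// subr_le0.
Qed.

End gaussian_moments.

(** * Gaussian vectors *)

Section independence.
Context {R : realType} {d : measure_display} {T : measurableType d}
        (P : probability T R).

(** Restricted to [E] and divided by P(E), the law of the pair agrees with the product law on
    rectangles, hence on all measurable sets. The extra event carries the remaining variables in the
    induction on partial sums. *)
Lemma independent_pair_law (X Y : {mfun T >-> R}) (E : set T) :
  measurable E ->
  (forall A B, measurable A -> measurable B ->
    P (X @^-1` A `&` Y @^-1` B `&` E) = (P (X @^-1` A) * P (Y @^-1` B) * P E)%E) ->
  forall C : set (R * R), measurable C ->
    P ((fun w => (X w, Y w)) @^-1` C `&` E) =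
    ((distribution P X \x distribution P Y) C * P E)%E.
Proof.
move=> mE ind C mC.
have mXY : measurable_fun setT (fun w => (X w, Y w)) by exact: measurable_fun_pair.
have mXYC : measurable ((fun w => (X w, Y w)) @^-1` C).
  by rewrite -[X in measurable X]setTI; exact: mXY.
have PEfin : P E \is a fin_num by exact: fin_num_measure.
have [PE0|PE0] := eqVneq (P E) 0%E.
  rewrite PE0 mule0; apply/eqP; rewrite eq_le measure_ge0 andbT -PE0.
  by apply: le_measure; rewrite ?inE//; exact: measurableI.
have k0 : (0 <= (fine (P E))^-1)%R by rewrite invr_ge0 fine_ge0.
have PE1 : ((fine (P E))^-1%:E * P E = 1)%E.
  by rewrite -[X in (_ * X)%E](fineK PEfin) -EFinM mulVf// -eqe fineK.
have -> : (distribution P X \x distribution P Y)%E C =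
    ((fine (P E))^-1%:E * P ((fun w => (X w, Y w)) @^-1` C `&` E))%E.
  apply: (@product_measure_unique _ _ _ _ _ (distribution P X) (distribution P Y)
    (mscale (NngNum k0) (pushforward (mrestr P mE) (fun w => (X w, Y w))))) => //.
  move=> A B mA mB.
  transitivity ((fine (P E))^-1%:E * P (X @^-1` A `&` Y @^-1` B `&` E))%E; first by [].
  by rewrite ind// muleCA [X in (_ * X)%E](_ : _ = 1%E) ?mule1 // muleC PE1.
by rewrite muleAC PE1 mul1e.
Qed.

Definition independent_rv (X Y : T -> R) : Prop :=
  forall A B, measurable A -> measurable B ->
    P (X @^-1` A `&` Y @^-1` B) = (P (X @^-1` A) * P (Y @^-1` B))%E.

Lemma ge0_integral_independent_rv (X Y : T -> R) (f : R * R -> \bar R) :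
  measurable_fun setT X -> measurable_fun setT Y -> independent_rv X Y ->
  measurable_fun setT f -> (forall z, (0 <= f z)%E) ->
  (\int[P]_w f (X w, Y w) = \int[P]_w \int[P]_w' f (X w, Y w'))%E.
Proof.
move=> mX mY ind mf f0.
pose X' : {mfun T >-> R} := HB.pack X (isMeasurableFun.Build _ _ T R X mX).
pose Y' : {mfun T >-> R} := HB.pack Y (isMeasurableFun.Build _ _ T R Y mY).
have mXY : measurable_fun setT (fun w => (X w, Y w)) by exact: measurable_fun_pair.
pose XY : {mfun T >-> (R * R)%type} := HB.pack (fun w => (X w, Y w))
  (isMeasurableFun.Build _ _ T (R * R)%type (fun w => (X w, Y w)) mXY).
transitivity (\int[distribution P XY]_z f z)%E.
  by rewrite ge0_integral_distribution.
transitivity (\int[distribution P X' \x distribution P Y']_z f z)%E.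
  apply: eq_measure_integral => C mC _.
  have := @independent_pair_law X' Y' setT measurableT _ C mC.
  rewrite probability_setT mule1 setIT; apply.
  by move=> A B mA mB; rewrite setIT mule1; exact: ind.
rewrite fubini_tonelli1// ge0_integral_distribution//.
- apply: eq_integral => w _ /=; rewrite /fubini_F ge0_integral_distribution//.
  exact: measurableT_comp.
- exact: measurable_fun_fubini_tonelli_F.
- by move=> x; exact: integral_ge0.
Qed.

(** Integrating over [Y] first, the contribution of [X] to the argument of the cosine is a constant
    phase; this is why [gaussian_rv] quantifies over phases. *)
Lemma gaussian_rvD (X Y : T -> R) (u v : R) :
  gaussian_rv P X u -> gaussian_rv P Y v -> independent_rv X Y ->
  gaussian_rv P (fun w => X w + Y w) (u + v).
Proof.
move=> [mX CX EX] [mY CY EY] ind.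
have mcos (b t : R) (Z : T -> R) : measurable_fun setT Z ->
    measurable_fun setT (fun w => cos (t * Z w + b)).
  move=> mZ; apply: measurableT_comp; first by apply: continuous_measurable_fun; exact: continuous_cos.
  by apply: measurable_funD => //; exact: measurable_funM.
have mXY : measurable_fun setT (fun w => X w + Y w) by exact: measurable_funD.
have m2 (t : R) : measurable_fun setT (fun z : R * R => t * (z.1 + z.2)).
  by apply: measurable_funM => //; exact: measurable_funD.
split=> // [t b|t].
(* Raised by 1 for Tonelli's theorem, which asks for a nonnegative integrand. *)
- pose f (z : R * R) := (1 + cos (t * (z.1 + z.2) + b))%:E.
  have f0 z : (0 <= f z)%E by rewrite lee_fin -lerBlDl sub0r cos_geN1.
  have mf : measurable_fun setT f.
    apply/measurable_EFinP; apply: measurable_funD => //.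
    apply: (@measurableT_comp _ _ _ _ _ _ cos); first by apply: continuous_measurable_fun; exact: continuous_cos.
    exact: measurable_funD.
  have bc (Z : T -> R) (s c : R) w : `|cos (s * Z w + c)| <= 1 by exact: cos_max.
  have H := ge0_integral_independent_rv mX mY ind mf f0.
  have icos : P.-integrable setT (EFin \o (fun w => cos (t * (X w + Y w) + b))).
    by apply: (integrable_bounded P (M := 1)); [exact: mcos|exact: bc].
  suff : (1%:E + \int[P]_w (cos (t * (X w + Y w) + b))%:E =
      1%:E + (cos b * expR (- (t ^+ 2 * (u + v) / 2)))%:E)%E.
    by rewrite ![(1 + _)%E]addeC => /(congr1 (fun x => x - 1%:E)%E); rewrite !addeK.
  have := integral_affine 1 1 icos; rewrite mul1e => <-.
  under eq_integral do rewrite mul1r.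
  rewrite [LHS]H /f/=.
  under eq_integral => w _.
    under eq_integral => w' _.
      rewrite (_ : t * (X w + Y w') + b = t * Y w' + (t * X w + b)); last by ring.
      over.
    rewrite (integral_affine_bounded 1 (mcos _ _ _ mY) (bc _ _ _) (CY _ _)).
    rewrite mulrC.
    over.
  rewrite integral_affine; last first.
    by apply: (integrable_bounded P (M := 1)); [exact: mcos|exact: bc].
  rewrite CX -EFinM; congr (_ + _%:E)%E.
  by rewrite mulrCA; congr (_ * _); rewrite -expRD; congr expR; field.
- pose f (z : R * R) := (expR (t * (z.1 + z.2)))%:E.
  have f0 z : (0 <= f z)%E by rewrite lee_fin expR_ge0.
  have mf : measurable_fun setT f.
    by apply/measurable_EFinP; exact: (@measurableT_comp _ _ _ _ _ _ expR).
  rewrite [LHS](ge0_integral_independent_rv mX mY ind mf f0) /f/=.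
  have iY := integrable_expR_integral mY (EY t).
  have iX := integrable_expR_integral mX (EX t).
  under eq_integral => w _.
    under eq_integral => w' _ do rewrite mulrDr expRD EFinM.
    rewrite integralZl//= EY.
    over.
  by rewrite integralZr//= EX -EFinM -expRD; congr (expR _)%:E; field.
Qed.

Lemma gaussian_rvZ (X : T -> R) (c v : R) :
  gaussian_rv P X v -> gaussian_rv P (fun w => c * X w) (c ^+ 2 * v).
Proof.
move=> [mX CX EX]; split => [|t b|t].
- exact: measurable_funM.
- under eq_integral do rewrite mulrA.
  by rewrite CX; congr (_ * expR _)%:E; field.
- under eq_integral do rewrite mulrA.
  by rewrite EX; congr (expR _)%:E; field.
Qed.

Lemma gaussian_rv_cst0 : gaussian_rv P (fun=> 0) 0.
Proof.
split=> // [t b|t].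
  by rewrite integral_cst//= probability_setT mule1 !mulr0 mul0r oppr0 expR0 mulr1 add0r.
by rewrite integral_cst//= probability_setT mule1 !mulr0 mul0r.
Qed.

(* Summing over a duplicate-free list, the indices already summed are those
   whose events are trivial. *)
Lemma mutually_indep_partial_sum (N : nat) (X : 'I_N -> T -> R) (c : 'I_N -> R)
    (s : seq 'I_N) :
  (forall i, measurable_fun setT (X i)) -> mutually_indep P X -> uniq s ->
  forall (A : set R) (B : 'I_N -> set R), measurable A ->
    (forall i, measurable (B i)) -> (forall i, i \in s -> B i = setT) ->
    P ((fun w => \sum_(i <- s) c i * X i w) @^-1` A `&`
       \bigcap_(i in [set: 'I_N]) (X i @^-1` B i)) =
    (P ((fun w => \sum_(i <- s) c i * X i w)%R @^-1` A) *
     \prod_(i < N) P (X i @^-1` B i))%E.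
Proof.
move=> mX ind; elim: s => [_ A B mA mB _|j s IH /andP[js us] A B mA mB Bs].
  under eq_fun do rewrite big_nil.
  have [A0|A0] := pselect (A 0).
    rewrite (_ : _ @^-1` A = setT) ?setTI ?probability_setT ?mul1e ?ind//.
    by apply/seteqP; split => w.
  rewrite (_ : _ @^-1` A = set0) ?set0I ?measure0 ?mul0e//.
  by apply/seteqP; split => w.
pose U w := \sum_(i <- s) c i * X i w.
have mU : measurable_fun setT U.
  by apply: measurable_sum => i; exact: measurable_funM.
pose U' : {mfun T >-> R} := HB.pack U (isMeasurableFun.Build _ _ T R U mU).
pose Xj : {mfun T >-> R} := HB.pack (X j) (isMeasurableFun.Build _ _ T R (X j) (mX j)).
pose E B' := \bigcap_(i in [set: 'I_N]) (X i @^-1` B' i).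
have mXB (i : 'I_N) (D : set R) : measurable D -> measurable (X i @^-1` D).
  by move=> mD; rewrite -[X in measurable X]setTI; exact: (mX i).
have mE (B' : 'I_N -> set R) : (forall i, measurable (B' i)) -> measurable (E B').
  by move=> mB'; apply: fin_bigcap_measurable => // i _; exact: mXB.
pose C := [set z : R * R | A (c j * z.2 + z.1)].
have mC : measurable C.
  rewrite -[X in measurable X]setTI.
  apply: (_ : measurable_fun setT (fun z : R * R => c j * z.2 + z.1)) => //.
  by apply: measurable_funD => //; exact: measurable_funM.
have joint (B' : 'I_N -> set R) : (forall i, measurable (B' i)) ->
    (forall i, i \in j :: s -> B' i = setT) ->
    P ((fun w => (U' w, Xj w)) @^-1` C `&` E B') =
    ((distribution P U' \x distribution P Xj) C * P (E B'))%E.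
  move=> mB' B's; apply: independent_pair_law => //; first exact: mE.
  move=> A1 A2 mA1 mA2.
  (* The condition on [X j] joins the family of events, where index [j] was still trivial, so that
     the induction hypothesis applies to the sum over [s]. *)
  pose B1 i := if i == j then A2 else B' i.
  have mB1 i : measurable (B1 i) by rewrite /B1; case: ifP.
  have EB1 : Xj @^-1` A2 `&` E B' = E B1.
    apply/seteqP; split => w.
      by move=> [wA2 wE] i _; rewrite /B1; case: eqVneq => [->//|_]; exact: wE.
    move=> wE; split.
      by have := wE j I; rewrite /B1 eqxx.
    move=> i _; have := wE i I; rewrite /B1; case: eqVneq => [->//|//] _.
    by rewrite B's// mem_head.
  rewrite -setIA EB1 (IH us A1 B1)//; last first.
    move=> i si; rewrite /B1; case: eqVneq => [ij|_]; first by rewrite -ij si in js.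
    by rewrite B's// inE si orbT.
  rewrite -muleA; congr (_ * _)%E.
  rewrite /E ind// (bigD1 j)//= [in RHS](bigD1 j)//= {1}/B1 eqxx; congr (_ * _)%E.
  rewrite B's ?mem_head// preimage_setT probability_setT mul1e.
  by apply: eq_bigr => i /negbTE ij; rewrite /B1 ij.
have eqA : (fun w => \sum_(i <- j :: s) c i * X i w) @^-1` A =
    (fun w => (U' w, Xj w)) @^-1` C.
  by apply/seteqP; split => w; rewrite /C /preimage/= big_cons.
rewrite eqA [LHS]joint// -ind//; congr (_ * _)%E.
(* With all events trivial, the same identity evaluates the product measure of [C]. *)
have := joint (fun=> setT) (fun=> measurableT) (fun _ _ => erefl).
have -> : E (fun=> setT) = setT by apply/seteqP; split => w.
by rewrite setIT probability_setT mule1.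
Qed.

Lemma gaussian_rv_sum (N : nat) (X : 'I_N -> T -> R) (v : R) (c : 'I_N -> R) :
  (forall i, gaussian_rv P (X i) v) -> mutually_indep P X ->
  gaussian_rv P (fun w => \sum_i c i * X i w) (\sum_i c i ^+ 2 * v).
Proof.
move=> gX ind; have mX i : measurable_fun setT (X i) by have [] := gX i.
have : uniq (index_enum 'I_N) by exact: index_enum_uniq.
elim: (index_enum 'I_N) => [_|j s IH /= /andP[js us]].
  rewrite big_nil; under eq_fun do rewrite big_nil.
  exact: gaussian_rv_cst0.
rewrite big_cons addrC; under eq_fun do rewrite big_cons addrC.
apply: gaussian_rvD; [exact: IH|exact: gaussian_rvZ|].
move=> A B mA mB.
pose B' i := if i == j then [set x | B (c j * x)] else setT.
have mB' i : measurable (B' i).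
  rewrite /B'; case: ifP => // _; rewrite -[X in measurable X]setTI.
  by apply: (_ : measurable_fun setT (fun z : R => c j * z)) => //; exact: measurable_funM.
have := mutually_indep_partial_sum c mX ind us mA mB'.
have -> : \bigcap_(i in [set: 'I_N]) X i @^-1` B' i = (fun w => c j * X j w) @^-1` B.
  apply/seteqP; split => w; first by move=> /(_ j I); rewrite /B' eqxx.
  by move=> Bw i _; rewrite /B'; case: eqVneq => [->|].
move=> ->; last first.
  by move=> i si; rewrite /B'; case: eqVneq => // ij; rewrite -ij si in js.
rewrite (bigD1 j)//= big1 ?mule1; last first.
  by move=> i /negbTE ij; rewrite /B' ij preimage_setT probability_setT.
by rewrite {1}/B' eqxx.
Qed.

End independence.

Section gaussian_vector.
Context {R : realType} {d : measure_display} {T : measurableType d}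
        (P : probability T R).

Definition gaussian_vec (N : nat) (e : T -> 'cV[R]_N) (V : 'M[R]_N) : Prop :=
  forall c : 'cV[R]_N, gaussian_rv P (fun w => (c^T *m e w) 0 0) (quad V c).

Lemma integrable_mul_sqr (f g : T -> R) :
  measurable_fun setT f -> measurable_fun setT g ->
  P.-integrable setT (EFin \o (fun w => f w ^+ 2)) ->
  P.-integrable setT (EFin \o (fun w => g w ^+ 2)) ->
  P.-integrable setT (EFin \o (fun w => f w * g w)).
Proof.
move=> mf mg f2 g2; apply: (le_integrable _ _ _ (integrableD measurableT f2 g2)) => //.
  by apply/measurable_EFinP; exact: measurable_funM.
move=> w _ /=; rewrite lee_fin normrM [leRHS]ger0_norm ?addr_ge0 ?sqr_ge0//.
rewrite -(real_normK (num_real (f w))) -(real_normK (num_real (g w))).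
have := sqr_ge0 (`|f w| - `|g w|); have := normr_ge0 (f w); have := normr_ge0 (g w).
by nra.
Qed.

End gaussian_vector.

Section noise.
Context {R : realType} {d : measure_display} {T : measurableType d}
        {P : probability T R} {dim k p N : nat} (S : setting P dim k p N)
        (Theta : set 'rV[R]_k) (std : standing_assumptions S Theta).

Let eta_ (i : 'I_N) : T -> R := Defs.eta S (site S i).
Let eps_ (i : 'I_N) : T -> R := eps S i.

Lemma sub_generated_sigma {I : Type} (D : set I) (X : I -> {RV P >-> R}) (M : nat)
    (s : 'I_M -> I) (c : 'I_M -> R) (A : set R) : (forall j, D (s j)) -> measurable A ->
  generated_sigma D (fun i => X i : T -> R)
    ((fun w => \sum_(j < M) c j * X (s j) w) @^-1` A).
Proof.
move=> Ds mA; rewrite /generated_sigma; set G := \bigcup_(i in D) _.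
have mX (j : 'I_M) : measurable_fun setT ((X (s j) : T -> R) : g_sigma_algebraType G -> R).
  move=> _ B mB; rewrite setTI; apply: sub_sigma_algebra.
  exists (s j) => //; exists B => //; by rewrite setTI.
have mS : measurable_fun setT
    ((fun w => \sum_(j < M) c j * X (s j) w) : g_sigma_algebraType G -> R).
  by apply: measurable_sum => j; exact: measurable_funM.
by have := mS measurableT A mA; rewrite setTI.
Qed.

Lemma gaussian_process_sum (c : 'I_N -> R) : exists v,
  gaussian_rv P (fun w => \sum_i c i * eta_ i w) v.
Proof.
have meta i : measurable_fun setT (eta_ i) by exact: measurable_funPT.
have ieta i : P.-integrable setT (EFin \o eta_ i).
  have [m [s [_ l]]] := eta_gaussian std (m := 1) (s := fun=> site S i) (fun=> 1) (fun=> site_region std i).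
  have {}l : has_normal_law P (eta_ i) m s.
    move=> B mB; rewrite -l//; congr (P _); apply/seteqP; split => w /=; rewrite big_ord1 mul1r//.
  have E t := normal_law_expR t (meta i) l.
  exact: (integrable_laplace (meta i) (E 1) (E (-1))).
have [m [s [_ l]]] := eta_gaussian std (s := fun i => site S i) c (site_region std).
have mS : measurable_fun setT (fun w => \sum_i c i * eta_ i w).
  by apply: measurable_sum => i; exact: measurable_funM.
(* The definition of a Gaussian process leaves the mean of a combination free; it is the combination
   of the means at the single sites, all zero. *)
have m0 : m = 0.
  have := laplace_mean mS (fun t => normal_law_expR t mS l).
  under eq_integral do rewrite -sumEFin.
  rewrite integral_sum//; last by move=> i; exact: (integrableZl _ (c i) (ieta i)).
  rewrite big1; first by case.
  move=> i _; under eq_integral do rewrite EFinM.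
  rewrite integralZl//; last exact: ieta.
  have := eta_centered std (site_region std i); rewrite unlock => ->.
  by rewrite mule0.
by exists (s ^+ 2); apply: normal_law_gaussian_rv => //; rewrite m0 in l.
Qed.

Lemma noise_vec_gaussian_rv (c : 'I_N -> R) : exists v,
  gaussian_rv P (fun w => \sum_i c i * noise_vec S w i 0) v.
Proof.
have [u gu] := gaussian_process_sum c.
have [v v0 lv] := eps_normal std.
have geps i : gaussian_rv P (eps_ i) v.
  rewrite -(sqr_sqrtr v0); apply: normal_law_gaussian_rv.
    exact: (measurable_funPT (eps S i)).
  exact: lv.
have gs := gaussian_rv_sum c geps (eps_indep std).
exists (u + \sum_i c i ^+ 2 * v).
rewrite (_ : (fun w => _) = fun w => (\sum_i c i * eta_ i w) + (\sum_i c i * eps_ i w)).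
  apply: gaussian_rvD => // A B mA mB; apply: (eps_eta_indep std).
    by apply: (sub_generated_sigma (X := fun s => Defs.eta S s)) => // j; exact: site_region std j.
  exact: (sub_generated_sigma (X := fun i => eps S i) (s := id)).
apply/funext => w; rewrite -big_split; apply: eq_bigr => i _.
by rewrite mxE mulrDr.
Qed.

Lemma noise_entry_gaussian (i : 'I_N) : exists v,
  gaussian_rv P (fun w => noise_vec S w i 0) v.
Proof.
have [v gv] := noise_vec_gaussian_rv (fun j => (j == i)%:R).
exists v; rewrite (_ : (fun w => _) = fun w => \sum_j (j == i)%:R * noise_vec S w j 0)//.
apply/funext => w; rewrite (bigD1 i)//= eqxx mul1r big1 ?addr0// => j /negbTE ->.
by rewrite mul0r.
Qed.

Lemma measurable_noise (i : 'I_N) : measurable_fun setT (fun w => noise_vec S w i 0).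
Proof. by have [v []] := noise_entry_gaussian i. Qed.

Lemma integrable_noise2 (i j : 'I_N) :
  P.-integrable setT (EFin \o (fun w => noise_vec S w i 0 * noise_vec S w j 0)).
Proof.
apply: integrable_mul_sqr; try exact: measurable_noise.
  by have [v gv] := noise_entry_gaussian i; exact: gaussian_rv_integrable_sqr gv.
by have [v gv] := noise_entry_gaussian j; exact: gaussian_rv_integrable_sqr gv.
Qed.

Lemma expectation_Z (i : 'I_N) : ('E_P[(fun w => Z S w i 0)%R] = (mean_fun S (site S i))%:E)%E.
Proof.
have [v gv] := noise_entry_gaussian i.
rewrite unlock.
rewrite (_ : (fun w => _) = fun w => (mean_fun S (site S i) + 1 * noise_vec S w i 0)%:E).
  by rewrite integral_affine ?(gaussian_rv_mean gv) ?mule0 ?adde0//;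
    exact: gaussian_rv_integrable gv.
by apply/funext => w; rewrite !mxE mul1r.
Qed.

Lemma mu0E : mu0 S = \col_i mean_fun S (site S i).
Proof. by apply/matrixP => i j; rewrite !mxE expectation_Z. Qed.

Lemma ZE w : Z S w = mu0 S + noise_vec S w.
Proof. by rewrite mu0E. Qed.

Lemma Sigma0E (i j : 'I_N) :
  (\int[P]_w (noise_vec S w i 0 * noise_vec S w j 0)%R%:E = (Sigma0 S i j)%:E)%E.
Proof.
rewrite mxE covariance.unlock !expectation_Z expectation.unlock/=.
rewrite -[LHS]fineK; last exact: (integrable_fin_num measurableT (integrable_noise2 i j)).
congr (fine _)%:E; apply: eq_integral => w _; congr EFin.
rewrite -[RHS]/((Z S w i 0 - mean_fun S (site S i)) * (Z S w j 0 - mean_fun S (site S j))).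
by rewrite !mxE; congr (_ * _); ring.
Qed.

(** A combination of the noise is already known to be centred Gaussian with some variance; computing
    its second moment from the entries of [Sigma0] identifies that variance. *)
Lemma noise_vec_gaussian : gaussian_vec P (noise_vec S) (Sigma0 S).
Proof.
move=> c.
have cE w : (c^T *m noise_vec S w) 0 0 = \sum_i c i 0 * noise_vec S w i 0.
  by rewrite mxE; apply: eq_bigr => i _; rewrite mxE.
under eq_fun do rewrite cE.
have [v gv] := noise_vec_gaussian_rv (fun i => c i 0).
suff -> : quad (Sigma0 S) c = v by [].
have := gaussian_rv_variance gv.
rewrite (_ : (fun w => _) = (fun w => \sum_i \sum_j
  ((c i 0 * c j 0) * (noise_vec S w i 0 * noise_vec S w j 0))%:E)%E); last first.
  apply/funext => w; rewrite expr2 mulr_suml -sumEFin; apply: eq_bigr => i _.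
  rewrite mulr_sumr -sumEFin; apply: eq_bigr => j _; congr EFin; ring.
rewrite integral_sum//; last first.
  move=> i; apply: integrable_sum => // j _.
  exact: (integrableZl _ (c i 0 * c j 0) (integrable_noise2 i j)).
under eq_bigr => i _.
  rewrite integral_sum//; last first.
    move=> j; exact: (integrableZl _ (c i 0 * c j 0) (integrable_noise2 i j)).
  under eq_bigr => j _.
    under eq_integral do rewrite EFinM.
    rewrite integralZl//; last exact: integrable_noise2.
    rewrite Sigma0E -EFinM.
    over.
  rewrite sumEFin.
  over.
rewrite sumEFin => -[<-].
rewrite /quad mxE exchange_big/=; apply: eq_bigr => j _.
rewrite mxE mulr_suml; apply: eq_bigr => i _.
by rewrite !mxE; ring.
Qed.

End noise.

(** * Quadratic forms of Gaussian vectors *)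

Section gaussian_density_integrals.
Context {R : realType}.
Local Notation mu := (@lebesgue_measure R).
Local Notation phi := (normal_pdf (0 : R) 1).

(** The integrand is a multiple of the density of N(0, 1 / (1 + a)). *)
Lemma integral_gauss_scaled (a : R) : 0 < 1 + a ->
  (\int[mu]_g (phi g * expR (- (a * g ^+ 2 / 2)))%:E = ((Num.sqrt (1 + a))^-1)%:E)%E.
Proof.
move=> a1; pose s := (Num.sqrt (1 + a))^-1.
have s0 : 0 < s by rewrite invr_gt0 sqrtr_gt0.
have s2 : s ^+ 2 = (1 + a)^-1 by rewrite exprVn sqr_sqrtr// ltW.
have E g : phi g * expR (- (a * g ^+ 2 / 2)) = s * normal_pdf 0 s g.
  rewrite !normal_pdfE ?oner_eq0 ?gt_eqF//.
  rewrite -[LHS]mulrA [RHS]mulrA /normal_fun -expRD !subr0; congr (_ * expR _).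
    rewrite /normal_peak s2 expr1n mul1r -mulrnAr sqrtrM ?invr_ge0 ?(ltW a1)// sqrtrV ?(ltW a1)//.
    by rewrite invfM mulrA /s divff ?mul1r// invr_eq0 gt_eqF// sqrtr_gt0.
  rewrite s2 expr1n; field.
  by rewrite gt_eqF.
under eq_integral do rewrite E EFinM.
rewrite integralZl//= ?integral_normal_pdf ?mule1//; exact: integrable_normal_pdf.
Qed.

(** Read from right to left, this identity and the next make an exponent linear in [y] instead of
    quadratic, at the price of an auxiliary normal variable (Hubbard-Stratonovich
    transformation). *)
Lemma expR_half_sqr_cos (y z : R) :
  (\int[mu]_g (cos (y * g + z) * phi g)%:E = (expR (- (y ^+ 2 / 2)) * cos z)%:E)%E.
Proof. by rewrite integral_cos_normal ?oner_eq0// expr1n mulr1 mulrC. Qed.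

Lemma expR_half_sqr (y : R) :
  (\int[mu]_g (expR (y * g) * phi g)%:E = (expR (y ^+ 2 / 2))%:E)%E.
Proof. by rewrite integral_expR_normal ?oner_eq0// expr1n mulr1 mulr0 add0r. Qed.

End gaussian_density_integrals.

Section standard_gaussian_family.
Context {R : realType} {d : measure_display} {T : measurableType d}
        (P : probability T R) {n : nat} (xi : 'I_n -> T -> R).
Hypothesis mxi : forall j, measurable_fun setT (xi j).
Hypothesis gxi : forall u : 'I_n -> R,
  gaussian_rv P (fun w => \sum_j u j * xi j w) (\sum_j u j ^+ 2).
Local Notation mu := (@lebesgue_measure R).
Local Notation phi := (normal_pdf (0 : R) 1).
Variable a : 'I_n -> R.
Hypothesis a0 : forall j, 0 <= a j.

Let q (s : seq 'I_n) w := \sum_(j <- s) a j * xi j w ^+ 2.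
Let l (u : 'I_n -> R) w := \sum_j u j * xi j w.

Let mq s : measurable_fun setT (q s).
Proof. by apply: measurable_sum => j; apply: measurable_funM => //; exact: measurable_funX. Qed.

Let ml u : measurable_fun setT (l u).
Proof. by apply: measurable_sum => j; exact: measurable_funM. Qed.

Let q0 s w : 0 <= q s w.
Proof. by apply: sumr_ge0 => j _; rewrite mulr_ge0// sqr_ge0. Qed.

Let upd (u : 'I_n -> R) j (x : R) := fun i => if i == j then x else u i.

Let l_upd u j x w : u j = 0 -> l (upd u j x) w = x * xi j w + l u w.
Proof.
move=> uj; rewrite /l (bigD1 j)//= [in RHS](bigD1 j)//= uj mul0r add0r.
rewrite /upd eqxx; congr (_ + _); apply: eq_bigr => i /negbTE ij.
by rewrite ij.
Qed.

Let sqr_upd u j x : u j = 0 -> \sum_i (upd u j x) i ^+ 2 = x ^+ 2 + \sum_i u i ^+ 2.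
Proof.
move=> uj; rewrite (bigD1 j)//= [in RHS](bigD1 j)//= uj expr0n/= add0r.
rewrite /upd eqxx; congr (_ + _); apply: eq_bigr => i /negbTE ij.
by rewrite ij.
Qed.

Let mcos : measurable_fun setT (@cos R).
Proof. by apply: continuous_measurable_fun; exact: continuous_cos. Qed.

Let iphi : (P \x mu)%E.-integrable setT (fun z => (phi z.2)%:E).
Proof.
apply/integrable12ltyP.
  by apply/measurable_EFinP; apply: measurableT_comp => //; exact: measurable_normal_pdf.
under eq_integral => w _.
  under eq_integral => g _ do rewrite /= ger0_norm ?normal_pdf_ge0//.
  rewrite integral_normal_pdf.
  over.
by rewrite integral_cst//= probability_setT mule1 ltry.
Qed.

(* Each factor exp(- a xi^2 / 2) is the Fourier transform of a Gaussian
   variable g independent of everything, which reduces to the transform of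
   linear forms. *)
Lemma laplace_neg_quadratic (s : seq 'I_n) (u : 'I_n -> R) : uniq s ->
  (forall j, j \in s -> u j = 0) ->
  (\int[P]_w (expR (- (q s w / 2)) * cos (l u w))%:E =
   ((\prod_(j <- s) (Num.sqrt (1 + a j))^-1) * expR (- ((\sum_j u j ^+ 2) / 2)))%:E)%E.
Proof.
elim: s u => [|j s IH] u /=.
  move=> _ _; rewrite big_nil mul1r.
  have [_ C _] := gxi u; have := C 1 0.
  rewrite cos0 mul1r expr1n mul1r => <-; apply: eq_integral => w _.
  by rewrite /q big_nil mul0r oppr0 expR0 mul1r mul1r addr0.
move=> /andP[js us] u0.
have uj : u j = 0 by apply: u0; rewrite mem_head.
have us0 i : i \in s -> u i = 0 by move=> si; apply: u0; rewrite inE si orbT.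
pose r := Num.sqrt (a j).
have r2 : r ^+ 2 = a j by rewrite sqr_sqrtr.
pose F (z : T * R) := expR (- (q s z.1 / 2)) * (cos (r * xi j z.1 * z.2 + l u z.1) * phi z.2).
have mF : measurable_fun setT F.
  have mqz : measurable_fun setT (fun z : T * R => q s z.1) by exact: measurableT_comp.
  have mlz : measurable_fun setT (fun z : T * R => l u z.1) by exact: measurableT_comp.
  have mxz : measurable_fun setT (fun z : T * R => xi j z.1) by exact: measurableT_comp.
  apply: measurable_funM.
    apply: measurableT_comp => //; apply: measurableT_comp => //.
    exact: measurable_funM.
  apply: measurable_funM; last first.
    by apply: measurableT_comp => //; exact: measurable_normal_pdf.
  apply: (measurableT_comp mcos); apply: measurable_funD => //.
  by apply: measurable_funM => //; exact: measurable_funM.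
have F1 z : `|F z| <= phi z.2.
  rewrite /F !normrM (ger0_norm (expR_ge0 _)) (ger0_norm (normal_pdf_ge0 _ _ _)) mulrA.
  rewrite ler_piMl ?normal_pdf_ge0// mulr_ile1 ?expR_ge0 ?cos_max//.
  by rewrite expR_le1 oppr_le0 divr_ge0.
have iF : (P \x mu)%E.-integrable setT (EFin \o F).
  apply: (le_integrable measurableT _ _ iphi); first exact/measurable_EFinP.
  by move=> z _ /=; rewrite lee_fin (le_trans (F1 z))// ler_norm.
transitivity (\int[P]_w \int[mu]_g (F (w, g))%:E)%E.
  apply: eq_integral => w _; rewrite /F/=.
  under eq_integral do rewrite EFinM.
  rewrite integralZl//=; last first.
    apply: (le_integrable measurableT _ _ (integrable_normal_pdf 0 1)).
      apply/measurable_EFinP; apply: measurable_funM; last exact: measurable_normal_pdf.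
      by apply: (measurableT_comp mcos); apply: measurable_funD => //; exact: measurable_funM.
    move=> g _ /=; rewrite lee_fin normrM ler_piMl// cos_max//.
  rewrite expR_half_sqr_cos -EFinM mulrA -expRD exprMn r2; congr (expR _ * _)%:E.
  by rewrite /q big_cons; field.
(* For fixed g the linear form has acquired the coefficient r g at index [j], where [u] vanished.
   The induction hypothesis integrates over [w], and a Gaussian integral in g remains. *)
rewrite (Fubini iF).
transitivity (\int[mu]_g ((\prod_(i <- s) (Num.sqrt (1 + a i))^-1 * expR (- ((\sum_i u i ^+ 2) / 2)))%:E
    * (phi g * expR (- (a j * g ^+ 2 / 2)))%:E))%E.
  apply: eq_integral => g _.
  have uus i : i \in s -> upd u j (r * g) i = 0.
    by move=> si; rewrite /upd; case: eqVneq => [ij|_]; [rewrite -ij si in js|exact: us0].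
  have := IH _ us uus; rewrite (sqr_upd _ uj) exprMn r2.
  move=> E.
  transitivity (\int[P]_w ((phi g)%:E * (expR (- (q s w / 2)) * cos (l (upd u j (r * g)) w))%:E))%E.
    apply: eq_integral => w _; rewrite /F/= -EFinM (l_upd _ _ uj); congr EFin.
    by rewrite mulrA [phi g * _]mulrC; congr (_ * cos (_ + _) * _); ring.
  rewrite integralZl//=; last first.
    apply: (integrable_bounded P (M := 1)).
      apply: measurable_funM; last exact: measurableT_comp.
      apply: measurableT_comp => //; apply: measurableT_comp => //.
      exact: measurable_funM.
    move=> w; rewrite normrM mulr_ile1 ?cos_max// ger0_norm ?expR_ge0//.
    by rewrite expR_le1 oppr_le0 divr_ge0.
  rewrite E -EFinM; congr EFin.
  rewrite mulrDl opprD expRD; ring.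
rewrite integralZl//; last first.
  apply: (le_integrable measurableT _ _ (integrable_normal_pdf 0 1)).
    apply/measurable_EFinP; apply: measurable_funM; first exact: measurable_normal_pdf.
    apply: measurableT_comp => //; apply: measurableT_comp => //.
    by apply: measurable_funM => //; apply: measurable_funM => //; exact: measurable_funX.
  move=> g _ /=; rewrite lee_fin normrM ler_piMr// ger0_norm ?expR_ge0//.
  by rewrite expR_le1 oppr_le0 divr_ge0// mulr_ge0// sqr_ge0.
by rewrite integral_gauss_scaled -?EFinM ?ltr_pwDl// big_cons; congr EFin; ring.
Qed.

(** The same linearisation with the Laplace transform. The bound on [a] keeps the integral over the
    auxiliary variable finite, and nonnegativity lets Tonelli exchange the integrals. *)
Lemma laplace_pos_quadratic (s : seq 'I_n) (u : 'I_n -> R) : uniq s ->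
  (forall j, a j < 1) -> (forall j, j \in s -> u j = 0) ->
  (\int[P]_w (expR (q s w / 2 + l u w))%:E =
   ((\prod_(j <- s) (Num.sqrt (1 - a j))^-1) * expR ((\sum_j u j ^+ 2) / 2))%:E)%E.
Proof.
move=> + a1; elim: s u => [|j s IH] u /=.
  move=> _ _; rewrite big_nil mul1r.
  have [_ _ E] := gxi u; have := E 1.
  rewrite expr1n mul1r => <-; apply: eq_integral => w _.
  by rewrite /q big_nil mul0r add0r mul1r.
move=> /andP[js us] u0.
have uj : u j = 0 by apply: u0; rewrite mem_head.
have us0 i : i \in s -> u i = 0 by move=> si; apply: u0; rewrite inE si orbT.
pose r := Num.sqrt (a j).
have r2 : r ^+ 2 = a j by rewrite sqr_sqrtr.
pose F (z : T * R) := expR (q s z.1 / 2 + l u z.1) * (expR (r * xi j z.1 * z.2) * phi z.2).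
have mexp : measurable_fun setT (@expR R) by exact: measurable_expR.
have mF : measurable_fun setT F.
  have mqz : measurable_fun setT (fun z : T * R => q s z.1) by exact: measurableT_comp.
  have mlz : measurable_fun setT (fun z : T * R => l u z.1) by exact: measurableT_comp.
  have mxz : measurable_fun setT (fun z : T * R => xi j z.1) by exact: measurableT_comp.
  apply: measurable_funM.
    apply: measurableT_comp => //; apply: measurable_funD => //.
    exact: measurable_funM.
  apply: measurable_funM; last first.
    by apply: measurableT_comp => //; exact: measurable_normal_pdf.
  apply: (measurableT_comp mexp); apply: measurable_funM => //.
  exact: measurable_funM.
have F0 z : (0 <= (F z)%:E)%E.
  by rewrite lee_fin mulr_ge0 ?expR_ge0// mulr_ge0 ?expR_ge0 ?normal_pdf_ge0.
have mEF : measurable_fun setT (fun z => (F z)%:E) by apply/measurable_EFinP.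
transitivity (\int[P]_w \int[mu]_g (F (w, g))%:E)%E.
  apply: eq_integral => w _; rewrite /F/=.
  under eq_integral do rewrite EFinM.
  rewrite ge0_integralZl//=; last 2 first.
  - apply/measurable_EFinP; apply: measurable_funM; last exact: measurable_normal_pdf.
    by apply: measurableT_comp => //; exact: measurable_funM.
  - by move=> g _; rewrite lee_fin mulr_ge0 ?expR_ge0 ?normal_pdf_ge0.
  rewrite expR_half_sqr -EFinM -expRD exprMn r2; congr (expR _)%:E.
  by rewrite /q big_cons; field.
rewrite [LHS](@fubini_tonelli _ _ _ _ _ P mu (fun z => (F z)%:E) mEF F0).
transitivity (\int[mu]_g ((\prod_(i <- s) (Num.sqrt (1 - a i))^-1 * expR ((\sum_i u i ^+ 2) / 2))%:E
    * (phi g * expR (- (- a j * g ^+ 2 / 2)))%:E))%E.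
  apply: eq_integral => g _.
  have uus i : i \in s -> upd u j (r * g) i = 0.
    by move=> si; rewrite /upd; case: eqVneq => [ij|_]; [rewrite -ij si in js|exact: us0].
  have := IH _ us uus; rewrite (sqr_upd _ uj) exprMn r2.
  move=> E.
  transitivity (\int[P]_w ((phi g)%:E * (expR (q s w / 2 + l (upd u j (r * g)) w))%:E))%E.
    apply: eq_integral => w _; rewrite /F/= -EFinM (l_upd _ _ uj); congr EFin.
    by rewrite mulrA -expRD mulrC; congr (_ * expR _); ring.
  rewrite ge0_integralZl//=; last 2 first.
  - apply/measurable_EFinP; apply: measurableT_comp => //; apply: measurable_funD => //.
    exact: measurable_funM.
  - by rewrite lee_fin normal_pdf_ge0.
  rewrite E -EFinM; congr EFin.
  rewrite mulNr mulNr opprK [in LHS]mulrDl [in LHS]expRD; ring.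
have a1' : 0 < 1 + - a j by rewrite subr_gt0.
rewrite ge0_integralZl//; last 3 first.
- apply/measurable_EFinP; apply: measurable_funM; first exact: measurable_normal_pdf.
  apply: measurableT_comp => //; apply: measurableT_comp => //.
  by apply: measurable_funM => //; apply: measurable_funM => //; exact: measurable_funX.
- by move=> g _; rewrite lee_fin mulr_ge0 ?expR_ge0 ?normal_pdf_ge0.
- by rewrite lee_fin mulr_ge0 ?expR_ge0// prodr_ge0// => i _; rewrite invr_ge0.
by rewrite integral_gauss_scaled// -EFinM big_cons; congr EFin; ring.
Qed.

Lemma sqrtV_le_expR (x y : R) : 0 < x -> 1 <= x * expR (2 * y) -> (Num.sqrt x)^-1 <= expR y.
Proof.
move=> x0 h; rewrite -[leLHS]mul1r ler_pdivrMr ?sqrtr_gt0//.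
rewrite -(@ler_pXn2r _ 2)// ?nnegrE ?mulr_ge0 ?expR_ge0// expr1n exprMn.
by rewrite (sqr_sqrtr (ltW x0)) mulrC -expRM_natl.
Qed.

(** The first-order term is minus half the mean of the form, so centring cancels it and only the sum
    of the squared weights is left. The factors are compared one by one: (1 + x)^{-1/2} <= exp(- x /
    2 + x^2 / 2). *)
Lemma expR_neg_quadratic_le :
  (\int[P]_w (expR (- ((\sum_j a j * xi j w ^+ 2) / 2)))%:E <=
   (expR (\sum_j (- a j / 2 + a j ^+ 2 / 2)))%:E)%E.
Proof.
have := @laplace_neg_quadratic (index_enum 'I_n) (fun=> 0) (index_enum_uniq _) (fun _ _ => erefl).
rewrite [X in expR (- (X / 2))]big1 => [|j _]; last by rewrite expr0n.
rewrite mul0r oppr0 expR0 mulr1.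
under eq_integral => w _.
  rewrite /l big1; last by move=> j _; rewrite mul0r.
  rewrite cos0 mulr1.
  over.
move=> ->; rewrite lee_fin expR_sum; apply: ler_prod => j _.
rewrite invr_ge0 sqrtr_ge0/=; apply: sqrtV_le_expR; first by rewrite ltr_pwDl.
set x := a j; have x0 : 0 <= x by exact: a0.
rewrite (_ : 2 * _ = - (x - x ^+ 2)); last by field.
rewrite expRN ler_pdivlMr ?expR_gt0// mul1r.
have := expR_ge1Dx (- (x - x ^+ 2)).
rewrite expRN => h.
have p : 0 < 1 + - (x - x ^+ 2) by nra.
rewrite -(invrK (expR _)) (@le_trans _ _ ((1 + - (x - x ^+ 2))^-1))//.
  by rewrite lef_pV2 ?posrE ?invr_gt0 ?expR_gt0.
(* (1 + x) (1 - x + x^2) = 1 + x^3 >= 1. *)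
rewrite -[leLHS]mul1r ler_pdivrMr//.
nra.
Qed.

Lemma expR_pos_quadratic_le : (forall j, a j <= 1 / 2) ->
  (\int[P]_w (expR ((\sum_j a j * xi j w ^+ 2) / 2))%:E <=
   (expR (\sum_j (a j / 2 + a j ^+ 2)))%:E)%E.
Proof.
move=> a2; have a1 j : a j < 1 by rewrite (le_lt_trans (a2 j))// ltr_pdivrMr// mul1r ltr1n.
have := @laplace_pos_quadratic (index_enum 'I_n) (fun=> 0) (index_enum_uniq _) a1 (fun _ _ => erefl).
rewrite [X in expR (X / 2)]big1 => [|j _]; last by rewrite expr0n.
rewrite mul0r expR0 mulr1.
under eq_integral => w _.
  rewrite /l [X in _ + X]big1; last by move=> j _; rewrite mul0r.
  rewrite addr0.
  over.
move=> ->; rewrite lee_fin expR_sum; apply: ler_prod => j _.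
rewrite invr_ge0 sqrtr_ge0/=; apply: sqrtV_le_expR; first by rewrite subr_gt0.
set x := a j; have x0 : 0 <= x by exact: a0.
have x2 : x <= 1 / 2 by exact: a2.
rewrite (_ : 2 * _ = x + 2 * x ^+ 2); last by field.
have := expR_ge1Dx (x + 2 * x ^+ 2).
set E := expR _ => h; have : (1 - x) * (1 + (x + 2 * x ^+ 2)) <= (1 - x) * E.
  by rewrite ler_wpM2l// subr_ge0 (le_trans x2)// ler_pdivrMr// mul1r ler1n.
(* (1 - x) (1 + x + 2 x^2) = 1 + x^2 (1 - 2 x) >= 1, as x <= 1 / 2. *)
apply: le_trans; nra.
Qed.

End standard_gaussian_family.

Section tails.
Context {R : realType} {d : measure_display} {T : measurableType d}
        (P : probability T R).

Lemma prob_le_integral (A : set T) (f : T -> R) : measurable A ->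
  measurable_fun setT f -> (forall w, 0 <= f w) -> (forall w, A w -> 1 <= f w) ->
  (P A <= \int[P]_w (f w)%:E)%E.
Proof.
move=> mA mf f0 f1; rewrite -[A in P A]setIT -integral_indic//.
apply: ge0_le_integral => //.
- by apply/measurable_EFinP.
- exact/measurable_EFinP.
- move=> w _; rewrite lee_fin indicE; case: (boolP (w \in A)) => [/set_mem/f1//|_]; exact: f0.
Qed.

Lemma exponential_markov (X : T -> R) (r x b : R) : measurable_fun setT X -> 0 < r ->
  (\int[P]_w (expR (r * X w))%:E <= (expR b)%:E)%E ->
  (P [set w | (x < X w)%R] <= (expR (b - r * x))%:E)%E.
Proof.
move=> mX r0 h.
have mA : measurable [set w | x < X w].
  by rewrite -[X in measurable X]setTI; exact: measurable_fun_ltr.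
have mE : measurable_fun setT (fun w => expR (r * X w)).
  by apply: measurableT_comp => //; exact: measurable_funM.
apply: (le_trans (@prob_le_integral _ (fun w => expR (- (r * x)) * expR (r * X w)) mA _ _ _)).
- exact: measurable_funM.
- by move=> w; rewrite mulr_ge0 ?expR_ge0.
- move=> w /= xX; rewrite -expRD -expR0 ler_expR addrC subr_ge0 ler_pM2l//.
  exact: ltW.
- under eq_integral do rewrite EFinM.
  rewrite ge0_integralZl//=; last exact/measurable_EFinP.
  rewrite (_ : expR (b - r * x) = expR (- (r * x)) * expR b); last by rewrite -expRD addrC.
  by rewrite EFinM lee_wpmul2l// lee_fin expR_ge0.
Qed.

Lemma measure_abs_gt (X : T -> R) (x : R) (b : \bar R) : measurable_fun setT X ->
  (P [set w | (x < X w)%R] <= b)%E -> (P [set w | (x < - X w)%R] <= b)%E ->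
  (P [set w | (x < `|X w|)%R] <= b + b)%E.
Proof.
move=> mX h1 h2.
have m1 : measurable [set w | x < X w].
  by rewrite -[X in measurable X]setTI; exact: measurable_fun_ltr.
have m2 : measurable [set w | x < - X w].
  by rewrite -[X in measurable X]setTI; apply: measurable_fun_ltr => //; exact: measurable_funN.
have -> : [set w | x < `|X w|] = [set w | x < X w] `|` [set w | x < - X w].
  apply/seteqP; split => w /=; first by case: (ger0P (X w)); [left|right].
  by case=> /lt_le_trans; apply; rewrite ?ler_norm// -normrN ler_norm.
by rewrite (le_trans (measureU2 _ m1 m2))// leeD.
Qed.

Lemma gaussian_rv_tail (X : T -> R) (v C D delta : R) : gaussian_rv P X v ->
  0 < C -> 0 < delta -> v <= C * D ->
  (P [set w | (delta * D < `|X w|)%R] <=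
   (expR (- (delta ^+ 2 / (2 * C) * D)))%:E + (expR (- (delta ^+ 2 / (2 * C) * D)))%:E)%E.
Proof.
move=> [mX _ E] C0 d0 vCD.
(* The minimiser of the Chernoff exponent r^2 C D / 2 - r delta D. *)
pose r := delta / C; have r0 : 0 < r by rewrite divr_gt0.
have b : r ^+ 2 * v / 2 - r * (delta * D) <= - (delta ^+ 2 / (2 * C) * D).
  rewrite (_ : - (delta ^+ 2 / (2 * C) * D) = r ^+ 2 * (C * D) / 2 - r * (delta * D)); last first.
    by rewrite /r; field; rewrite gt_eqF.
  by rewrite lerD2r ler_pM2r// ler_wpM2l// sqr_ge0.
apply: measure_abs_gt => //.
- apply: (le_trans (@exponential_markov X r (delta * D) (r ^+ 2 * v / 2) mX r0 _)).
    by rewrite E.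
  by rewrite lee_fin ler_expR.
- apply: (le_trans (@exponential_markov (fun w => - X w) r (delta * D) (r ^+ 2 * v / 2) _ r0 _)).
  + exact: measurable_funN.
  + by under eq_integral do rewrite mulrN -mulNr; rewrite E sqrrN.
  by rewrite lee_fin ler_expR.
Qed.

Variables (N : nat) (e : T -> 'cV[R]_N) (V : 'M[R]_N).
Hypotheses (ge : gaussian_vec P e V) (pV : psdmx V) (uV : V \in unitmx).

Lemma gaussian_vec_dotv (b : 'cV[R]_N) : gaussian_rv P (fun w => dotv b (e w)) (quad V b).
Proof. exact: ge. Qed.

(** The form is a sum of lam_j xi_j^2 with lam_j <= c, so the sum of the lam_j^2 is at most c tr(B
    V) <= 2 c D: the fluctuations are governed by D, whatever the dimension. *)
Lemma gaussian_vec_quad_tail (B : 'M[R]_N) (c D delta : R) : psdmx B ->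
  0 < c -> (forall v, quad V (B *m v) <= c * quad B v) ->
  0 < delta -> delta <= 1 -> 0 <= D -> \tr (B *m V) <= 2 * D ->
  (P [set w | (delta * D < `|quad B (e w) - \tr (B *m V)|)%R] <=
   (expR (- (delta ^+ 2 / (32 * c) * D)))%:E + (expR (- (delta ^+ 2 / (32 * c) * D)))%:E)%E.
Proof.
move=> pB c0 BVB d0 d1 D0 trD.
have [b [lam [lam0 trE quadB quadV]]] := simultaneous_diagonalisation pV uV pB (ltW c0) BVB.
pose xi j w := dotv (b j) (e w).
have mxi j : measurable_fun setT (xi j) by have [] := gaussian_vec_dotv (b j).
have gxi (u : 'I_N -> R) : gaussian_rv P (fun w => \sum_j u j * xi j w) (\sum_j u j ^+ 2).
  rewrite -quadV.
  rewrite (_ : (fun w => _) = fun w => dotv (\sum_j u j *: b j) (e w)).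
    exact: gaussian_vec_dotv.
  apply/funext => w; rewrite dotvC /dotv mulmx_sumr summxE; apply: eq_bigr => j _.
  by rewrite -scalemxAr mxE /xi dotvC.
(* This [s] minimises 8 s^2 c D - s delta D, the exponent left after centring. It also keeps the
   weights [a j] below 1 / 2, since delta <= 1. *)
pose s := delta / (16 * c); have s0 : 0 < s by rewrite divr_gt0// mulr_gt0.
have sc : s * c = delta / 16 by rewrite /s; field; rewrite gt_eqF.
have sc4 : s * c <= 1 / 4 by rewrite sc; lra.
have kappa : 8 * s ^+ 2 * c * D - s * (delta * D) = - (delta ^+ 2 / (32 * c) * D).
  by rewrite /s; field; rewrite gt_eqF.
clearbody s.
pose a j := 2 * s * lam j.
have a0 j : 0 <= a j by have /andP[l0 _] := lam0 j; rewrite /a mulr_ge0// mulr_ge0// ltW.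
have a2 j : a j <= 1 / 2.
  have /andP[_ lc] := lam0 j.
  rewrite (@le_trans _ _ (2 * (s * c)))//; last by lra.
  by rewrite /a -mulrA ler_pM2l// ler_pM2l.
have sumsq : \sum_j a j ^+ 2 <= 8 * s ^+ 2 * c * D.
  rewrite (@le_trans _ _ (\sum_j 4 * s ^+ 2 * c * lam j))//.
    apply: ler_sum => j _; have /andP[l0 lc] := lam0 j.
    rewrite (_ : a j ^+ 2 = 4 * s ^+ 2 * (lam j * lam j)); last by rewrite /a; ring.
    by rewrite -!mulrA !ler_pM2l// ler_wpM2r.
  rewrite -mulr_sumr trE (_ : 8 * s ^+ 2 * c * D = 4 * s ^+ 2 * c * (2 * D)); last by ring.
  by rewrite ler_wpM2l// mulr_ge0 ?(ltW c0)// mulr_ge0// sqr_ge0.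
have suma : \sum_j a j / 2 = s * \tr (B *m V).
  by rewrite -trE mulr_sumr; apply: eq_bigr => j _; rewrite /a; field.
have QE w : (\sum_j a j * xi j w ^+ 2) / 2 = s * quad B (e w).
  by rewrite quadB mulr_sumr mulr_suml; apply: eq_bigr => j _; rewrite /a /xi; field.
have mQ : measurable_fun setT (fun w => quad B (e w)).
  under eq_fun do rewrite quadB.
  by apply: measurable_sum => j; apply: measurable_funM => //; exact: (measurable_funX 2 (mxi j)).
have mQt : measurable_fun setT (fun w => quad B (e w) - \tr (B *m V)).
  exact: measurable_funB.
have shift (t : R) (f : T -> R) (bd : R) : measurable_fun setT f ->
    (\int[P]_w (expR (f w))%:E <= (expR bd)%:E)%E ->
    (\int[P]_w (expR (f w + t))%:E <= (expR (bd + t))%:E)%E.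
  move=> mf h; under eq_integral do rewrite addrC expRD EFinM.
  rewrite ge0_integralZl//=; last by apply/measurable_EFinP; exact: measurableT_comp.
  rewrite (_ : expR (bd + t) = expR t * expR bd); last by rewrite -expRD addrC.
  by rewrite EFinM lee_wpmul2l// lee_fin expR_ge0.
apply: measure_abs_gt => //.
- apply: (le_trans (@exponential_markov _ s (delta * D) (8 * s ^+ 2 * c * D) mQt s0 _)).
    under eq_integral do rewrite mulrBr.
    have := shift (- (s * \tr (B *m V))) (fun w => s * quad B (e w)) (\sum_j (a j / 2 + a j ^+ 2)).
    move=> /(_ _ _)/le_trans; apply => //.
    + exact: measurable_funM.
    + by have := expR_pos_quadratic_le mxi gxi a0 a2; under eq_integral do rewrite QE.
    + by rewrite lee_fin ler_expR big_split/= suma addrAC subrr add0r.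
  by rewrite lee_fin ler_expR kappa.
- apply: (le_trans (@exponential_markov (fun w => - (quad B (e w) - \tr (B *m V))) s (delta * D) (8 * s ^+ 2 * c * D) _ s0 _)).
  + exact: measurable_funN.
  + under eq_integral do rewrite opprB mulrBr addrC.
    have := shift (s * \tr (B *m V)) (fun w => - (s * quad B (e w))) (\sum_j (- a j / 2 + a j ^+ 2 / 2)).
    move=> /(_ _ _)/le_trans; apply => //.
    * by apply: measurable_funN; exact: measurable_funM.
    * by have := expR_neg_quadratic_le mxi gxi a0; under eq_integral do rewrite QE.
    * rewrite lee_fin ler_expR big_split/=.
      rewrite (eq_bigr (fun j => - (a j / 2))); last by move=> j _; rewrite mulNr.
      rewrite sumrN suma addrAC addNr add0r -mulr_suml (le_trans _ sumsq)//.
      rewrite ler_pdivrMr// ler_peMr ?ler1n// sumr_ge0// => j _; exact: sqr_ge0.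
  by rewrite lee_fin ler_expR kappa.
Qed.

End tails.

Section no_atom.
Context {R : realType} {d : measure_display} {T : measurableType d}
        (P : probability T R).

(** On the event, exp(- a X^2 / (2 v)) equals 1, so the probability is at most the expectation (1 +
    a)^{-1/2} for every a >= 0. *)
Lemma gaussian_rv_no_atom (X : T -> R) (v : R) : gaussian_rv P X v -> 0 < v ->
  P [set w | X w = 0] = 0%E.
Proof.
move=> gX v0; have [mX _ _] := gX.
have mA : measurable [set w | X w = 0].
  by rewrite -[X in measurable X]setTI; apply: (mX measurableT [set 0]).
pose xi (j : 'I_1) w := (Num.sqrt v)^-1 * X w.
have v1 : (Num.sqrt v)^-1 ^+ 2 * v = 1 by rewrite exprVn sqr_sqrtr ?ltW// mulVf// gt_eqF.
have mxi j : measurable_fun setT (xi j) by exact: measurable_funM.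
have gxi (u : 'I_1 -> R) : gaussian_rv P (fun w => \sum_j u j * xi j w) (\sum_j u j ^+ 2).
  rewrite big_ord1 (_ : (fun w => _) = (fun w => u ord0 * ((Num.sqrt v)^-1 * X w))).
    by have := gaussian_rvZ (u ord0) (gaussian_rvZ (Num.sqrt v)^-1 gX); rewrite v1 mulr1.
  by apply/funext => w; rewrite big_ord1.
apply/eqP; rewrite eq_le measure_ge0 andbT; apply/lee_addgt0Pr => eps eps0; rewrite add0e.
(* With this value (1 + a)^{-1/2} <= eps. *)
pose a (j : 'I_1) := eps ^- 2.
have a0 j : 0 <= a j by rewrite invr_ge0 sqr_ge0.
have := @laplace_neg_quadratic _ _ _ P _ xi mxi gxi a a0 (index_enum 'I_1) (fun=> 0) (index_enum_uniq _) (fun _ _ => erefl).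
move=> E.
apply: (le_trans (@prob_le_integral _ _ _ P _ (fun w => expR (- ((\sum_(j <- index_enum 'I_1) a j * xi j w ^+ 2) / 2))) mA _ _ _)).
- apply: measurableT_comp => //; apply: measurable_funN; apply: measurable_funM => //.
  by apply: measurable_sum => j; apply: measurable_funM => //; exact: measurable_funX.
- by move=> w; exact: expR_ge0.
- move=> w /= Xw; rewrite big1 ?mul0r ?oppr0 ?expR0// => j _.
  by rewrite /xi Xw mulr0 expr0n mulr0.
have -> : (\int[P]_w (expR (- ((\sum_(j <- index_enum 'I_1) a j * xi j w ^+ 2) / 2)))%:E)%E =
    (\prod_(j <- index_enum 'I_1) (Num.sqrt (1 + a j))^-1)%:E.
  have -> : (\prod_(j <- index_enum 'I_1) (Num.sqrt (1 + a j))^-1)%:E =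
     ((\prod_(j <- index_enum 'I_1) (Num.sqrt (1 + a j))^-1) * expR (- ((\sum_(j < 1) (0:R) ^+ 2) / 2)))%:E.
    by rewrite [X in expR (- (X / 2))]big_ord1 expr0n/= mul0r oppr0 expR0 mulr1.
  rewrite -E; apply: eq_integral => w _; rewrite [X in cos X]big1 ?cos0 ?mulr1// => j _.
  by rewrite mul0r.
rewrite (_ : \prod_(j <- _) _ = (Num.sqrt (1 + eps ^- 2))^-1); last first.
  exact: (big_ord1 *%R (fun j => (Num.sqrt (1 + a j))^-1)).
rewrite lee_fin -[leRHS]invrK lef_pV2 ?posrE ?invr_gt0// ?sqrtr_gt0 ?addr_gt0// ?invr_gt0 ?exprn_gt0//.
rewrite -[leLHS]ger0_norm ?invr_ge0 ?(ltW eps0)// -sqrtr_sqr ler_sqrt ?addr_ge0 ?invr_ge0 ?sqr_ge0//.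
by rewrite exprVn lerDr.
Qed.

End no_atom.

(** * Decomposition of the likelihood and of the loss *)

Section one_sample.
Context {R : realType} {d : measure_display} {T : measurableType d}
        {P : probability T R} {dim k p N : nat} (S : setting P dim k p N)
        (Theta : set 'rV[R]_k) (std : standing_assumptions S Theta)
        (theta0 : 'rV[R]_k) (theta0_in : Theta theta0)
        (spec : Sigma0 S = Sigma S theta0).
Implicit Types (a : {set 'I_p}) (th : 'rV[R]_k) (w : T).

Lemma Sigma_psd th : Theta th -> psdmx (Sigma S th).
Proof.
move=> Tth; have [sE pE] := Sigma_eta_psd std Tth; split.
  by rewrite /Sigma linearD/= sE tr_scalar_mx.
move=> v; rewrite quadE /Sigma mulmxDl dotvDr -quadE addr_ge0// mul_scalar_mx dotvZr.
by rewrite mulr_ge0 ?dotvv_ge0// (noise_var_ge0 std).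
Qed.

Let psd_inv th (Tth : Theta th) : psdmx (invmx (Sigma S th)) :=
  psdmx_invmx (Sigma_psd Tth) (Sigma_unit std Tth).

Let unit_inv th : Theta th -> invmx (Sigma S th) \in unitmx.
Proof. by move=> Tth; rewrite unitmx_inv (Sigma_unit std). Qed.

(** [E] selects distinct columns of [Xmat], and [Xmat] is injective because its Gram matrix at
    [theta0] is invertible. *)
Lemma Xsub_injective a (u : 'cV[R]_(1 + #|a|)) : Xsub S a *m u = 0 -> u = 0.
Proof.
have uX := XSX_unit std theta0_in.
move=> Xu; pose f (i : 'I_(1 + #|a|)) : 'I_(1 + p) :=
  match fintype.split i with inl j => lshift p j | inr j => rshift 1 (enum_val j) end.
pose E : 'M[R]_(1 + p, 1 + #|a|) := \matrix_(i, j) (i == f j)%:R.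
have finj : injective f.
  move=> i j; rewrite /f -(splitK i) -(splitK j) !unsplitK.
  case: (fintype.split i) => i'; case: (fintype.split j) => j' //=.
  - by rewrite !ord1.
  - by move=> /eqP; rewrite eq_lrshift.
  - by move=> /eqP; rewrite eq_rlshift.
  - by move=> /rshift_inj/enum_val_inj ->.
have XE : Xsub S a = Xmat S *m E.
  apply/matrixP => i j; rewrite [RHS]mxE (bigD1 (f j))//= big1 ?addr0.
    rewrite [E _ _]mxE eqxx mulr1 /f /Xsub /Xmat -[j]splitK unsplitK.
    by case: (fintype.split j) => j'; rewrite /= ?row_mxEl ?row_mxEr ?mxE.
  by move=> l /negbTE lf; rewrite [E _ _]mxE lf mulr0.
have EE : E^T *m E = 1%:M.
  apply/matrixP => i j; rewrite [LHS]mxE (bigD1 (f i))//= big1 ?addr0.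
    by rewrite !mxE eqxx mul1r (inj_eq finj).
  by move=> l /negbTE lf; rewrite !mxE lf mul0r.
have Eu0 : E *m u = 0.
  rewrite -[LHS]mul1mx -(mulVmx uX) -!mulmxA (mulmxA (Xmat S)) -XE Xu.
  by rewrite !mulmx0.
by rewrite -[u]mul1mx -EE -mulmxA Eu0 mulmx0.
Qed.

Lemma MmxE a th : Mmx S a th = gls_proj (invmx (Sigma S th)) (Xsub S a).
Proof. by rewrite gls_projE. Qed.

Definition bias a th : 'cV[R]_N := mu0 S - Mmx S a th *m mu0 S.
Definition lin_noise a th w : R := dotv (invmx (Sigma S th) *m bias a th) (noise_vec S w).
Definition quad_noise a th w : R := quad (invmx (Sigma S th) *m Mmx S a th) (noise_vec S w).
Definition quad_mean a th : R := \tr (invmx (Sigma S th) *m Mmx S a th *m Sigma0 S).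
(** Minus twice the log-likelihood at the true mean and covariance. *)
Definition baseline w : R :=
  N%:R * ln (2 * pi) + ln (\det (Sigma0 S)) + quad (invmx (Sigma0 S)) (noise_vec S w).
(** The numerator in (C5). *)
Definition cov_noise th w : R :=
  \tr ((noise_vec S w *m (noise_vec S w)^T - Sigma0 S)
         *m (invmx (Sigma S th) - invmx (Sigma S theta0))).

Lemma lossE a th w : Theta th ->
  loss S a th w = L0 S th + (quad (invmx (Sigma S th)) (bias a th) + quad_noise a th w) / 2.
Proof.
move=> Tth; rewrite /loss /muhat (ZE std) /quad_noise /bias MmxE.
by rewrite gls_fit_quad//; [exact: psd_inv|exact: unit_inv|exact: Xsub_injective].
Qed.

Lemma loglikE a th w : Theta th ->
  - 2 * loglik S a th w = N%:R * ln (2 * pi) + ln (\det (Sigma S th)) +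
    (quad (invmx (Sigma S th)) (bias a th) + 2 * lin_noise a th w
     + quad (invmx (Sigma S th)) (noise_vec S w) - quad_noise a th w).
Proof.
move=> Tth; rewrite /loglik /muhat (ZE std) /quad_noise /lin_noise /bias MmxE.
rewrite gls_residual_quad//; [|exact: psd_inv|exact: unit_inv|exact: Xsub_injective].
by field.
Qed.

Lemma quad_trace (B : 'M[R]_N) (v : 'cV[R]_N) : quad B v = \tr (v *m v^T *m B).
Proof. by rewrite -mulmxA mxtrace_mulC /quad /mxtrace big_ord1. Qed.

(* The baseline is common to all models; 2 quad_noise is the optimism that the
   penalty of the criterion has to compensate. *)
Lemma loglik_loss a th w : Theta th ->
  - 2 * loglik S a th w - baseline w =
  2 * loss S a th w + cov_noise th w + 2 * lin_noise a th w - 2 * quad_noise a th w.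
Proof.
move=> Tth; rewrite loglikE// lossE// /baseline /L0 /cov_noise.
have -> : \tr ((noise_vec S w *m (noise_vec S w)^T - Sigma0 S)
    *m (invmx (Sigma S th) - invmx (Sigma S theta0))) =
   quad (invmx (Sigma S th)) (noise_vec S w) - quad (invmx (Sigma0 S)) (noise_vec S w)
   - \tr (Sigma0 S *m invmx (Sigma S th)) + N%:R.
  rewrite mulmxBl !mulmxBr !linearB/= -!quad_trace -spec.
  by rewrite mulmxV ?mxtrace1 ?spec ?(Sigma_unit std)//; ring.
by field.
Qed.

Lemma expectation_quad (B : 'M[R]_N) :
  P.-integrable setT (EFin \o (fun w => quad B (noise_vec S w))) /\
  (\int[P]_w (quad B (noise_vec S w))%:E = (\tr (B *m Sigma0 S))%:E)%E.
Proof.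
have E w : quad B (noise_vec S w) =
    \sum_i \sum_j B i j * (noise_vec S w i 0 * noise_vec S w j 0).
  rewrite quadE dotvE; apply: eq_bigr => i _; rewrite [(B *m _) _ _]mxE mulr_sumr.
  by apply: eq_bigr => j _; ring.
have iij i j : P.-integrable setT (fun w =>
    (B i j * (noise_vec S w i 0 * noise_vec S w j 0))%:E).
  exact: (integrableZl _ (B i j) (integrable_noise2 std i j)).
have isum i : P.-integrable setT (fun w =>
    (\sum_j (B i j * (noise_vec S w i 0 * noise_vec S w j 0))%:E)%E).
  by apply: integrable_sum.
have -> : (EFin \o (fun w => quad B (noise_vec S w))) = (fun w =>
    (\sum_i \sum_j (B i j * (noise_vec S w i 0 * noise_vec S w j 0))%:E)%E).
  apply/funext => w /=; rewrite E -sumEFin; apply: eq_bigr => i _; by rewrite -sumEFin.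
have EE : (\int[P]_w (quad B (noise_vec S w))%:E)%E = (\int[P]_w
    (\sum_i \sum_j (B i j * (noise_vec S w i 0 * noise_vec S w j 0))%:E)%E)%E.
  apply: eq_integral => w _; rewrite E -sumEFin; apply: eq_bigr => i _; by rewrite -sumEFin.
split; first exact: integrable_sum.
rewrite EE integral_sum// /mxtrace -sumEFin; apply: eq_bigr => i _.
rewrite integral_sum// [(B *m _) _ _]mxE -sumEFin; apply: eq_bigr => j _.
under eq_integral do rewrite EFinM.
rewrite integralZl//; last exact: (integrable_noise2 std).
rewrite (Sigma0E std) -EFinM; congr (_ * _)%:E.
have [sS _] := Sigma_psd theta0_in.
by rewrite -spec in sS; rewrite -{1}sS mxE.
Qed.

Lemma riskE a th : Theta th ->
  risk S a th = L0 S th + (quad (invmx (Sigma S th)) (bias a th) + quad_mean a th) / 2.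
Proof.
move=> Tth; have [iQ EQ] := expectation_quad (invmx (Sigma S th) *m Mmx S a th).
rewrite /risk unlock.
have -> : (\int[P]_w (loss S a th w)%:E)%E = (\int[P]_w
    ((L0 S th + quad (invmx (Sigma S th)) (bias a th) / 2) +
     1/2 * quad (invmx (Sigma S th) *m Mmx S a th) (noise_vec S w))%:E)%E.
  by apply: eq_integral => w _; rewrite lossE// /quad_noise; congr EFin; field.
by rewrite integral_affine// EQ/= /quad_mean; field.
Qed.

(** The projection has trace 1 + p(alpha); what remains is the trace that (C4) makes negligible.
    This is where the number of parameters emerges. *)
Lemma quad_mean_trace a th : Theta th ->
  quad_mean a th = (1 + #|a|)%:R -
    \tr (Sigma0 S *m (invmx (Sigma0 S) - invmx (Sigma S th)) *m Mmx S a th).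
Proof.
move=> Tth.
rewrite mulmxBr mulmxBl linearB/= mulmxV ?mul1mx ?spec ?(Sigma_unit std)// -spec.
rewrite {1}MmxE trace_gls; [|exact: psd_inv|exact: unit_inv|exact: Xsub_injective].
by rewrite subKr /quad_mean mxtrace_mulC mulmxA.
Qed.

Lemma quad_noise_psd a th : Theta th -> psdmx (invmx (Sigma S th) *m Mmx S a th).
Proof.
by move=> Tth; rewrite MmxE; apply: gls_psd; [exact: psd_inv|exact: unit_inv|exact: Xsub_injective].
Qed.

Lemma quad_mean_ge0 a th : Theta th -> 0 <= quad_mean a th.
Proof.
move=> Tth.
have pB := quad_noise_psd a Tth.
have [iQ EQ] := expectation_quad (invmx (Sigma S th) *m Mmx S a th).
by rewrite -lee_fin -EQ; apply: integral_ge0 => w _; rewrite lee_fin; exact: pB.2.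
Qed.

Lemma L0_ge0 th : Theta th -> 0 <= L0 S th.
Proof.
move=> Tth; have [h _] := kullback_leibler_covariance (Sigma_psd Tth) (Sigma_unit std Tth)
  (Sigma_psd theta0_in) (Sigma_unit std theta0_in).
by rewrite /L0 spec divr_ge0.
Qed.

Lemma L0_eq0 th : Theta th -> L0 S th = 0 -> Sigma S th = Sigma S theta0.
Proof.
move=> Tth L; have [_ h] := kullback_leibler_covariance (Sigma_psd Tth) (Sigma_unit std Tth)
  (Sigma_psd theta0_in) (Sigma_unit std theta0_in).
apply: h; move: L; rewrite /L0 spec => /eqP.
by rewrite mulf_eq0 invr_eq0 pnatr_eq0 orbF => /eqP.
Qed.

Lemma L0_theta0 : L0 S theta0 = 0.
Proof.
by rewrite /L0 spec mulmxV ?(Sigma_unit std)// mxtrace1; field.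
Qed.

Lemma bias_correct a th : Theta th -> correct_model S a -> bias a th = 0.
Proof.
move=> Tth [b0 [b bE]].
pose u : 'cV[R]_(1 + #|a|) := col_mx (const_mx b0) (\col_j b (enum_val j)).
have muE : mu0 S = Xsub S a *m u.
  rewrite (mu0E std) /Xsub /u mul_row_col; apply/colP => i.
  rewrite !mxE bE; last exact: site_region std i.
  rewrite big_ord1 !mxE mul1r; congr (_ + _).
  rewrite big_enum_val; apply: eq_bigr => j _.
  by rewrite !mxE mulrC.
rewrite /bias muE MmxE mulmxA gls_projX ?subrr//.
- exact: psd_inv.
- exact: unit_inv.
- exact: Xsub_injective.
Qed.

Lemma loss_ge0 a th w : Theta th -> 0 <= loss S a th w.
Proof.
move=> Tth; rewrite lossE// addr_ge0 ?L0_ge0// divr_ge0// addr_ge0//.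
  exact: (psd_inv Tth).2.
exact: (quad_noise_psd a Tth).2.
Qed.

(* If the loss vanishes then Sigma th is the true covariance and the fitted
   noise is zero, so the noise is orthogonal to the constant regressor. *)
Lemma loss_eq0 a th w : Theta th -> loss S a th w = 0 ->
  dotv (invmx (Sigma0 S) *m const_mx 1) (noise_vec S w) = 0.
Proof.
move=> Tth; rewrite lossE// => /eqP.
have b0 := (psd_inv Tth).2 (bias a th); have q0 := (quad_noise_psd a Tth).2 (noise_vec S w).
rewrite -/(quad_noise a th w) in q0.
rewrite paddr_eq0 ?L0_ge0 ?divr_ge0 ?addr_ge0// => /andP[/eqP/(L0_eq0 Tth) SS].
rewrite mulf_eq0 invr_eq0 pnatr_eq0 orbF paddr_eq0// => /andP[_ /eqP qn].
have SMe := psd_quad_eq0 (quad_noise_psd a Tth) qn.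
have Me : Mmx S a th *m noise_vec S w = 0.
  move: SMe; rewrite MmxE => SMe.
  rewrite -[LHS]mul1mx -(mulmxV (Sigma_unit std Tth)) -mulmxA.
  by rewrite (mulmxA (invmx (Sigma S th))) SMe mulmx0.
pose e1 : 'cV[R]_(1 + #|a|) := col_mx (const_mx 1) 0.
have X1 : const_mx 1 = Xsub S a *m e1 :> 'cV[R]_N.
  by rewrite /Xsub /e1 mul_row_col mulmx0 addr0; apply/matrixP => i j; rewrite !mxE big_ord1 !mxE mulr1.
have M1 : Mmx S a th *m const_mx 1 = const_mx 1 :> 'cV[R]_N.
  rewrite X1 MmxE mulmxA gls_projX//.
  - exact: psd_inv.
  - exact: unit_inv.
  - exact: Xsub_injective.
rewrite spec -SS -M1 mulmxA dotv_mulmxl (quad_noise_psd a Tth).1.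
move: Me; rewrite MmxE => Me.
by rewrite -mulmxA Me mulmx0 /dotv mulmx0 mxE.
Qed.

Section tails.
Variables (c : R) (c1 : 1 <= c).
Hypothesis C1 : forall th v, Theta th -> quad (Sigma0 S) v <= c * quad (Sigma S th) v.

Let psd0 : psdmx (Sigma0 S). Proof. by rewrite spec; exact: Sigma_psd. Qed.
Let unit0 : Sigma0 S \in unitmx. Proof. by rewrite spec (Sigma_unit std). Qed.
Let c0 : 0 < c := lt_le_trans ltr01 c1.

Let C1' th (Tth : Theta th) v : quad (Sigma0 S) v <= c * quad (invmx (invmx (Sigma S th))) v.
Proof. by rewrite invmxK; exact: C1. Qed.

Lemma quad_noise_tail a th (D delta : R) : Theta th -> 0 < delta -> delta <= 1 ->
  0 <= D -> quad_mean a th <= 2 * D ->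
  (P [set w | (delta * D < `|quad_noise a th w - quad_mean a th|)%R] <=
   (expR (- (delta ^+ 2 / (32 * c) * D)))%:E + (expR (- (delta ^+ 2 / (32 * c) * D)))%:E)%E.
Proof.
move=> Tth d0 d1 D0 tD.
apply: (gaussian_vec_quad_tail (noise_vec_gaussian std)) => //.
- exact: quad_noise_psd.
- move=> v; rewrite MmxE; apply: gls_bound.
  + exact: psd_inv.
  + exact: unit_inv.
  + exact: Xsub_injective.
  + exact: C1'.
Qed.

(** By (C1) the variance of the linear form is at most c times the squared bias in the metric of the
    model, hence at most 2 c D. *)
Lemma lin_noise_tail a th (D delta : R) : Theta th -> 0 < delta ->
  quad (invmx (Sigma S th)) (bias a th) <= 2 * D ->
  (P [set w | (delta * D < `|lin_noise a th w|)%R] <=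
   (expR (- (delta ^+ 2 / (2 * (2 * c)) * D)))%:E + (expR (- (delta ^+ 2 / (2 * (2 * c)) * D)))%:E)%E.
Proof.
move=> Tth d0 bD.
apply: (gaussian_rv_tail (gaussian_vec_dotv (noise_vec_gaussian std) _)) => //.
  by rewrite mulr_gt0.
rewrite (le_trans (C1' Tth _))// quad_invmx_mul; [|exact: psd_inv|exact: unit_inv].
by rewrite [2 * c]mulrC -mulrA ler_pM2l.
Qed.

End tails.

(** Together with [loss_eq0] it confines all zero losses to a null event: the linear form has
    positive variance because the constant regressor is nonzero. *)
Lemma noise_const_null : N != 0%N ->
  P [set w | dotv (invmx (Sigma0 S) *m const_mx 1) (noise_vec S w) = 0] = 0%E.
Proof.
move=> N0; apply: (gaussian_rv_no_atom (gaussian_vec_dotv (noise_vec_gaussian std) _)).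
have p0 : psdmx (Sigma0 S) by rewrite spec; exact: Sigma_psd.
have u0 : Sigma0 S \in unitmx by rewrite spec (Sigma_unit std).
apply: psd_quad_gt0 => //.
apply/eqP => /(congr1 (mulmx (Sigma0 S))); rewrite mulmxA mulmxV// mul1mx mulmx0.
have i : 'I_N by case: N N0 => // n _; exact: ord0.
by move=> /colP/(_ i)/eqP; rewrite !mxE oner_eq0.
Qed.

End one_sample.

(** * Measurability at the estimated parameters *)

Section measurable_matrices.
Context {R : realType} {d : measure_display} {T : measurableType d}.

(** Inversion is discontinuous at 0, but f exp(- ln f^2) represents it everywhere: at a zero of [f]
    the first factor gives 0, the conventional value of the inverse. *)
Lemma measurable_funV (f : T -> R) : measurable_fun setT f ->
  measurable_fun setT (fun w => (f w)^-1).
Proof.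
move=> mf; rewrite (_ : (fun w => _) = fun w => f w * expR (- ln (f w ^+ 2))).
  apply: measurable_funM => //; apply: (measurableT_comp (@measurable_expR R)).
  apply: measurable_funN; apply: (measurableT_comp (@measurable_ln R)).
  exact: (measurable_funX 2 mf).
apply/funext => w; have [->|f0] := eqVneq (f w) 0; first by rewrite invr0 mul0r.
rewrite expRN lnK ?posrE ?exprn_even_gt0//.
by rewrite expr2 invfM mulrA divff// mul1r.
Qed.

Definition measurable_mx (m n : nat) (A : T -> 'M[R]_(m, n)) : Prop :=
  forall i j, measurable_fun setT (fun w => A w i j).

Lemma measurable_mx_cst m n (A : 'M[R]_(m, n)) : measurable_mx (fun=> A).
Proof. by move=> i j. Qed.

Lemma measurable_mulmx m n q (A : T -> 'M[R]_(m, n)) (B : T -> 'M[R]_(n, q)) :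
  measurable_mx A -> measurable_mx B -> measurable_mx (fun w => A w *m B w).
Proof.
move=> mA mB i j; under eq_fun do rewrite mxE.
by apply: measurable_sum => l; exact: measurable_funM.
Qed.

Lemma measurable_mxB m n (A B : T -> 'M[R]_(m, n)) :
  measurable_mx A -> measurable_mx B -> measurable_mx (fun w => A w - B w).
Proof.
by move=> mA mB i j; under eq_fun do rewrite !mxE; exact: measurable_funB.
Qed.

Lemma measurable_mxD m n (A B : T -> 'M[R]_(m, n)) :
  measurable_mx A -> measurable_mx B -> measurable_mx (fun w => A w + B w).
Proof.
by move=> mA mB i j; under eq_fun do rewrite !mxE; exact: measurable_funD.
Qed.

Lemma measurable_trmx m n (A : T -> 'M[R]_(m, n)) :
  measurable_mx A -> measurable_mx (fun w => (A w)^T).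
Proof. by move=> mA i j; under eq_fun do rewrite mxE; exact: mA. Qed.

Lemma measurable_det n (A : T -> 'M[R]_n) : measurable_mx A ->
  measurable_fun setT (fun w => \det (A w)).
Proof.
move=> mA; rewrite /determinant; apply: measurable_sum => s.
by apply: measurable_funM => //; apply: measurable_prod => i _.
Qed.

Lemma measurable_trace n (A : T -> 'M[R]_n) : measurable_mx A ->
  measurable_fun setT (fun w => \tr (A w)).
Proof. by move=> mA; rewrite /mxtrace; apply: measurable_sum => i. Qed.

Lemma measurable_quad n (A : T -> 'M[R]_n) (v : T -> 'cV[R]_n) : measurable_mx A ->
  measurable_mx v -> measurable_fun setT (fun w => quad (A w) (v w)).
Proof.
move=> mA mv; suff h : measurable_mx (fun w => (v w)^T *m A w *m v w) by exact: (h 0 0).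
by apply: measurable_mulmx => //; apply: measurable_mulmx => //; exact: measurable_trmx.
Qed.

(** On invertible matrices the inverse is given by Cramer's rule. *)
Lemma measurable_invmx n (A : T -> 'M[R]_n) : measurable_mx A ->
  (forall w, A w \in unitmx) -> measurable_mx (fun w => invmx (A w)).
Proof.
move=> mA uA i j; rewrite /invmx.
under eq_fun do rewrite uA !mxE.
apply: measurable_funM; first by apply: measurable_funV; exact: measurable_det.
rewrite /cofactor; apply: measurable_funM => //; apply: measurable_det => i' j'.
by under eq_fun do rewrite !mxE; exact: mA.
Qed.

End measurable_matrices.

Section measurable_criteria.
Context {R : realType} {d : measure_display} {T : measurableType d}
        {P : probability T R} {dim k p N : nat} (S : setting P dim k p N)
        (Theta : set 'rV[R]_k) (std : standing_assumptions S Theta)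
        (theta0 : 'rV[R]_k) (theta0_in : Theta theta0).

(* Theta need not be measurable; only the relatively open subsets of Theta
   matter, as theta takes its values in Theta. *)
Lemma measurable_Sigma (th : T -> 'rV[R]_k) :
  measurable_fun setT (th : T -> g_sigma_algebraType (@open 'rV[R]_k)) ->
  (forall w, Theta (th w)) -> measurable_mx (fun w => Sigma S (th w)).
Proof.
move=> mth Tth i j.
apply: (measurability _ (RGenOInfty.measurableE R)).
move=> _ [_ [x ->] <-]; rewrite setTI.
have cg : {within Theta, continuous (fun t => Sigma S t i j)}.
  move=> t; apply: (@continuous_comp _ _ _ (Sigma S : subspace Theta -> _) (fun M : 'M[R]_N => M i j)).
    exact: (Sigma_continuous std).
  exact: coord_continuous.
have oU : open ([set t | Sigma S t i j \in `]x, +oo[] : set (subspace Theta)).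
  move/continuousP : cg => /(_ `]x, +oo[%classic); apply.
  exact: interval_open.
have [W oW WE] := (open_subspaceP _ _).1 oU.
rewrite (_ : _ @^-1` _ = th @^-1` W).
  rewrite -[X in measurable X]setTI; apply: mth => //.
  exact: sub_sigma_algebra.
have WE' t : Theta t -> W t <-> (Sigma S t i j \in `]x, +oo[).
  move=> Tt; have := congr1 (fun A : set 'rV[R]_k => A t) WE.
  rewrite /setI/= propeqE => -[h1 h2]; split => [Wt|h].
    by have [] := h1 (conj Wt Tt).
  by have [] := h2 (conj h Tt).
by apply/seteqP; split => w /=; rewrite -WE'.
Qed.

Variables (a : {set 'I_p}) (th : T -> 'rV[R]_k).
Hypotheses (mth : measurable_fun setT (th : T -> g_sigma_algebraType (@open 'rV[R]_k)))
           (Tth : forall w, Theta (th w)).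

Let mS : measurable_mx (fun w => Sigma S (th w)).
Proof. exact: measurable_Sigma. Qed.

Let mSi : measurable_mx (fun w => invmx (Sigma S (th w))).
Proof. by apply: measurable_invmx => // w; exact: (Sigma_unit std). Qed.

Let mZ : measurable_mx (fun w => Z S w).
Proof.
move=> i j; rewrite ord1; under eq_fun do rewrite (ZE std).
apply: measurable_mxD; first exact: measurable_mx_cst.
by move=> i' j'; rewrite ord1; exact: (measurable_noise std).
Qed.

Let mM : measurable_mx (fun w => Mmx S a (th w)).
Proof.
apply: measurable_mulmx => //; apply: measurable_mulmx; last exact: measurable_mx_cst.
apply: measurable_mulmx; first exact: measurable_mx_cst.
apply: measurable_invmx.
  apply: measurable_mulmx; last exact: measurable_mx_cst.
  by apply: measurable_mulmx => //; exact: measurable_mx_cst.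
move=> w; apply: gram_unit.
- exact: psdmx_invmx (Sigma_psd std (Tth w)) (Sigma_unit std (Tth w)).
- by rewrite unitmx_inv (Sigma_unit std).
by move=> u; exact: (Xsub_injective std theta0_in).
Qed.

Let mmuhat : measurable_mx (fun w => muhat S a (th w) w).
Proof. exact: measurable_mulmx. Qed.

Lemma measurable_loglik : measurable_fun setT (fun w => loglik S a (th w) w).
Proof.
apply: measurable_funB; first apply: measurable_funB => //.
  apply: measurable_funM => //; apply: (measurableT_comp (@measurable_ln R)).
  exact: measurable_det.
by apply: measurable_funM => //; apply: measurable_quad => //; exact: measurable_mxB.
Qed.

Lemma measurable_loss : measurable_fun setT (fun w => loss S a (th w) w).
Proof.
apply: measurable_funD.
  apply: measurable_funM => //; apply: measurable_funB => //; apply: measurable_funD.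
    apply: measurable_funB => //; apply: (measurableT_comp (@measurable_ln R)).
    exact: measurable_det.
  apply: measurable_trace; apply: measurable_mulmx => //; exact: measurable_mx_cst.
apply: measurable_funM => //; apply: measurable_quad => //; apply: measurable_mxB => //.
Qed.

End measurable_criteria.

(** * Sums over growing families of models *)

Section limits.
Context {R : realType}.

(** Keep the single term (kappa x)^m / m! of the exponential series, for an integer m >= q; x >= 1
    allows raising the exponent from q to m. *)
Lemma expR_le_powR (kappa q : R) : 0 < kappa -> 0 < q ->
  exists2 C : R, 0 < C & forall x, 1 <= x -> expR (- (kappa * x)) <= C * (x `^ q)^-1.
Proof.
move=> k0 q0; have [n qn] : exists n, q <= n.+1%:R.
  exists (Num.truncn q); exact/ltW/truncnS_gt.
exists (n.+1`!%:R / kappa ^+ n.+1).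
  by rewrite divr_gt0 ?exprn_gt0// ltr0n fact_gt0.
move=> x x1; have x0 : 0 < x by rewrite (lt_le_trans ltr01).
rewrite expRN ler_pdivlMr ?powR_gt0// mulrC ler_pdivrMr ?expR_gt0//.
have kx0 : 0 <= kappa * x by rewrite mulr_ge0// ltW.
have f0 : 0 < n.+1`!%:R :> R by rewrite ltr0n fact_gt0.
have kn0 : 0 < kappa ^+ n.+1 by rewrite exprn_gt0.
have h : (kappa * x) ^+ n.+1 / n.+1`!%:R <= expR (kappa * x).
  by apply: le_trans (expR_ge1Dxn n kx0); rewrite lerDr.
apply: (@le_trans _ _ (x ^+ n.+1)).
  by rewrite -powR_mulrn ?(ltW x0)//; exact: ler_powR.
rewrite mulrAC ler_pdivlMr// mulrC -exprMn -ler_pdivrMl// mulrC.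
exact: h.
Qed.

(** At a negative base the power has the default value 1, so the comparison survives for negative
    [x] because y >= 1. *)
Lemma powR_le_ge1 (x y q : R) : 0 < q -> 1 <= y -> x <= y -> x `^ q <= y `^ q.
Proof.
move=> q0 y1 xy; have [x0|x0] := ltP x 0; last first.
  by apply: ge0_ler_powR; rewrite ?nnegrE ?(ltW q0)//; exact: le_trans xy.
have -> : x `^ q = 1 by rewrite /powR lt_eqF// ln0 ?(ltW x0)// mulr0 expR0.
by rewrite -(powRr0 y); apply: ler_powR => //; exact: ltW.
Qed.

(** No term exceeds the sum. Vanishing and negative [D a] are excluded as well: their terms are
    infinite, respectively 1, which is at least M^{-q}. *)
Lemma inv_powR_sum_gt (I : finType) (A : {set I}) (D : I -> R) (q M : R) :
  0 < q -> 1 <= M ->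
  (\sum_(a in A) (((D a) `^ q)%:E)^-1 < ((M `^ q)^-1)%:E)%E ->
  forall a, a \in A -> M < D a.
Proof.
move=> q0 M1 sM a aA; rewrite ltNge; apply/negP => DM.
have Mq : 0 < M `^ q by rewrite powR_gt0// (lt_le_trans ltr01).
have : (((D a `^ q)%:E)^-1 < ((M `^ q)^-1)%:E)%E.
  apply: le_lt_trans sM; rewrite (bigD1 a)//= leeDl// sume_ge0// => b _.
  by rewrite inve_ge0 lee_fin powR_ge0.
apply/negP; rewrite -leNgt inver; case: ifPn => [_|Dq]; first by rewrite leey.
have D0 : 0 < D a `^ q by rewrite lt_neqAle eq_sym Dq powR_ge0.
by rewrite lee_fin lef_pV2 ?posrE// powR_le_ge1.
Qed.

(** The common consequence of (C3), (a) and (b): the exponent of the power is gone, the sum has the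
    form delivered by the tail bounds, and the property passes to smaller families and larger
    [D]. *)
Definition sparse (I : nat -> finType) (A : forall n, {set I n})
    (D : forall n, I n -> R) : Prop :=
  forall kappa e M : R, 0 < kappa -> 0 < e ->
  \forall n \near \oo, (forall a, a \in A n -> M < D n a) /\
    \sum_(a in A n) expR (- (kappa * D n a)) <= e.

Lemma inv_powR_sum_sparse (I : nat -> finType) (A : forall n, {set I n})
    (D : forall n, I n -> R) (q : R) : 0 < q ->
  (fun n => \sum_(a in A n) (((D n a) `^ q)%:E)^-1)%E @ \oo --> 0%E ->
  sparse A D.
Proof.
move=> q0 sD kappa e M k0 e0; have [C C0 CE] := expR_le_powR k0 q0.
pose M1 := Num.max M 1.
have M1q : 0 < (M1 `^ q)^-1.
  by rewrite invr_gt0 powR_gt0// (lt_le_trans ltr01)// le_max lexx orbT.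
(* The first bound forces every [D n a] above [M1], hence above 1, where the exponential is
   dominated by the power; the second makes the resulting sum at most [e]. *)
pose r := Num.min (M1 `^ q)^-1 (e / C).
have r0 : 0 < r by rewrite lt_min M1q divr_gt0.
have /fine_cvgP[fs /cvgr0Pnorm_lt/(_ _ r0) sr] := sD.
near=> n.
have fn : \sum_(a in A n) (((D n a) `^ q)%:E)^-1%E \is a fin_num by near: n.
have sn : (\sum_(a in A n) (((D n a) `^ q)%:E)^-1 < r%:E)%E.
  rewrite -(fineK fn) lte_fin; apply: le_lt_trans (ler_norm _) _.
  by near: n; exact: sr.
have gt a : a \in A n -> M1 < D n a.
  apply: inv_powR_sum_gt q0 _ _ _; first by rewrite le_max lexx orbT.
  by apply: lt_le_trans sn _; rewrite lee_fin ge_min lexx.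
have gt1 a : a \in A n -> 1 < D n a.
  by move=> /gt; apply: le_lt_trans; rewrite le_max lexx orbT.
split=> [a /gt|]; first by apply: le_lt_trans; rewrite le_max lexx.
have sE : \sum_(a in A n) (D n a `^ q)^-1 < r.
  rewrite -lte_fin -sumEFin; apply: le_lt_trans sn; apply: lee_sum => a /gt1 D1.
  by rewrite inver gt_eqF// powR_gt0// (lt_trans ltr01).
apply: (@le_trans _ _ (\sum_(a in A n) C * (D n a `^ q)^-1)).
  by apply: ler_sum => a /gt1 /ltW; exact: CE.
rewrite -mulr_sumr mulrC -ler_pdivlMr//; apply/ltW/(lt_le_trans sE).
by rewrite ge_min lexx orbT.
Unshelve. all: by end_near. Qed.

Lemma sparse_set0 (I : nat -> finType) (A : forall n, {set I n})
    (D : forall n, I n -> R) : (\forall n \near \oo, A n = finset.set0) -> sparse A D.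
Proof.
move=> A0 kappa e M _ e0; apply: filterS A0 => n ->; split=> [a|].
  by rewrite finset.in_set0.
by rewrite big_set0 ltW.
Qed.

Lemma sparse_le (I : nat -> finType) (A A' : forall n, {set I n})
    (D D' : forall n, I n -> R) : sparse A' D' ->
  (\forall n \near \oo, A n \subset A' n /\ forall a, a \in A n -> D' n a <= D n a) ->
  sparse A D.
Proof.
move=> sA hA kappa e M k0 e0; have h := sA _ _ M k0 e0.
near=> n.
have [/fintype.subsetP AA DD] :
  A n \subset A' n /\ forall a, a \in A n -> D' n a <= D n a by near: n.
have [f s] : (forall a, a \in A' n -> M < D' n a) /\
    \sum_(a in A' n) expR (- (kappa * D' n a)) <= e by near: n; exact: h.
split=> [a aA|]; first by apply: lt_le_trans (DD _ aA); exact/f/AA.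
apply: le_trans s; rewrite [leLHS]big_mkcond [leRHS]big_mkcond; apply: ler_sum => a _.
case: ifPn => [aA|_]; last by case: ifP => // _; exact: expR_ge0.
by rewrite AA// ler_expR lerN2 ler_pM2l// DD.
Unshelve. all: by end_near. Qed.

Lemma cvge0P (u : nat -> \bar R) : (forall n, (0 <= u n)%E) ->
  u @ \oo --> 0%E <->
  forall e : R, 0 < e -> \forall n \near \oo, (u n <= e%:E)%E.
Proof.
move=> u0; split=> [/fine_cvgP[fu /cvgr0Pnorm_lt h] e e0|h].
  near=> n.
  have fn : u n \is a fin_num by near: n.
  rewrite -(fineK fn) lee_fin; apply/ltW/(le_lt_trans (ler_norm _)).
  by near: n; exact: h.
have fu : \forall n \near \oo, u n \is a fin_num.
  near=> n; rewrite ge0_fin_numE//.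
  by apply: (@le_lt_trans _ _ 1%:E); [near: n; exact: h|rewrite ltry].
apply/fine_cvgP; split=> //; apply/cvgr0Pnorm_lt => e e0.
near=> n.
have fn : u n \is a fin_num by near: n.
rewrite ger0_norm/= ?fine_ge0//; apply: (@le_lt_trans _ _ (e / 2)); last by lra.
by rewrite -lee_fin fineK//; near: n; apply: h; lra.
Unshelve. all: by end_near. Qed.

Lemma limn_esup_bounded (u : nat -> \bar R) : (limn_esup u < +oo)%E ->
  exists2 c : R, 1 <= c & \forall n \near \oo, (u n <= c%:E)%E.
Proof.
move=> /ereal_inf_lt [_ [V nV <-]] Voo.
pose c := Num.max 1 (fine (ereal_sup (u @` V))).
exists c; first by rewrite le_max lexx.
near=> n; have Vn : V n by near: n.
have : (u n <= ereal_sup (u @` V))%E by apply: ereal_sup_ubound; exists n.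
move: Voo; rewrite /c; case: (ereal_sup _) => [s| |]//= _ h.
  by apply: le_trans h _; rewrite lee_fin le_max lexx orbT.
by apply: le_trans h _; rewrite leNye.
Unshelve. all: by end_near. Qed.

End limits.

Lemma measurable_norm_gt {R : realType} {d : measure_display} {T : measurableType d}
    (f : T -> R) (x : R) :
  measurable_fun setT f -> measurable [set w | (x < `|f w|)%R].
Proof.
move=> mf; rewrite -[X in measurable X]setTI; apply: measurable_fun_ltr => //.
exact: measurableT_comp.
Qed.

Section finite_families.
Context {R : realType} {d : measure_display} {T : measurableType d}.
Context {I : finType} (A : {set I}).

Lemma measurable_bigmax (f : I -> T -> R) (x : R) :
  (forall a, a \in A -> measurable_fun setT (f a)) ->
  measurable_fun setT (fun w => \big[Num.max/x]_(a in A) f a w).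
Proof.
move=> mf; under eq_fun do rewrite -big_filter.
have : forall a, a \in [seq a <- index_enum I | a \in A] -> a \in A.
  by move=> a; rewrite mem_filter => /andP[].
elim: [seq _ <- _ | _] => [_|a s ih sA].
  by under eq_fun do rewrite big_nil; exact: measurable_cst.
under eq_fun do rewrite big_cons; apply: measurable_maxr.
  by apply/mf/sA; rewrite mem_head.
by apply: ih => b bs; apply: sA; rewrite inE bs orbT.
Qed.

Lemma measurable_bigmin (f : I -> T -> R) (g : T -> R) : measurable_fun setT g ->
  (forall a, a \in A -> measurable_fun setT (f a)) ->
  measurable_fun setT (fun w => \big[Num.min/g w]_(a in A) f a w).
Proof.
move=> mg mf; under eq_fun do rewrite -big_filter.
have : forall a, a \in [seq a <- index_enum I | a \in A] -> a \in A.
  by move=> a; rewrite mem_filter => /andP[].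
elim: [seq _ <- _ | _] => [_|a s ih sA].
  by under eq_fun do rewrite big_nil; exact: mg.
under eq_fun do rewrite big_cons; apply: measurable_minr.
  by apply/mf/sA; rewrite mem_head.
by apply: ih => b bs; apply: sA; rewrite inE bs orbT.
Qed.

Lemma measure_bigsetU_le (P : probability T R) (F : I -> set T) :
  (forall a, a \in A -> measurable (F a)) ->
  (P (\big[setU/set0]_(a in A) F a) <= \sum_(a in A) P (F a))%E.
Proof.
move=> mF.
suff [] : measurable (\big[setU/set0]_(a in A) F a) /\
  (P (\big[setU/set0]_(a in A) F a) <= \sum_(a in A) P (F a))%E by [].
apply: (big_ind2 (fun (X : set T) (y : \bar R) => measurable X /\ (P X <= y)%E)).
- by rewrite measure0.
- move=> X x Y y [mX Xx] [mY Yy]; split; first exact: measurableU.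
  by apply: le_trans (measureU2 _ _ _) _ => //; exact: leeD.
by move=> a /mF.
Qed.

End finite_families.

(** * Selection in one sample *)

Lemma bigmax_norm_bound {R : realType} {I : finType} (A : {set I}) (f : I -> R) (e : R) :
  `| \big[Num.max/0]_(a in A) `|f a| | <= e -> forall a, a \in A -> `|f a| <= e.
Proof.
move=> h a aA; apply: le_trans h; apply: le_trans (ler_norm _).
exact: (le_bigmax_cond _ (fun a => `|f a|)).
Qed.

Lemma bigmax_ratio_bound {R : realType} {I : finType} (A : {set I}) (f D : I -> R) (e : R) :
  `| \big[Num.max/0]_(a in A) `|f a / D a| | <= e ->
  forall a, a \in A -> 0 < D a -> `|f a| <= e * D a.
Proof.
move=> /bigmax_norm_bound h a aA D0.
by have := h a aA; rewrite normrM (normfV (D a)) (gtr0_norm D0) ler_pdivrMr.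
Qed.

Section one_sample_selection.
Context {R : realType} {d : measure_display} {T : measurableType d}
        {P : probability T R} {dim k p N : nat} (S : setting P dim k p N)
        (Theta : set 'rV[R]_k) (std : standing_assumptions S Theta)
        (theta0 : 'rV[R]_k) (theta0_in : Theta theta0)
        (spec : Sigma0 S = Sigma S theta0)
        (thetahat : {set 'I_p} -> T -> 'rV[R]_k)
        (ML : ML_estimator S thetahat Theta)
        (thetastar : {set 'I_p} -> 'rV[R]_k)
        (thetastar_in : forall a, a \in incorrect S -> Theta (thetastar a)).
Implicit Types (a : {set 'I_p}) (w : T).

(** The common denominator of (C2) to (C5), and so the scale on which incorrect models are
    compared. *)
Definition excess a : R := risk S a (thetastar a) - L0 S theta0.

Definition center a : 'rV[R]_k := if a \in incorrect S then thetastar a else theta0.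

(** This and the next definitions name the suprema in (C2), (C5) and (C4), so that each smallness
    condition becomes a single event or, for [trace_gap], a single inequality. *)
Definition loglik_gap w : R := sup_incorrect S (fun a =>
  (loglik S a (thetahat a w) w - loglik S a (thetastar a) w) / excess a).
Definition loss_gap w : R := sup_incorrect S (fun a =>
  (loss S a (thetahat a w) w - loss S a (thetastar a) w) / excess a).
Definition cov_gap w : R := sup_incorrect S (fun a =>
  cov_noise S theta0 (thetastar a) w / excess a).
Definition loglik_gap_correct w : R := sup_correct S (fun a =>
  loglik S a (thetahat a w) w - loglik S a theta0 w).
Definition loss_gap_correct w : R := sup_correct S (fun a =>
  loss S a (thetahat a w) w - loss S a theta0 w).
Definition trace_gap : R := sup_incorrect S (fun a =>
  \tr (Sigma0 S *m (invmx (Sigma0 S) - invmx (Sigma S (thetastar a)))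
         *m Mmx S a (thetastar a)) / excess a).

Lemma cand_split a : a \in cand S -> a \notin correct S -> a \in incorrect S.
Proof. by move=> aC aN; rewrite finset.in_setD aN. Qed.

Lemma incorrect_cand a : a \in incorrect S -> a \in cand S.
Proof. by rewrite finset.in_setD => /andP[]. Qed.

Lemma correct_cand a : a \in correct S -> a \in cand S.
Proof. by rewrite finset.inE => /andP[]. Qed.

Lemma correctP a : a \in correct S -> correct_model S a.
Proof. by rewrite finset.inE => /andP[_ /asboolP]. Qed.

Lemma correct_incorrectF a : a \in correct S -> (a \in incorrect S) = false.
Proof. by move=> aC; rewrite finset.in_setD aC. Qed.

Lemma center_in a : Theta (center a).
Proof. by rewrite /center; case: ifPn => // /thetastar_in. Qed.

Lemma measurable_gaps :
  [/\ measurable_fun setT loglik_gap, measurable_fun setT loss_gap,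
      measurable_fun setT cov_gap, measurable_fun setT loglik_gap_correct &
      measurable_fun setT loss_gap_correct].
Proof.
have mcst (t : 'rV[R]_k) :
  measurable_fun setT ((fun=> t) : T -> g_sigma_algebraType (@open 'rV[R]_k)).
  exact: measurable_cst.
have mabs (f : T -> R) : measurable_fun setT f -> measurable_fun setT (fun w => `|f w|).
  exact: measurableT_comp.
split; apply: measurable_bigmax => a aA; apply: mabs.
- have [m1 m2 _] := ML (incorrect_cand aA).
  apply: measurable_funM => //; apply: measurable_funB.
    exact: (measurable_loglik std theta0_in a m1 m2).
  exact: (measurable_loglik std theta0_in a (mcst _) (fun=> thetastar_in aA)).
- have [m1 m2 _] := ML (incorrect_cand aA).
  apply: measurable_funM => //; apply: measurable_funB.
    exact: (measurable_loss std theta0_in a m1 m2).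
  exact: (measurable_loss std theta0_in a (mcst _) (fun=> thetastar_in aA)).
- apply: measurable_funM => //; apply: measurable_trace.
  apply: measurable_mulmx; last exact: measurable_mx_cst.
  apply: measurable_mxB; last exact: measurable_mx_cst.
  apply: measurable_mulmx; last apply: measurable_trmx.
    by move=> i j; rewrite ord1; exact: (measurable_noise std).
  by move=> i j; rewrite ord1; exact: (measurable_noise std).
- have [m1 m2 _] := ML (correct_cand aA); apply: measurable_funB.
    exact: (measurable_loglik std theta0_in a m1 m2).
  exact: (measurable_loglik std theta0_in a (mcst _) (fun=> theta0_in)).
have [m1 m2 _] := ML (correct_cand aA); apply: measurable_funB.
  exact: (measurable_loss std theta0_in a m1 m2).
exact: (measurable_loss std theta0_in a (mcst _) (fun=> theta0_in)).
Qed.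

Variables (delta K : R) (D : {set 'I_p} -> R).

Definition noise_deviation a : set T :=
  [set w | (delta * D a < `|lin_noise S a (center a) w|)%R] `|`
  [set w | (delta * D a < `|quad_noise S a (center a) w - quad_mean S a (center a)|)%R].

(** Off this event the comparison of the models is deterministic. *)
Definition exceptional : set T :=
  [set w | (delta < `|loglik_gap w|)%R] `|` [set w | (delta < `|loss_gap w|)%R] `|`
  [set w | (delta < `|cov_gap w|)%R] `|` [set w | (K < `|loglik_gap_correct w|)%R] `|`
  [set w | (K < `|loss_gap_correct w|)%R] `|`
  \big[setU/set0]_(a in cand S) noise_deviation a.

Hypotheses (delta_gt0 : 0 < delta) (delta_le1 : delta <= 1)
  (D_incorrect : forall a, a \in incorrect S -> D a = excess a)
  (D_correct : forall a, a \in correct S -> (1 + #|a|)%:R / 2 <= D a)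
  (D_large : forall a, a \in cand S -> [/\ 0 < D a, K <= delta * D a & 2 <= delta * D a])
  (trace_small : `|trace_gap| <= delta).

Let L00 : L0 S theta0 = 0 := L0_theta0 std theta0_in spec.

Lemma weight_incorrect a : a \in incorrect S ->
  D a = L0 S (thetastar a) + (quad (invmx (Sigma S (thetastar a))) (bias S a (thetastar a))
                              + quad_mean S a (thetastar a)) / 2.
Proof.
move=> aI; rewrite D_incorrect// /excess L00 subr0.
exact: (riskE std theta0_in spec) (thetastar_in aI).
Qed.

Lemma bias_theta0 a : a \in correct S -> bias S a theta0 = 0.
Proof. by move=> aC; apply: (bias_correct std theta0_in theta0_in (correctP aC)). Qed.

Lemma quad_mean_theta0 a : quad_mean S a theta0 = (1 + #|a|)%:R.
Proof.
rewrite (quad_mean_trace std theta0_in spec)// spec subrr mulmx0 mul0mx.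
by rewrite linear0 subr0.
Qed.

Lemma quad_bias_ge0 a th : Theta th -> 0 <= quad (invmx (Sigma S th)) (bias S a th).
Proof.
move=> Tth; have := psdmx_invmx (Sigma_psd std Tth) (Sigma_unit std Tth).
by case=> _; exact.
Qed.

(** The tail bounds ask only for upper bounds on squared bias and trace, which is why [D] may exceed
    (1 + p(alpha)) / 2 at a correct model; this leaves room for inflating alpha_n^0. *)
Lemma center_bounds a : a \in cand S ->
  quad (invmx (Sigma S (center a))) (bias S a (center a)) <= 2 * D a /\
  quad_mean S a (center a) <= 2 * D a.
Proof.
move=> aC; rewrite /center; case: ifPn => [aI|].
  have Ts := thetastar_in aI; have := weight_incorrect aI.
  have := quad_bias_ge0 a Ts; have := quad_mean_ge0 std theta0_in spec a Ts.
  by have := L0_ge0 std theta0_in spec Ts; lra.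
move=> aN; have aCo : a \in correct S.
  by apply/negPn; apply: contra aN; exact: cand_split.
rewrite bias_theta0// /quad mulmx0 mxE quad_mean_theta0.
by have := D_correct aCo; have [] := D_large aC; lra.
Qed.

Let measurable_noise_mx : measurable_mx (fun w => noise_vec S w).
Proof. by move=> i j; rewrite ord1; exact: (measurable_noise std). Qed.

Let measurable_lin a : measurable [set w | (delta * D a < `|lin_noise S a (center a) w|)%R].
Proof.
apply: measurable_norm_gt; suff h : measurable_mx (fun w =>
    (invmx (Sigma S (center a)) *m bias S a (center a))^T *m noise_vec S w) by exact: (h 0 0).
by apply: measurable_mulmx => //; exact: measurable_mx_cst.
Qed.

Let measurable_quad_dev a : measurable
  [set w | (delta * D a < `|quad_noise S a (center a) w - quad_mean S a (center a)|)%R].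
Proof.
apply: measurable_norm_gt; apply: measurable_funB => //; apply: measurable_quad => //.
Qed.

Lemma measurable_exceptional : measurable exceptional.
Proof.
have [m1 m2 m3 m4 m5] := measurable_gaps.
apply: measurableU; last first.
  by apply: bigsetU_measurable => a _; apply: measurableU.
by do 4 (apply: measurableU; last exact: measurable_norm_gt); exact: measurable_norm_gt.
Qed.

Lemma exceptional_le (c : R) : 1 <= c ->
  (forall th v, Theta th -> quad (Sigma0 S) v <= c * quad (Sigma S th) v) ->
  (P exceptional <= P [set w | (delta < `|loglik_gap w|)%R] +
     P [set w | (delta < `|loss_gap w|)%R] + P [set w | (delta < `|cov_gap w|)%R] +
     P [set w | (K < `|loglik_gap_correct w|)%R] +
     P [set w | (K < `|loss_gap_correct w|)%R] +
     (4 * \sum_(a in cand S) expR (- (delta ^+ 2 / (32 * c) * D a)))%:E)%E.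
Proof.
move=> c1 C1; have c0 : 0 < c := lt_le_trans ltr01 c1.
have [m1 m2 m3 m4 m5] := measurable_gaps.
have mU : measurable (\big[setU/set0]_(a in cand S) noise_deviation a).
  by apply: bigsetU_measurable => a _; apply: measurableU.
have U2 (X Y : set T) (x y : \bar R) : measurable X -> measurable Y ->
    (P X <= x -> P Y <= y -> P (X `|` Y) <= x + y)%E.
  by move=> mX mY Xx Yy; apply: le_trans (measureU2 _ mX mY) _; exact: leeD.
have n1 := measurable_norm_gt delta m1; have n2 := measurable_norm_gt delta m2; have n3 := measurable_norm_gt delta m3.
have n4 := measurable_norm_gt K m4; have n5 := measurable_norm_gt K m5.
have n12 := measurableU _ _ n1 n2; have n13 := measurableU _ _ n12 n3.
have n14 := measurableU _ _ n13 n4; have n15 := measurableU _ _ n14 n5.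
apply: (U2 _ _ _ _ n15 mU).
  apply: (U2 _ _ _ _ n14 n5 _ (lexx _)); apply: (U2 _ _ _ _ n13 n4 _ (lexx _)).
  by apply: (U2 _ _ _ _ n12 n3 _ (lexx _)); exact: (U2 _ _ _ _ n1 n2).
apply: le_trans (measure_bigsetU_le _ _) _ => [a _|]; first exact: measurableU.
rewrite mulr_sumr -sumEFin; apply: lee_sum => a aC.
have [b1 b2] := center_bounds aC; have [D0 _ _] := D_large aC.
(* The linear form decays faster; both rates are lowered to the same one, so that two forms with two
   tails each contribute the factor 4. *)
have kD : expR (- (delta ^+ 2 / (2 * (2 * c)) * D a)) <= expR (- (delta ^+ 2 / (32 * c) * D a)).
  rewrite ler_expR lerN2 ler_pM2r// ler_pM2l ?exprn_gt0// lef_pV2 ?posrE//; lra.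
have h1 := lin_noise_tail std c1 C1 (center_in a) delta_gt0 b1.
have h2 := quad_noise_tail std theta0_in spec c1 C1 (center_in a) delta_gt0 delta_le1 (ltW D0) b2.
apply: le_trans (U2 _ _ _ _ _ _ h1 h2) _ => //.
by rewrite -!EFinD lee_fin; lra.
Qed.

Section outside_exceptional.
Variable w : T.
Hypothesis wE : ~ exceptional w.

Let not_lt (x y : R) : ~ (x < y) -> y <= x.
Proof. by move=> h; rewrite leNgt; apply/negP. Qed.

Lemma regular_noise a : a \in cand S -> `|lin_noise S a (center a) w| <= delta * D a /\
  `|quad_noise S a (center a) w - quad_mean S a (center a)| <= delta * D a.
Proof.
move=> aC; have h : ~ noise_deviation a w.
  by move=> h; apply: wE; right; rewrite -bigcup_pred; exists a.
by split; apply: not_lt => l; apply: h; [left|right].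
Qed.

Lemma regular_gaps : [/\ `|loglik_gap w| <= delta, `|loss_gap w| <= delta,
  `|cov_gap w| <= delta, `|loglik_gap_correct w| <= K & `|loss_gap_correct w| <= K].
Proof.
split; apply: not_lt => l; apply: wE.
- by do 5 left.
- by do 4 left; right.
- by do 3 left; right.
- by do 2 left; right.
by left; right.
Qed.

(** Up to 2, the penalty cancels twice the mean of the quadratic form. In units of delta D the
    errors are 2 and 2 for replacing the estimated parameter in likelihood and loss, 1 from (C5), 2
    from the linear form, 2 from the quadratic form and 2 from (C4); the leftover 2 of the intercept
    is the twelfth unit. *)
Lemma regular_incorrect a : a \in incorrect S ->
  `|GIC S thetahat 2 a w - baseline S w - 2 * loss S a (thetahat a w) w| <= 12 * (delta * D a) /\
  `|loss S a (thetahat a w) w - D a| <= 2 * (delta * D a).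
Proof.
move=> aI; have aC := incorrect_cand aI.
have [D0 _ D2] := D_large aC; have De := D_incorrect aI.
have e0 : 0 < excess a by rewrite -De.
have [g1 g2 g3 _ _] := regular_gaps.
have := regular_noise aC; rewrite /center aI => -[n1 n2].
have := bigmax_ratio_bound g1 aI e0; have := bigmax_ratio_bound g2 aI e0.
have := bigmax_ratio_bound g3 aI e0; have := bigmax_ratio_bound trace_small aI e0.
rewrite -De; have := quad_mean_trace std theta0_in spec a (thetastar_in aI).
set t := \tr _; rewrite natrD => tE ht h3 h2 h1.
have LE := loglik_loss std theta0_in spec a w (thetastar_in aI).
have lE := lossE std theta0_in a w (thetastar_in aI).
have wI := weight_incorrect aI.
move: ht h1 h2 h3 n1 n2; rewrite /GIC !ler_norml.
move=> /andP[? ?] /andP[? ?] /andP[? ?] /andP[? ?] /andP[? ?] /andP[? ?].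
by split; apply/andP; split; lra.
Qed.

Let correct_facts a : a \in correct S ->
  [/\ `|loglik S a (thetahat a w) w - loglik S a theta0 w| <= K,
      `|loss S a (thetahat a w) w - loss S a theta0 w| <= K,
      `|quad_noise S a theta0 w - (1 + #|a|)%:R| <= delta * D a,
      loss S a theta0 w = quad_noise S a theta0 w / 2 &
      - 2 * loglik S a theta0 w - baseline S w =
        2 * loss S a theta0 w - 2 * quad_noise S a theta0 w].
Proof.
move=> aC; have [_ _ _ g4 g5] := regular_gaps.
have := regular_noise (correct_cand aC); rewrite /center correct_incorrectF// => -[_].
rewrite quad_mean_theta0 => n2.
have h4 := bigmax_norm_bound g4 aC; have h5 := bigmax_norm_bound g5 aC.
split=> //.
  rewrite (lossE std theta0_in a w theta0_in) L00 bias_theta0// /quad mulmx0 mxE.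
  by rewrite !add0r.
rewrite (loglik_loss std theta0_in spec a w theta0_in) /cov_noise /lin_noise bias_theta0//.
rewrite subrr !mulmx0 linear0 /dotv trmx0 mul0mx.
have -> : (0 : 'M[R]_1) 0 0 = 0 :> R by rewrite mxE.
by rewrite mulr0 !addr0.
Qed.

Lemma regular_correct a : a \in correct S -> D a = (1 + #|a|)%:R / 2 ->
  `|GIC S thetahat 2 a w - baseline S w - 2 * loss S a (thetahat a w) w| <= 12 * (delta * D a) /\
  `|loss S a (thetahat a w) w - D a| <= 2 * (delta * D a).
Proof.
move=> aC DE; have [D0 D1 D2] := D_large (correct_cand aC).
have [h1 h2 h3 lE LE] := correct_facts aC.
move: h3 h1 h2 DE; rewrite natrD /GIC !ler_norml.
move=> /andP[? ?] /andP[? ?] /andP[? ?] DE.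
by split; apply/andP; split; lra.
Qed.

(** One-sided, since for an inflated alpha_n^0 the weight is merely an upper bound: the nonnegative
    optimism is dropped from the criterion, and K, 2 p(alpha) and the deviations are absorbed into
    multiples of D. *)
Lemma regular_correct_le a : a \in correct S ->
  GIC S thetahat 2 a w - baseline S w <= 8 * D a /\ loss S a (thetahat a w) w <= 3 * D a.
Proof.
move=> aC; have [D0 D1 D2] := D_large (correct_cand aC); have DC := D_correct aC.
have [h1 h2 h3 lE LE] := correct_facts aC.
have q0 : 0 <= quad_noise S a theta0 w by have [_] := quad_noise_psd std theta0_in a theta0_in; exact.
have dD : delta * D a <= D a by rewrite ler_piMl// ltW.
move: h3 h1 h2 DC; rewrite natrD /GIC !ler_norml.
move=> /andP[? ?] /andP[? ?] /andP[? ?] DC.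
by split; lra.
Qed.

End outside_exceptional.

End one_sample_selection.

(** Regularity gives D <= 2 L, so errors relative to D become errors relative to L, and the order of
    the criteria yields L_a (1 - 12 delta) <= L_b (1 + 12 delta). The quotient of these factors is
    at most 1 + 48 delta exactly when delta <= 1 / 24. *)
Lemma near_minimal_ratio {R : realFieldType} (V delta Ga La Da Gb Lb Db : R) :
  0 < delta -> delta <= 24^-1 -> 0 < Da -> 0 < Db ->
  `|Ga - V - 2 * La| <= 12 * (delta * Da) -> `|La - Da| <= 2 * (delta * Da) ->
  `|Gb - V - 2 * Lb| <= 12 * (delta * Db) -> `|Lb - Db| <= 2 * (delta * Db) ->
  Ga <= Gb -> Lb <= La -> `|La / Lb - 1| <= 48 * delta.
Proof.
move=> d0 d1 Da0 Db0; rewrite !ler_norml.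
move=> /andP[a1 _] /andP[a2 _] /andP[_ b1] /andP[b2 _] G L.
have dDa : delta * Da <= 24^-1 * Da by rewrite ler_pM2r.
have dDb : delta * Db <= 24^-1 * Db by rewrite ler_pM2r.
have Lb0 : 0 < Lb by lra.
have La0 : 0 < La by lra.
have La2 : delta * Da <= 2 * (delta * La).
  by rewrite mulrCA ler_pM2l//; lra.
have Lb2 : delta * Db <= 2 * (delta * Lb).
  by rewrite mulrCA ler_pM2l//; lra.
have h : La * (1 - 12 * delta) <= Lb * (1 + 12 * delta) by lra.
have h2 : Lb * (1 + 12 * delta) <= Lb * ((1 + 48 * delta) * (1 - 12 * delta)).
  rewrite ler_pM2l//.
  have dd : delta * delta <= 24^-1 * delta by rewrite ler_pM2r.
  lra.
have La_le : La <= (1 + 48 * delta) * Lb.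
  have s0 : 0 < 1 - 12 * delta by lra.
  rewrite -(ler_pM2r s0); apply: le_trans h _; apply: le_trans h2 _.
  by rewrite mulrA [Lb * _]mulrC.
apply/andP; split.
  rewrite lerBrDr addrC; apply: (@le_trans _ _ 1); first by lra.
  by rewrite ler_pdivlMr// mul1r.
by rewrite lerBlDr addrC ler_pdivrMr.
Qed.

(** * Minimisers of the criterion and of the loss *)

Section criterion_minimiser.
Context {R : realType} {d : measure_display} {T : measurableType d}
        {P : probability T R} {dim k p N : nat} (S : setting P dim k p N)
        (Theta : set 'rV[R]_k) (std : standing_assumptions S Theta)
        (theta0 : 'rV[R]_k) (theta0_in : Theta theta0)
        (spec : Sigma0 S = Sigma S theta0)
        (thetahat : {set 'I_p} -> T -> 'rV[R]_k)
        (ML : ML_estimator S thetahat Theta)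
        (ahat : T -> {set 'I_p}) (ahatP : GIC_selected S thetahat 2 ahat).
Implicit Types (a : {set 'I_p}) (w : T).

Let ahat_cand w : ahat w \in cand S. Proof. by have [] := ahatP. Qed.

Lemma min_loss_le w a : a \in cand S -> min_loss S thetahat w <= loss S a (thetahat a w) w.
Proof.
move=> aC; apply: ge_inf; last by exists a.
by exists 0 => _ [b bC <-]; apply: (loss_ge0 std theta0_in spec); have [_] := ML bC.
Qed.

Lemma min_loss_eq w a : a \in cand S ->
  (forall b, b \in cand S -> loss S a (thetahat a w) w <= loss S b (thetahat b w) w) ->
  min_loss S thetahat w = loss S a (thetahat a w) w.
Proof.
move=> aC h; apply/eqP; rewrite eq_le min_loss_le//=.
by apply: lb_le_inf => [|_ [b bC <-]]; [exists (loss S a (thetahat a w) w); exists a|exact: h].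
Qed.

Lemma min_loss_attained w : exists2 a, a \in cand S &
  min_loss S thetahat w = loss S a (thetahat a w) w.
Proof.
have [a aC h] := @arg_minP _ _ _ (ahat w) (mem (cand S))
  (fun a => loss S a (thetahat a w) w) (ahat_cand w).
by exists a => //; exact: min_loss_eq.
Qed.

Lemma measurable_loss_ratio : measurable_fun setT (loss_ratio S thetahat ahat).
Proof.
have mL a : a \in cand S -> measurable_fun setT (fun w => loss S a (thetahat a w) w).
  by move=> aC; have [m1 m2 _] := ML aC; exact: (measurable_loss std theta0_in a m1 m2).
(* The selected model is random but takes finitely many values. *)
have LE : (fun w => loss S (ahat w) (thetahat (ahat w) w) w) =
    (fun w => \sum_(a in cand S) \1_(ahat @^-1` [set a]) w * loss S a (thetahat a w) w).
  apply/funext => w; rewrite (bigD1 (ahat w))//= big1 ?addr0 => [|b /andP[_ bw]].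
    by rewrite indicE mem_set ?mul1r.
  by rewrite indicE memNset ?mul0r//= => wb; rewrite wb eqxx in bw.
have mA : measurable_fun setT (fun w => loss S (ahat w) (thetahat (ahat w) w) w).
  rewrite LE; under eq_fun do rewrite -big_filter.
  have : forall a, a \in [seq a <- index_enum {set 'I_p} | a \in cand S] -> a \in cand S.
    by move=> a; rewrite mem_filter => /andP[].
  elim: [seq _ <- _ | _] => [_|a s ih sC].
    by under eq_fun do rewrite big_nil; exact: measurable_cst.
  under eq_fun do rewrite big_cons; apply: measurable_funD.
    apply: measurable_funM; last by apply/mL/sC; rewrite mem_head.
    by apply: measurable_indic; have [] := ahatP.
  by apply: ih => b bs; apply: sC; rewrite inE bs orbT.
apply: measurable_funM => //; apply: measurable_funV.
(* The default of the minimum is the loss of the selected model, itself a candidate, so it does not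
   change the value. *)
have -> : min_loss S thetahat = (fun w =>
    \big[Num.min/loss S (ahat w) (thetahat (ahat w) w) w]_(a in cand S) loss S a (thetahat a w) w).
  apply/funext => w; have [a aC aE] := min_loss_attained w.
  apply/eqP; rewrite eq_le; apply/andP; split.
    by apply/bigmin_geP; split=> [|b bC]; exact: min_loss_le.
  by rewrite aE; apply: (bigmin_le_cond _ (fun a => loss S a (thetahat a w) w)).
exact: measurable_bigmin.
Qed.

Variables (delta V : R) (D : {set 'I_p} -> R) (w : T).
Hypotheses (delta_gt0 : 0 < delta) (delta_le : delta <= 24^-1).

Let regular a := [/\ 0 < D a,
  `|GIC S thetahat 2 a w - V - 2 * loss S a (thetahat a w) w| <= 12 * (delta * D a) &
  `|loss S a (thetahat a w) w - D a| <= 2 * (delta * D a)].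

Lemma regular_loss_ratio : (forall a, a \in cand S -> regular a) ->
  `|loss_ratio S thetahat ahat w - 1| <= 48 * delta.
Proof.
move=> reg; have [b bC bE] := min_loss_attained w; rewrite /loss_ratio bE.
have [Da a1 a2] := reg _ (ahat_cand w); have [Db b1 b2] := reg _ bC.
apply: (near_minimal_ratio delta_gt0 delta_le Da Db a1 a2 b1 b2).
  by have [_ _ h] := ahatP; exact: h.
by rewrite -bE; exact: min_loss_le.
Qed.

(** For delta <= 1 / 24 a regular model has centred criterion at least 4 D / 3 and loss at least 11
    D / 12. Once D > 8 D(alpha0), both exceed the bounds assumed for [alpha0]. *)
Lemma dominated_selection alpha0 : alpha0 \in cand S -> 0 < D alpha0 ->
  (forall a, a \in cand S -> a != alpha0 -> regular a /\ 8 * D alpha0 < D a) ->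
  GIC S thetahat 2 alpha0 w - V <= 8 * D alpha0 ->
  loss S alpha0 (thetahat alpha0 w) w <= 3 * D alpha0 ->
  ahat w = alpha0 /\ min_loss S thetahat w = loss S alpha0 (thetahat alpha0 w) w.
Proof.
move=> a0C D0 reg G0 L0.
have far a : a \in cand S -> a != alpha0 ->
    GIC S thetahat 2 alpha0 w < GIC S thetahat 2 a w /\
    loss S alpha0 (thetahat alpha0 w) w < loss S a (thetahat a w) w.
  move=> aC /(reg _ aC) [[Da]]; rewrite !ler_norml => /andP[a1 _] /andP[a2 _] DD.
  have dDa : delta * D a <= 24^-1 * D a by rewrite ler_pM2r.
  by split; lra.
split.
  apply/eqP; apply/negPn/negP => /(far _ (ahat_cand w)) [+ _].
  by apply/negP; rewrite -leNgt; have [_ _ h] := ahatP; exact: h.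
apply: min_loss_eq => // b bC; have [->//|/(far _ bC)[_ /ltW]//] := eqVneq b alpha0.
Qed.

End criterion_minimiser.

Section weights.
Context {R : realType} {d : measure_display} {T : measurableType d}
        {P : probability T R} {dim k p N : nat} (S : setting P dim k p N)
        (Theta : set 'rV[R]_k) (std : standing_assumptions S Theta)
        (theta0 : 'rV[R]_k) (theta0_in : Theta theta0)
        (spec : Sigma0 S = Sigma S theta0)
        (thetahat : {set 'I_p} -> T -> 'rV[R]_k)
        (ML : ML_estimator S thetahat Theta)
        (thetastar : {set 'I_p} -> 'rV[R]_k)
        (thetastar_in : forall a, a \in incorrect S -> Theta (thetastar a))
        (ahat : T -> {set 'I_p}) (ahatP : GIC_selected S thetahat 2 ahat)
        (alpha0 : {set 'I_p}).
Implicit Types (a : {set 'I_p}) (w : T).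

(* The size of alpha0 is inflated to B, since nothing forces its noise term to
   concentrate when alpha0 is small. *)
Definition weight (B : nat) a : R :=
  if a \in incorrect S then excess S theta0 thetastar a
  else if a == alpha0 then (1 + maxn #|a| B)%:R / 2 else (1 + #|a|)%:R / 2.

Lemma weight_incorrectE B a : a \in incorrect S -> weight B a = excess S theta0 thetastar a.
Proof. by rewrite /weight => ->. Qed.

Lemma weight_correctE B a : a \in correct S :\ alpha0 -> weight B a = (1 + #|a|)%:R / 2.
Proof.
by rewrite finset.in_setD1 /weight => /andP[/negbTE -> /correct_incorrectF ->].
Qed.

Lemma weight_alpha0 B : alpha0 \in correct S ->
  weight B alpha0 = (1 + maxn #|alpha0| B)%:R / 2.
Proof. by rewrite /weight => /correct_incorrectF ->; rewrite eqxx. Qed.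

Lemma weight_correct_ge B a : a \in correct S -> (1 + #|a|)%:R / 2 <= weight B a.
Proof.
move=> aC; rewrite /weight correct_incorrectF//; case: eqP => // _.
by rewrite ler_pM2r// ler_nat leq_add2l leq_maxl.
Qed.

(** The first two sums vanish in the limit by sparsity; the last term, that of [alpha0], becomes
    small through the choice of [B]. The factor 1 / 2 on [kappa] comes from the weight of a correct
    model. *)
Lemma sum_weight (B : nat) (kappa : R) : 0 < kappa ->
  \sum_(a in cand S) expR (- (kappa * weight B a)) <=
  \sum_(a in incorrect S) expR (- (kappa * excess S theta0 thetastar a)) +
  \sum_(a in correct S :\ alpha0) expR (- (kappa / 2 * #|a|%:R)) +
  expR (- (kappa / 2 * (1 + B)%:R)).
Proof.
move=> k0; rewrite (bigID (mem (incorrect S)))/= -addrA.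
have -> : \sum_(a in cand S | a \in incorrect S) expR (- (kappa * weight B a)) =
    \sum_(a in incorrect S) expR (- (kappa * excess S theta0 thetastar a)).
  apply: eq_big => a; last by move=> /andP[_ /(weight_incorrectE B) ->].
  by rewrite andb_idl//; exact: incorrect_cand.
rewrite lerD2l (bigID (mem (correct S :\ alpha0)))/=; apply: lerD.
  rewrite (eq_bigl (mem (correct S :\ alpha0))); last first.
    move=> a /=; rewrite andb_idl// => /finset.setD1P[_ aC].
    by rewrite correct_cand// correct_incorrectF.
  apply: ler_sum => a aC; rewrite weight_correctE// ler_expR lerN2.
  rewrite -mulrA ler_pM2l// mulrC ler_pM2r// ler_nat; exact: leq_addl.
rewrite [leRHS](_ : _ = \sum_(a | a == alpha0) expR (- (kappa / 2 * (1 + B)%:R))).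
  rewrite [leLHS]big_mkcond [leRHS]big_mkcond; apply: ler_sum => a _.
  case: ifPn => [/andP[/andP[aC aI] aN]|_]; last by case: ifP.
  have aCo : a \in correct S by apply/negPn; apply: contra aI; exact: cand_split.
  move: aN; rewrite finset.in_setD1 aCo andbT negbK => /eqP aE.
  rewrite aE eqxx weight_alpha0 -?aE// ler_expR lerN2.
  rewrite -mulrA ler_pM2l// mulrC ler_pM2r// ler_nat leq_add2l; exact: leq_maxr.
by rewrite big_pred1_eq.
Qed.

Variables (delta K : R) (B : nat) (w : T).
Hypotheses (delta_gt0 : 0 < delta) (delta_le : delta <= 24^-1)
  (weight_large : forall a, a \in cand S ->
     [/\ 0 < weight B a, K <= delta * weight B a & 2 <= delta * weight B a])
  (trace_small : `|trace_gap S theta0 thetastar| <= delta)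
  (wE : ~ exceptional S theta0 thetahat thetastar delta K (weight B) w).

Let delta_le1 : delta <= 1. Proof. by apply: le_trans delta_le _; lra. Qed.

(** The implication excludes exactly a correct [alpha0] whose size was inflated. *)
Let regular_others a : a \in cand S ->
  (a == alpha0) && (alpha0 \in correct S) ==> (B <= #|alpha0|)%N ->
  [/\ 0 < weight B a,
    `|GIC S thetahat 2 a w - baseline S w - 2 * loss S a (thetahat a w) w|
      <= 12 * (delta * weight B a) &
    `|loss S a (thetahat a w) w - weight B a| <= 2 * (delta * weight B a)].
Proof.
move=> aC h; have [D0 _ _] := weight_large aC.
have [aI|aI] := boolP (a \in incorrect S).
  by have [] := regular_incorrect std theta0_in spec thetastar_in
    (weight_incorrectE B) weight_large trace_small wE aI.
have aCo : a \in correct S by apply/negPn; apply: contra aI; exact: cand_split.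
suff DE : weight B a = (1 + #|a|)%:R / 2.
  by have [] := regular_correct std theta0_in spec weight_large wE aCo DE.
have [aE|aN] := eqVneq a alpha0; last by rewrite weight_correctE// finset.in_setD1 aN.
move: h; rewrite -aE eqxx aCo /= => Ba.
by rewrite [in LHS]aE weight_alpha0 -?aE//; move/maxn_idPl: Ba => ->.
Qed.

Lemma selection_regular : ~~ ((alpha0 \in correct S) && (#|alpha0| < B)%N) ->
  `|loss_ratio S thetahat ahat w - 1| <= 48 * delta.
Proof.
move=> h; apply: (regular_loss_ratio std theta0_in spec ML ahatP delta_gt0 delta_le) => a aC.
apply: regular_others => //; apply/implyP => /andP[_ a0].
by move: h; rewrite a0 -leqNgt.
Qed.

Lemma selection_dominated : alpha0 \in correct S -> (#|alpha0| < B)%N ->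
  (forall a, a \in cand S -> a != alpha0 -> 8 * weight B alpha0 < weight B a) ->
  ahat w = alpha0 /\
  min_loss S thetahat w = loss S alpha0 (thetahat alpha0 w) w.
Proof.
move=> a0 aB far; have [D0 _ _] := weight_large (correct_cand a0).
have [h1 h2] := regular_correct_le std theta0_in spec delta_le1 (@weight_correct_ge B)
  weight_large wE a0.
apply: (dominated_selection std theta0_in spec ML ahatP delta_le (correct_cand a0) D0 _ h1 h2).
by move=> a aC aN; split; [apply: regular_others => //; rewrite (negbTE aN)|exact: far].
Qed.

End weights.

(** * Asymptotics *)

Section asymptotics.
Context {R : realType} {dim k : nat} {disp : nat -> measure_display}
  {T : forall n, measurableType (disp n)} (P : forall n, probability (T n) R)
  {p : nat -> nat} (S : forall n, setting (P n) dim k (p n) n.+1)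
  (Theta : set 'rV[R]_k) (theta0 : 'rV[R]_k)
  (thetahat : forall n, {set 'I_(p n)} -> T n -> 'rV[R]_k)
  (ahat : forall n, T n -> {set 'I_(p n)})
  (alpha0 : forall n, {set 'I_(p n)})
  (thetastar : forall n, {set 'I_(p n)} -> 'rV[R]_k)
  (std : forall n, standing_assumptions (S n) Theta)
  (theta0_in : Theta theta0)
  (spec : forall n, Sigma0 (S n) = Sigma (S n) theta0)
  (ML : forall n, ML_estimator (S n) (thetahat n) Theta)
  (ahatP : forall n, GIC_selected (S n) (thetahat n) 2 (ahat n))
  (thetastar_in : forall n a, a \in incorrect (S n) -> Theta (thetastar n a)).

Lemma covariance_ratio_bounded :
  (limn_esup (fun n => ereal_sup
     [set (lambda_max (invsqrtmx (Sigma (S n) th) *m Sigma0 (S n)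
             *m invsqrtmx (Sigma (S n) th)))%:E | th in Theta]) < +oo)%E ->
  exists2 c : R, 1 <= c & \forall n \near \oo, forall th v, Theta th ->
    quad (Sigma0 (S n)) v <= c * quad (Sigma (S n) th) v.
Proof.
move=> /limn_esup_bounded [c c1 hc]; exists c => //; apply: filterS hc => n hn th v Tth.
have ps := Sigma_psd (std n) Tth; have us := Sigma_unit (std n) Tth.
have s0 : (Sigma0 (S n))^T = Sigma0 (S n).
  by rewrite spec; have [] := Sigma_psd (std n) theta0_in.
apply: le_trans (quad_le_lambda_max_invsqrt v ps us s0) _.
apply: ler_wpM2r; first by have [_] := ps; exact.
rewrite -lee_fin; apply: le_trans hn.
by apply: ereal_sup_ubound; exists th.
Qed.

Hypotheses
  (loglik_gap_op1 : is_op1 P (fun n => loglik_gap (S n) theta0 (@thetahat n) (@thetastar n)))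
  (loss_gap_op1 : is_op1 P (fun n => loss_gap (S n) theta0 (@thetahat n) (@thetastar n)))
  (cov_gap_op1 : is_op1 P (fun n => cov_gap (S n) theta0 (@thetastar n)))
  (loglik_gap_Op1 : is_Op1 P (fun n => loglik_gap_correct (S n) theta0 (@thetahat n)))
  (loss_gap_Op1 : is_Op1 P (fun n => loss_gap_correct (S n) theta0 (@thetahat n)))
  (trace_gap_cvg : (fun n => trace_gap (S n) theta0 (@thetastar n)) @ \oo --> (0 : R)).
Variable c : R.
Hypotheses (c_ge1 : 1 <= c)
  (covariance_ratio : \forall n \near \oo, forall th v, Theta th ->
     quad (Sigma0 (S n)) v <= c * quad (Sigma (S n) th) v)
  (incorrect_sparse :
     sparse (fun n => incorrect (S n)) (fun n => excess (S n) theta0 (@thetastar n)))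
  (correct_sparse : sparse (fun n => correct (S n) :\ alpha0 n) (fun n a => #|a|%:R : R)).

Let w_ n B := weight (S n) theta0 (@thetastar n) (alpha0 n) B.
Arguments w_ : clear implicits.
Let exc n (delta K : R) B :=
  exceptional (S n) theta0 (@thetahat n) (@thetastar n) delta K (w_ n B).
Arguments exc : clear implicits.

Lemma exceptional_small (delta e : R) : 0 < delta -> delta <= 1 -> 0 < e ->
  exists K (B0 : nat), forall B, (B0 <= B)%N -> \forall n \near \oo,
  [/\ (P n (exc n delta K B) <= e%:E)%E,
      forall a, a \in cand (S n) -> [/\ 0 < w_ n B a, K <= delta * w_ n B a & 2 <= delta * w_ n B a],
      `|trace_gap (S n) theta0 (@thetastar n)| <= delta &
      forall a, a \in cand (S n) -> (a \notin correct (S n)) || (a != alpha0 n) ->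
        4 * (1 + B)%:R < w_ n B a].
Proof.
(* Five gaps cost [e / 9] each, and three sums in the union bound cost 4 times [e / 36] each:
   together 8 e / 9. *)
move=> d0 d1 e0; have e9 : 0 < e / 9 by lra.
have e36 : 0 < e / 36 by lra.
have [K1 hK1] := loglik_gap_Op1 e9; have [K2 hK2] := loss_gap_Op1 e9.
pose K := Num.max K1 K2; pose kappa := delta ^+ 2 / (32 * c).
have c0 : 0 < c := lt_le_trans ltr01 c_ge1.
have k0 : 0 < kappa by rewrite divr_gt0 ?exprn_gt0//; lra.
have k2 : 0 < kappa / 2 by lra.
have ek : 0 < kappa * e by rewrite mulr_gt0.
(* The first summand makes delta times the weight of [alpha0] at least |K| + 2; the second makes its
   exponential at most [e / 36], by e^y >= y. *)
pose X := 2 * (`|K| + 2) / delta + 72 / (kappa * e).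
have X1 : 0 <= 2 * (`|K| + 2) / delta.
  by rewrite divr_ge0 ?(ltW d0)//; have := normr_ge0 K; lra.
have X2 : 0 <= 72 / (kappa * e) by rewrite divr_ge0 ?(ltW ek).
exists K, (Num.truncn X) => B B0B.
have XB : X < (1 + B)%:R.
  by apply: lt_le_trans (truncnS_gt X) _; rewrite ler_nat add1n.
have KB : `|K| + 2 <= delta * ((1 + B)%:R / 2).
  have : 2 * (`|K| + 2) / delta <= (1 + B)%:R by apply: le_trans (ltW XB); rewrite lerDl.
  by rewrite ler_pdivrMr//; lra.
have eB : expR (- (kappa / 2 * (1 + B)%:R)) <= e / 36.
  rewrite expRN -[leRHS]invrK lef_pV2 ?posrE ?invr_gt0 ?expR_gt0//.
  apply: le_trans (expR_ge1Dx _); apply: (@le_trans _ _ (kappa / 2 * (1 + B)%:R)); last by lra.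
  have : 72 / (kappa * e) <= (1 + B)%:R by apply: le_trans (ltW XB); rewrite lerDr.
  rewrite ler_pdivrMr// => h; rewrite invf_div ler_pdivrMr//; lra.
have n1 := (cvge0P (fun n => measure_ge0 (P n) _)).1 (loglik_gap_op1 d0) _ e9.
have n2 := (cvge0P (fun n => measure_ge0 (P n) _)).1 (loss_gap_op1 d0) _ e9.
have n3 := (cvge0P (fun n => measure_ge0 (P n) _)).1 (cov_gap_op1 d0) _ e9.
have n4 := (cvgr0Pnorm_lt _).1 trace_gap_cvg _ d0.
(* Twice the separation 4 (1 + B) to be reached, as the weight of a correct model is half of one
   plus its size. *)
pose M := 8 * (1 + B)%:R : R.
have n5 := @incorrect_sparse _ _ M k0 e36; have n6 := @correct_sparse _ _ M k2 e36.
near=> n.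
have h1 : (P n [set w | (delta < `|loglik_gap (S n) theta0 (@thetahat n) (@thetastar n) w|)%R]
  <= (e / 9)%:E)%E by near: n; exact: n1.
have h2 : (P n [set w | (delta < `|loss_gap (S n) theta0 (@thetahat n) (@thetastar n) w|)%R]
  <= (e / 9)%:E)%E by near: n; exact: n2.
have h3 : (P n [set w | (delta < `|cov_gap (S n) theta0 (@thetastar n) w|)%R]
  <= (e / 9)%:E)%E by near: n; exact: n3.
have [_ _ _ m4 m5] := measurable_gaps (std n) theta0_in (@ML n) (@thetastar_in n).
have h4 : (P n [set w | (K < `|loglik_gap_correct (S n) theta0 (@thetahat n) w|)%R]
    <= (e / 9)%:E)%E.
  apply: (@le_trans _ _ (P n [set w |
      (K1 < `|loglik_gap_correct (S n) theta0 (@thetahat n) w|)%R])); last by near: n; exact: hK1.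
  apply: le_measure; rewrite ?inE; [exact: measurable_norm_gt|exact: measurable_norm_gt|].
  by move=> w /=; apply: le_lt_trans; rewrite le_max lexx.
have h5 : (P n [set w | (K < `|loss_gap_correct (S n) theta0 (@thetahat n) w|)%R]
    <= (e / 9)%:E)%E.
  apply: (@le_trans _ _ (P n [set w |
      (K2 < `|loss_gap_correct (S n) theta0 (@thetahat n) w|)%R])); last by near: n; exact: hK2.
  apply: le_measure; rewrite ?inE; [exact: measurable_norm_gt|exact: measurable_norm_gt|].
  by move=> w /=; apply: le_lt_trans; rewrite le_max lexx orbT.
have C1 : forall th v, Theta th -> quad (Sigma0 (S n)) v <= c * quad (Sigma (S n) th) v.
  by near: n.
have [f1 s1] : (forall a, a \in incorrect (S n) -> M < excess (S n) theta0 (@thetastar n) a) /\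
     \sum_(a in incorrect (S n))
        expR (- (kappa * excess (S n) theta0 (@thetastar n) a)) <= e / 36.
  by near: n; exact: n5.
have [f2 s2] : (forall a, a \in correct (S n) :\ alpha0 n -> M < #|a|%:R) /\
     \sum_(a in correct (S n) :\ alpha0 n) expR (- (kappa / 2 * #|a|%:R)) <= e / 36.
  by near: n; exact: n6.
have B1 : 1 <= (1 + B)%:R :> R by rewrite natrD lerDl.
have far a : a \in cand (S n) -> (a \notin correct (S n)) || (a != alpha0 n) ->
    4 * (1 + B)%:R < w_ n B a.
  move=> aC h; have [aCo|aN] := boolP (a \in correct (S n)).
    move: h; rewrite aCo /= => aa.
    have aCa : a \in correct (S n) :\ alpha0 n by rewrite finset.in_setD1 aa.
    by have := f2 _ aCa; rewrite /w_ weight_correctE// natrD /M; lra.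
  have aI := cand_split aC aN.
  by have := f1 _ aI; rewrite /w_ weight_incorrectE// /M; lra.
have wB a : a \in cand (S n) -> (1 + B)%:R / 2 <= w_ n B a.
  move=> aC; have [/(far _ aC)|] := boolP ((a \notin correct (S n)) || (a != alpha0 n)).
    lra.
  rewrite negb_or !negbK => /andP[aCo /eqP aE]; rewrite /w_ aE weight_alpha0 -?aE//.
  by rewrite ler_pM2r// ler_nat leq_add2l leq_maxr.
have wl a : a \in cand (S n) ->
    [/\ 0 < w_ n B a, K <= delta * w_ n B a & 2 <= delta * w_ n B a].
  move=> /wB aB; have : delta * ((1 + B)%:R / 2) <= delta * w_ n B a by rewrite ler_pM2l.
  by have := ler_norm K; have := normr_ge0 K; split; lra.
split=> //; last by apply/ltW; near: n; exact: n4.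
have wi a : a \in incorrect (S n) -> w_ n B a = excess (S n) theta0 (@thetastar n) a.
  exact: weight_incorrectE.
have wc a : a \in correct (S n) -> (1 + #|a|)%:R / 2 <= w_ n B a.
  exact: weight_correct_ge.
apply: le_trans (exceptional_le (std n) theta0_in (spec n) (@ML n) (@thetastar_in n) d0 d1
  wi wc wl c_ge1 C1) _.
have s3 := sum_weight (S n) theta0 (@thetastar n) (alpha0 n) B k0.
rewrite -/kappa.
apply: (@le_trans _ _ ((e / 9)%:E + (e / 9)%:E + (e / 9)%:E + (e / 9)%:E + (e / 9)%:E +
   (4 * (e / 36 + e / 36 + e / 36))%:E)%E).
  apply: leeD; first by do 4 (apply: leeD => //).
  by rewrite lee_fin; move: s3; rewrite -/(w_ n B); lra.
by rewrite -!EFinD lee_fin; lra.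
Unshelve. all: by end_near. Qed.

Let measurable_null n : measurable
  [set w | dotv (invmx (Sigma0 (S n)) *m const_mx 1) (noise_vec (S n) w) = 0].
Proof.
have h : measurable_mx (fun w =>
    (invmx (Sigma0 (S n)) *m const_mx 1 : 'cV_n.+1)^T *m noise_vec (S n) w).
  apply: measurable_mulmx; first exact: measurable_mx_cst.
  by move=> i j; rewrite ord1; exact: (measurable_noise (std n)).
rewrite -[X in measurable X]setTI.
exact: (h 0 0 measurableT [set 0] (measurable_set1 0)).
Qed.

(** The inflated weight of [alpha0 n] is (1 + B) / 2, and 8 times it is the separation 4 (1 + B). *)
Let dominated_far n B : alpha0 n \in correct (S n) -> (#|alpha0 n| < B)%N ->
  (forall a, a \in cand (S n) -> (a \notin correct (S n)) || (a != alpha0 n) ->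
        4 * (1 + B)%:R < w_ n B a) ->
  forall a, a \in cand (S n) -> a != alpha0 n -> 8 * w_ n B (alpha0 n) < w_ n B a.
Proof.
move=> a0 aB far a aC aN; apply: le_lt_trans (far _ aC _); last by rewrite aN orbT.
rewrite /w_ weight_alpha0//; move/ltnW/maxn_idPr: aB => ->; lra.
Qed.

Lemma loss_efficient : asymptotically_loss_efficient S thetahat ahat.
Proof.
move=> e e0; apply/cvge0P => [n|e' e'0]; first exact: measure_ge0.
pose delta := Num.min 24^-1 (e / 48).
have d0 : 0 < delta by rewrite lt_min invr_gt0 ltr0n/= divr_gt0.
have d24 : delta <= 24^-1 by rewrite ge_min lexx.
have d1 : delta <= 1 by apply: le_trans d24 _; lra.
have de : 48 * delta <= e.
  have : delta <= e / 48 by rewrite ge_min lexx orbT.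
  lra.
have [K [B /(_ B (leqnn B)) h]] := exceptional_small d0 d1 e'0.
apply: filterS h => n [Pe wl ts far].
have mE : measurable (exc n delta K B).
  exact: (measurable_exceptional (std n) theta0_in (@ML n) (@thetastar_in n)).
have mN := measurable_null n.
apply: (@le_trans _ _ (P n (exc n delta K B `|`
    [set w | dotv (invmx (Sigma0 (S n)) *m const_mx 1) (noise_vec (S n) w) = 0]))); last first.
  apply: le_trans (measureU2 _ mE mN) _.
  rewrite -[leRHS]adde0; apply: leeD => //.
  by have /= -> := noise_const_null (std n) theta0_in (spec n) isT.
apply: le_measure; rewrite ?inE.
- apply: measurable_norm_gt; apply: measurable_funB => //.
  exact: (measurable_loss_ratio (std n) theta0_in (spec n) (@ML n) (ahatP n)).
- exact: measurableU.
move=> w /= ew; have [|wE] := pselect (exc n delta K B w); [by left|right].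
(* This split depends on n: [alpha0 n] may fall on either side of the threshold for infinitely many
   n. *)
have [/andP[a0 aB]|hB] := boolP ((alpha0 n \in correct (S n)) && (#|alpha0 n| < B)%N); last first.
  have := selection_regular (std n) theta0_in (spec n) (@ML n) (@thetastar_in n) (ahatP n)
    d0 d24 wl ts wE hB.
  by move=> /le_trans/(_ de); rewrite leNgt ew.
have [aE mE'] := selection_dominated (std n) theta0_in (spec n) (@ML n) (@thetastar_in n) (ahatP n)
  d24 wl ts wE a0 aB (dominated_far a0 aB far).
have [_ Th _] := ML (correct_cand a0).
apply: (@loss_eq0 _ _ _ _ _ _ _ _ _ _ (std n) _ theta0_in (spec n) (alpha0 n) _ w (Th w)).
(* In this case [alpha0 n] is selected and attains the minimal loss, so a nonzero loss makes the
   ratio exactly 1. *)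
apply/eqP/negPn/negP => l0.
by move: ew; rewrite /loss_ratio aE mE' divff// subrr normr0 ltNge (ltW e0).
Qed.

Lemma selection_consistent : (\forall n \near \oo, alpha0 n \in correct (S n)) ->
  (limn_esup (fun n => (#|alpha0 n|%:R : R)%:E) < +oo)%E -> consistent P alpha0 ahat.
Proof.
move=> a0C /limn_esup_bounded [b b1 hb].
have mA n : measurable (@ahat n @^-1` [set alpha0 n]) by have [] := ahatP n.
have h0 : (fun n => P n (~` (@ahat n @^-1` [set alpha0 n]))) @ \oo --> 0%E.
  apply/cvge0P => [n|e e0]; first exact: measure_ge0.
  have d0 : 0 < 24^-1 :> R by rewrite invr_gt0.
  have d1 : 24^-1 <= 1 :> R by lra.
  have [K [B0 h]] := exceptional_small d0 d1 e0.
  (* Above the eventual bound on the size, so that [alpha0 n] always falls in the inflated case. *)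
  pose B := maxn B0 (Num.truncn b).+1.
  have {}h := h B (leq_maxl _ _).
  near=> n.
  have [Pe wl ts far] : [/\ (P n (exc n 24^-1 K B) <= e%:E)%E,
      forall a, a \in cand (S n) ->
        [/\ 0 < w_ n B a, K <= 24^-1 * w_ n B a & 2 <= 24^-1 * w_ n B a],
      `|trace_gap (S n) theta0 (@thetastar n)| <= 24^-1 &
      forall a, a \in cand (S n) -> (a \notin correct (S n)) || (a != alpha0 n) ->
        4 * (1 + B)%:R < w_ n B a] by near: n; exact: h.
  have a0 : alpha0 n \in correct (S n) by near: n.
  have aB : (#|alpha0 n| < B)%N.
    have : (#|alpha0 n|%:R : R) <= b by rewrite -lee_fin; near: n; exact: hb.
    move=> /le_lt_trans/(_ (truncnS_gt b)); rewrite ltr_nat => /leq_trans; apply.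
    exact: leq_maxr.
  apply: le_trans Pe; apply: le_measure; rewrite ?inE.
  - exact: measurableC.
  - exact: (measurable_exceptional (std n) theta0_in (@ML n) (@thetastar_in n)).
  move=> w /= aN; apply: contrapT => wE; apply: aN.
  by have [] := selection_dominated (std n) theta0_in (spec n) (@ML n) (@thetastar_in n) (ahatP n)
    (lexx _) wl ts wE a0 aB (dominated_far a0 aB far).
rewrite /consistent.
have -> : (fun n => P n (@ahat n @^-1` [set alpha0 n])) =
    (fun n => (1 - P n (~` (@ahat n @^-1` [set alpha0 n])))%E).
  by apply/funext => n; rewrite -probability_setC ?setCK//; exact: measurableC.
rewrite -[1%E in X in _ --> X]sube0; apply: cvgeB => //; exact: cvg_cst.
Unshelve. all: by end_near. Qed.

End asymptotics.

Unset Implicit Arguments.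

Theorem theorem3p1 (R : realType) (dim k : nat)
  (disp : nat -> measure_display) (T : forall n, measurableType (disp n))
  (P : forall n, probability (T n) R) (p : nat -> nat)
  (S : forall n, setting (P n) dim k (p n) n.+1)
  (Theta : set 'rV[R]_k) (theta0 : 'rV[R]_k)
  (thetahat : forall n, {set 'I_(p n)} -> T n -> 'rV[R]_k)
  (ahat2 : forall n, T n -> {set 'I_(p n)})
  (alpha0 : forall n, {set 'I_(p n)})
  (thetastar : {fset nat} -> 'rV[R]_k)
  (standing : forall n, standing_assumptions (S n) Theta)
  (theta0_in : Theta theta0)
  (well_specified : forall n, Sigma0 (S n) = Sigma (S n) theta0)
  (thetahat_ML : forall n, ML_estimator (S n) (thetahat n) Theta)
  (alpha0_min : forall n, correct (S n) != finset.set0 ->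
    smallest_correct (S n) (alpha0 n))
  (ahat2_AIC : forall n, GIC_selected (S n) (thetahat n) 2 (ahat2 n))
  (C1_min : forall n th, Theta th -> 0 < lambda_min (Sigma (S n) th))
  (C1_max : (limn_esup (fun n => ereal_sup
     [set (lambda_max (invsqrtmx (Sigma (S n) th) *m Sigma0 (S n)
             *m invsqrtmx (Sigma (S n) th)))%:E | th in Theta]) < +oo)%E)
  (thetastar_in : forall n (a : {set 'I_(p n)}), a \in incorrect (S n) ->
    Theta (thetastar (model_index a)))
  (C2_loglik : is_op1 P (fun n w => sup_incorrect (S n) (fun a =>
     (loglik (S n) a (thetahat n a w) w
        - loglik (S n) a (thetastar (model_index a)) w)
     / (risk (S n) a (thetastar (model_index a)) - L0 (S n) theta0))))
  (C2_loss : is_op1 P (fun n w => sup_incorrect (S n) (fun a =>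
     (loss (S n) a (thetahat n a w) w
        - loss (S n) a (thetastar (model_index a)) w)
     / (risk (S n) a (thetastar (model_index a)) - L0 (S n) theta0))))
  (C2_loglik_correct : is_Op1 P (fun n w => sup_correct (S n) (fun a =>
     loglik (S n) a (thetahat n a w) w - loglik (S n) a theta0 w)))
  (C2_loss_correct : is_Op1 P (fun n w => sup_correct (S n) (fun a =>
     loss (S n) a (thetahat n a w) w - loss (S n) a theta0 w)))
  (C3 : exists2 q : R, 0 < q &
     (fun n => \sum_(a in incorrect (S n))
        (((risk (S n) a (thetastar (model_index a)) - L0 (S n) theta0)
            `^ q)%:E)^-1)%E @ \oo --> 0%E)
  (C4 : (fun n => sup_incorrect (S n) (fun a =>
     \tr (Sigma0 (S n)
            *m (invmx (Sigma0 (S n))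
                  - invmx (Sigma (S n) (thetastar (model_index a))))
            *m Mmx (S n) a (thetastar (model_index a)))
     / (risk (S n) a (thetastar (model_index a)) - L0 (S n) theta0)))
     @ \oo --> (0 : R))
  (C5 : is_op1 P (fun n w => sup_incorrect (S n) (fun a =>
     \tr ((noise_vec (S n) w *m (noise_vec (S n) w)^T - Sigma0 (S n))
            *m (invmx (Sigma (S n) (thetastar (model_index a)))
                  - invmx (Sigma (S n) theta0)))
     / (risk (S n) a (thetastar (model_index a)) - L0 (S n) theta0)))) :
  let bounded_alpha0 :=
    (limn_esup (fun n => (#|alpha0 n|%:R : R)%:E) < +oo)%E in
  let cond_a := exists2 m : R, 0 < m &
    (fun n => \sum_(a in correct (S n)) (((#|a|%:R : R) `^ m)%:E)^-1)%E
      @ \oo --> 0%E in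
  let cond_b := exists2 m : R, 0 < m &
    (fun n => \sum_(a in correct (S n) :\ alpha0 n)
       (((#|a|%:R - #|alpha0 n|%:R : R) `^ m)%:E)^-1)%E @ \oo --> 0%E in
  ((forall n, (#|correct (S n)| <= 1)%N) ->
     asymptotically_loss_efficient S thetahat ahat2 /\
     ((forall n, #|correct (S n)| = 1%N) -> bounded_alpha0 ->
        consistent P alpha0 ahat2))
  /\
  ((\forall n \near \oo, (2 <= #|correct (S n)|)%N) ->
     (cond_a \/ cond_b -> asymptotically_loss_efficient S thetahat ahat2) /\
     (cond_b -> bounded_alpha0 -> consistent P alpha0 ahat2)).
Proof.
move=> bounded_alpha0 cond_a cond_b.
pose ths n (a : {set 'I_(p n)}) := thetastar (model_index a).
have ths_in n (a : {set 'I_(p n)}) : a \in incorrect (S n) -> Theta (ths n a).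
  exact: thetastar_in.
have [c c1 cov] := covariance_ratio_bounded standing theta0_in well_specified C1_max.
have [q q0 C3'] := C3.
have inc : sparse (fun n => incorrect (S n)) (fun n => excess (S n) theta0 (ths n)).
  exact: inv_powR_sum_sparse q0 C3'.
pose others n := correct (S n) :\ alpha0 n.
have eff : sparse others (fun n a => #|a|%:R : R) ->
    asymptotically_loss_efficient S thetahat ahat2.
  by move=> sp; apply: (loss_efficient standing theta0_in well_specified thetahat_ML
    ahat2_AIC ths_in C2_loglik C2_loss C5 C2_loglik_correct C2_loss_correct C4 c1 cov inc sp).
have cons : sparse others (fun n a => #|a|%:R : R) ->
    (\forall n \near \oo, alpha0 n \in correct (S n)) ->
    bounded_alpha0 -> consistent P alpha0 ahat2.
  by move=> sp; apply: (selection_consistent standing theta0_in well_specified thetahat_ML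
    ahat2_AIC ths_in C2_loglik C2_loss C5 C2_loglik_correct C2_loss_correct C4 c1 cov inc sp).
have a0C n : correct (S n) != finset.set0 -> alpha0 n \in correct (S n).
  by move=> /alpha0_min[].
have sp_a : cond_a -> sparse others (fun n a => #|a|%:R : R).
  move=> [m m0 h]; apply: (sparse_le (inv_powR_sum_sparse m0 h)); apply: nearW => n; split=> //.
  exact: finset.subD1set.
have sp_b : cond_b -> sparse others (fun n a => #|a|%:R : R).
  (* (b) gives sparsity for the size differences, and the sizes themselves are larger. *)
  move=> [m m0 h]; apply: (sparse_le (inv_powR_sum_sparse m0 h)); apply: nearW => n; split=> // a _.
  by rewrite lerBlDr lerDl.
split=> [C1le|C2ge].
  have sp : sparse others (fun n a => #|a|%:R : R).
    (* With at most one correct model there is none besides [alpha0 n]; if there is none at all, the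
       value of [alpha0 n] is arbitrary and the family is still empty. *)
    apply: sparse_set0; apply: nearW => n; apply/eqP.
    have [C0|/a0C a0] := eqVneq (correct (S n)) finset.set0.
      by rewrite /others C0 finset.set0D.
    rewrite -cards_eq0 -leqn0 -ltnS (leq_trans _ (C1le n))//.
    by rewrite [in leqRHS](cardsD1 (alpha0 n)) a0 add1n.
  split=> [|C1 b]; first exact: eff.
  by apply: cons => //; apply: nearW => n; apply: a0C; rewrite -cards_eq0 C1.
split=> [[/sp_a|/sp_b]|/sp_b sp b]; [exact: eff|exact: eff|].
apply: cons => //; apply: filterS C2ge => n C2n; apply: a0C.
by rewrite -cards_eq0 -lt0n (leq_trans _ C2n).
Qed.
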